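(* There is a constant $K>0$ such that the following holds. Let $x\in B_4$ be a braid which is pseudo-Anosov and rigid with respect to the dual Garside structure $BKL_4$. Then the set of sliding circuits $SC(x)$ with respect to $BKL_4$ satisfies $\#SC(x)\le K\,\ell(x)^2$.
   Context: Dual (Birman–Ko–Lee) Garside structure $BKL_4$ on $B_4$. - Generators: the braids $a_{p,q}$ ($1\le p<q\le4$) given by $a_{p,p+1}=\sigma_p$, $a_{1,3}=\sigma_2^{-1}\sigma_1\sigma_2$, $a_{2,4}=\sigma_3^{-1}\sigma_2\sigma_3$ and $a_{1,4}=\sigma_3^{-1}\sigma_2^{-1}\sigma_1\sigma_2\sigma_3$. - Order: $x\preccurlyeq y$ iff $x^{-1}y$ lies in the monoid generated by the $a_{p,q}$. This order is a lattice order, and $\wedge$ denotes the greatest common prefix. - Garside element: $\delta=\sigma_1\sigma_2\sigma_3$. The simple elements are the $s$ with $1\preccurlyeq s\preccurlyeq\delta$. - Notation: $\tau(u)=\delta^{-1}u\delta$, $\partial(s)=s^{-1}\delta$, and $x^z=z^{-1}xz$. - Left-weighted pair: a pair $s_1s_2$ of simple elements is left-weighted if $\partial(s_1)\wedge s_2=1$. - Normal form: every $x$ has a unique left normal form $x=\delta^p x_1\cdots x_r$, where $p$ is maximal with $\delta^p\preccurlyeq x$, the $x_i$ are simple and different from $1$ and $\delta$, and each pair $x_ix_{i+1}$ is left-weighted. One sets $\inf(x)=p$ and calls $\ell(x)=r$ the canonical length. - For $r\ge1$: $\iota(x)=\tau^{-p}(x_1)$ and $\varphi(x)=x_r$. -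 Rigidity: $x$ is rigid if $r\ge1$ and the pair $\varphi(x)\iota(x)$ is left-weighted. - Cyclic sliding: $\mathfrak s(x)=x^{\mathfrak p(x)}$ with $\mathfrak p(x)=\iota(x)\wedge\partial(\varphi(x))$, and $\mathfrak s(x)=x$ if $r=0$. - Sliding circuits: $SC(x)$ is the set of conjugates $y$ of $x$ with $\mathfrak s^k(y)=y$ for some $k\ge1$. - Pseudo-Anosov: in the sense of the Nielsen–Thurston classification of $B_4$ as the mapping class group of the 4-punctured disk. *)

(* Defs.v *)
(* The braid group B_4 is modelled by words in sigma_1^{+-1}, sigma_2^{+-1},
   sigma_3^{+-1}; group equality [beq] is the congruence generated by the
   standard Artin presentation. *)
From HB Require Import structures.
From mathcomp Require Import all_boot all_order all_algebra.
From Stdlib Require Import Relations.Relation_Operators.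
Set Implicit Arguments.
Unset Strict Implicit.
Unset Printing Implicit Defensive.

(* (i, true) = sigma_(i+1), (i, false) = sigma_(i+1)^-1 *)
Definition letter := ('I_3 * bool)%type.
Definition word := seq letter.

Definition g1 : 'I_3 := inord 0.
Definition g2 : 'I_3 := inord 1.
Definition g3 : 'I_3 := inord 2.

Definition sg (i : 'I_3) : word := [:: (i, true)].
Definition winv (w : word) : word := rev (map (fun l : letter => (l.1, ~~ l.2)) w).

Inductive brel : word -> word -> Prop :=
| br_free (i : 'I_3) (b : bool) : brel [:: (i, b); (i, ~~ b)] [::]
| br_comm : brel (sg g1 ++ sg g3) (sg g3 ++ sg g1)
| br_12 : brel (sg g1 ++ sg g2 ++ sg g1) (sg g2 ++ sg g1 ++ sg g2)
| br_23 : brel (sg g2 ++ sg g3 ++ sg g2) (sg g3 ++ sg g2 ++ sg g3).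

Inductive bstep : word -> word -> Prop :=
| bstep_intro (u v l r : word) : brel l r -> bstep (u ++ l ++ v) (u ++ r ++ v).

Definition beq : word -> word -> Prop := clos_refl_sym_trans word bstep.

Definition conjw (x z : word) : word := winv z ++ x ++ z.

Definition delta : word := sg g1 ++ sg g2 ++ sg g3.

Definition dpow (k : int) : word :=
  match k with
  | Posz n => flatten (nseq n delta)
  | Negz n => flatten (nseq n.+1 (winv delta))
  end.

Definition a12 : word := sg g1.
Definition a23 : word := sg g2.
Definition a34 : word := sg g3.
Definition a13 : word := winv (sg g2) ++ sg g1 ++ sg g2.
Definition a24 : word := winv (sg g3) ++ sg g2 ++ sg g3.
Definition a14 : word := winv (sg g3) ++ winv (sg g2) ++ sg g1 ++ sg g2 ++ sg g3.
Definition bkl_gens : seq word := [:: a12; a23; a34; a13; a24; a14].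

Definition bkl_pos (y : word) : Prop :=
  exists l : seq word, (forall g, g \in l -> g \in bkl_gens) /\ beq y (flatten l).

Definition bprefix (x y : word) : Prop := bkl_pos (winv x ++ y).

Definition is_meet (a b g : word) : Prop :=
  bprefix g a /\ bprefix g b /\ (forall h, bprefix h a -> bprefix h b -> bprefix h g).

Definition simple (s : word) : Prop := bprefix [::] s /\ bprefix s delta.

Definition tau_pow (k : int) (u : word) : word := dpow (- k)%R ++ u ++ dpow k.

Definition dpartial (s : word) : word := winv s ++ delta.

Definition left_weighted (s1 s2 : word) : Prop := is_meet (dpartial s1) s2 [::].

Definition left_nf (x : word) (p : int) (xs : seq word) : Prop :=
  beq x (dpow p ++ flatten xs) /\
  bprefix (dpow p) x /\
  (forall q : int, bprefix (dpow q) x -> (q <= p)%R) /\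
  (forall s, s \in xs -> simple s /\ ~ beq s [::] /\ ~ beq s delta) /\
  (forall i, i.+1 < size xs -> left_weighted (nth [::] xs i) (nth [::] xs i.+1)).

(* rigidity, read off the (unique) left normal form (p, xs):
   r >= 1 and phi(x) iota(x) is left-weighted, iota(x) = tau^-p (x_1) *)
Definition rigid_nf (p : int) (xs : seq word) : Prop :=
  match xs with
  | [::] => False
  | x1 :: rest => left_weighted (last x1 rest) (tau_pow (- p)%R x1)
  end.

Definition rigid (x : word) : Prop := exists p xs, left_nf x p xs /\ rigid_nf p xs.

Definition cyc_sliding (x y : word) : Prop :=
  exists p xs, left_nf x p xs /\
   ((xs = [::] /\ beq y x) \/
    (exists x1 rest g, xs = x1 :: rest /\
       is_meet (tau_pow (- p)%R x1) (dpartial (last x1 rest)) g /\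
       beq y (conjw x g))).

Fixpoint sliding_iter (k : nat) (x y : word) : Prop :=
  match k with
  | 0 => beq x y
  | k'.+1 => exists z, cyc_sliding x z /\ sliding_iter k' z y
  end.

Definition in_SC (x y : word) : Prop :=
  (exists z, beq y (conjw x z)) /\ (exists k, 0 < k /\ sliding_iter k y y).

(* Free group F_4 on x_1..x_4 = pi_1 of the 4-punctured disk; (k,true) = x_k *)
Definition fletter := (nat * bool)%type.
Definition fword := seq fletter.
Definition finv (w : fword) : fword := rev (map (fun l : fletter => (l.1, ~~ l.2)) w).
Definition fcons (a : fletter) (w : fword) : fword :=
  match w with
  | b :: t => if (a.1 == b.1) && (a.2 != b.2) then t else a :: w
  | [::] => [:: a]
  end.
Definition freduce (w : fword) : fword := foldr fcons [::] w.
Definition fconj (u v : fword) : Prop :=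
  exists g : fword, freduce u = freduce (finv g ++ v ++ g).

Definition gen_img (l : letter) (k : nat) : fword :=
  let i := (val l.1).+1 in
  if l.2 then
    (if k == i then [:: (i, true); (i.+1, true); (i, false)]
     else if k == i.+1 then [:: (i, true)] else [:: (k, true)])
  else
    (if k == i then [:: (i.+1, true)]
     else if k == i.+1 then [:: (i.+1, false); (i, true); (i.+1, true)]
     else [:: (k, true)]).
Definition fsubst (phi : nat -> fword) (u : fword) : fword :=
  flatten (map (fun a : fletter => if a.2 then phi a.1 else finv (phi a.1)) u).
Definition artin (w : word) (u : fword) : fword :=
  foldr (fun l acc => fsubst (gen_img l) acc) u w.

(* round curves: (i,j) surrounds punctures i..j; essential: 2 <= j-i+1 <= 3 *)
Definition curve := (nat * nat)%type.
Definition round (c : curve) : bool :=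
  [&& 1 <= c.1, c.1 < c.2, c.2 <= 4 & c.2 - c.1 <= 2].
Definition bword (c : curve) : fword := [seq (k, true) | k <- iota c.1 (c.2 - c.1).+1].
Definition noncross (c d : curve) : bool :=
  [|| c.2 < d.1, d.2 < c.1, (c.1 <= d.1) && (d.2 <= c.2) | (d.1 <= c.1) && (c.2 <= d.2)].

(* x preserves (up to isotopy) the nonempty curve system a(C), C round *)
Definition reducible (x : word) : Prop :=
  exists (a : word) (C : seq curve),
    C != [::] /\ all round C /\
    (forall c d, c \in C -> d \in C -> noncross c d) /\
    (forall c, c \in C -> exists2 d, d \in C &
        fconj (artin (conjw x a) (bword c)) (bword d)).

(* some power of x is a power of Delta^2 = delta^4 *)
Definition periodic (x : word) : Prop :=
  exists (m : nat) (k : int), 0 < m /\ beq (flatten (nseq m x)) (dpow (4%:Z * k)%R).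

Definition pseudo_anosov (x : word) : Prop := ~ periodic x /\ ~ reducible x.

(* Main.v *)
Require Import Defs.
From HB Require Import structures.
From mathcomp Require Import all_boot all_order all_algebra.
From mathcomp Require Import zify.
From Stdlib Require Import Relations.Relation_Operators Classical.
Set Implicit Arguments.
Unset Strict Implicit.
Unset Printing Implicit Defensive.
Import Order.TTheory GRing.Theory Num.Theory.

(** Braids are represented by their left normal forms, so that sliding
    and rigidity become statements about the prefix order.  The product of n consecutive
    sliding conjugators of y is the meet of the elements
    y^(a-b) delta^(-a inf y + b sup y + c) with a + b + c = n; on a circuit this forces
    inf and sup to be optimal in the conjugacy class, and then y is rigid as soon as it has
    a rigid conjugate.  Rigid conjugates are connected by conjugations by prefixes of the
    initial factor or of the complement of the final factor.  Writing y as a periodic row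
    of letters, the full factors act by shift and by shift composed with tau; a proper
    prefix exists only if all letters have length 2 (length 1 for the complement, a case
    exchanged with the former by inversion) and produces a "strip" between two rows.
    Rows containing a product of two disjoint atoms have at most two strips.  Along a
    non-backtracking path of strips the local types of the letters stabilise after O(r)
    rows, after which the path is periodic with period O(r), so such rows are determined
    by the number of steps, the first atom and a shift.  When some row consists of
    3-cycles only, every row is at most two strips away from it, up to shifts.  This
    leaves O(r^2) rigid conjugates. *)

(** * Simple elements *)

(** Left normal forms carry a left action of the simple elements, which makes them a group; words
    are shown to agree with their normal forms, so every local question becomes a finite check over
    14 elements. On a circuit, optimality of inf is a length argument. If some conjugate had larger
    inf, the product of n cyclings would contain n copies of $\delta$, of length 3 each, up to a
    bounded error, while n initial factors different from $\delta$ have length at most 2n. In the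
    count the obstacle is branching. A product of disjoint atoms has only two atoms below it, one of
    which is spent on the way back, so a path has no choice after its first atom. A 3-cycle has
    three atoms below it. Classes with a row of 3-cycles alone are therefore treated apart; there,
    paths soon retrace themselves. Periods have two sources: $\tau^4 = 1$ turns the twisted period r
    into 4r, and in the stable regime one family of atoms is conjugated by a fixed one inside the
    symmetric group $S_4$, whose exponent is 12. The square in the bound is O(r) path lengths times
    O(r) shifts. *)

(* The 14 simple elements, named after the non-trivial blocks of the
   corresponding non-crossing partition of {1,2,3,4}. *)
Inductive simp : Set :=
  | sI | s12 | s23 | s34 | s14 | s13 | s24
  | s123 | s234 | s134 | s124 | s12_34 | s14_23 | sD.

Definition allS : seq simp :=
  [:: sI; s12; s23; s34; s14; s13; s24;
      s123; s234; s134; s124; s12_34; s14_23; sD].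

Definition simp_code (s : simp) : nat :=
  match s with
  | sI => 0 | s12 => 1 | s23 => 2 | s34 => 3 | s14 => 4 | s13 => 5 | s24 => 6
  | s123 => 7 | s234 => 8 | s134 => 9 | s124 => 10 | s12_34 => 11
  | s14_23 => 12 | sD => 13
  end.

Lemma simp_codeK : cancel simp_code (nth sI allS).
Proof. by case. Qed.

HB.instance Definition _ := Countable.copy simp (can_type simp_codeK).

Lemma mem_allS s : s \in allS.
Proof. by case: s. Qed.

Lemma forallS (P : pred simp) : all P allS -> forall s, P s.
Proof. by move=> /allP h s; apply: h; apply: mem_allS. Qed.

Lemma forallS2 (P : simp -> simp -> bool) :
  all (fun s => all (P s) allS) allS -> forall s t, P s t.
Proof. by move=> h s; apply: forallS; apply: (forallS (P := fun s => all (P s) allS)). Qed.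

Lemma forallS3 (P : simp -> simp -> simp -> bool) :
  all (fun s => all (fun t => all (P s t) allS) allS) allS ->
  forall s t u, P s t u.
Proof.
by move=> h s t; apply: forallS; apply: (forallS2 (P := fun s t => all (P s t) allS)).
Qed.

(* One-line notation of the underlying permutation of {0,1,2,3}; products are
   composed from left to right. *)
Definition sperm (s : simp) : seq nat :=
  match s with
  | sI => [:: 0; 1; 2; 3] | s12 => [:: 1; 0; 2; 3] | s23 => [:: 0; 2; 1; 3]
  | s34 => [:: 0; 1; 3; 2] | s14 => [:: 3; 1; 2; 0] | s13 => [:: 2; 1; 0; 3]
  | s24 => [:: 0; 3; 2; 1] | s123 => [:: 2; 0; 1; 3] | s234 => [:: 0; 3; 1; 2]
  | s134 => [:: 3; 1; 0; 2] | s124 => [:: 3; 0; 2; 1] | s12_34 => [:: 1; 0; 3; 2]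
  | s14_23 => [:: 3; 2; 1; 0] | sD => [:: 3; 0; 1; 2]
  end.

(** The reflection length of [sperm s]; prefixes of a simple element are the factorizations on which
    it is additive. *)
Definition slen (s : simp) : nat :=
  match s with
  | sI => 0 | s12 | s23 | s34 | s14 | s13 | s24 => 1 | sD => 3 | _ => 2
  end.

Definition sprod (s t : simp) : seq nat := [seq nth 0 (sperm t) i | i <- sperm s].

(* [sprd s t u]: the product of s and t is the simple element u *)
Definition sprd (s t u : simp) : bool :=
  (slen s + slen t == slen u) && (sprod s t == sperm u).

(* Binary operations are tabulated once, so that the finite verifications
   below are table lookups. *)
Definition tabulate (A : Type) (f : simp -> simp -> A) : seq (seq A) :=
  [seq [seq f s t | t <- allS] | s <- allS].
Definition lookup (A : Type) (d : A) (tab : seq (seq A)) (s t : simp) : A :=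
  nth d (nth [::] tab (simp_code s)) (simp_code t).

(** Where the product is not simple, [find] runs off the list and the entry is the default [sI];
    hence the guards [sle t (sdual s)] below. *)
Definition smul_tab : seq (seq simp) :=
  Eval vm_compute in tabulate (fun s t => nth sI allS (find (sprd s t) allS)).
Definition smul : simp -> simp -> simp := lookup sI smul_tab.
Definition squo_tab : seq (seq simp) := Eval vm_compute in
  tabulate (fun s u => nth sI allS (find (fun t => sprd s t u) allS)).
Definition squo : simp -> simp -> simp := lookup sI squo_tab.
Definition sle_tab : seq (seq bool) :=
  Eval vm_compute in tabulate (fun s u => has (fun t => sprd s t u) allS).
Definition sle : simp -> simp -> bool := lookup false sle_tab.
(** [allS] is ordered by increasing length, so the last common prefix is the greatest one. *)
Definition smeet_tab : seq (seq simp) := Eval vm_compute in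
  tabulate (fun s t => last sI [seq u <- allS | sle u s && sle u t]).
Definition smeet : simp -> simp -> simp := lookup sI smeet_tab.
Definition sdual (s : simp) : simp := squo s sD.
(** The square of the complement is conjugation by $\delta$. Consequently [scodual s], which is
    $\tau^{-1}$ of the complement, is $\delta s^{-1}$. *)
Definition stau (s : simp) : simp := sdual (sdual s).
Definition scodual (s : simp) : simp := stau (stau (stau (sdual s))).
Definition slw (s t : simp) : bool := smeet (sdual s) t == sI.
(** The left-weighted form of the product s x: the first factor absorbs as much of x as fits,
    [scarry s x] is the rest. *)
Definition shead (s x : simp) : simp := smul s (smeet (sdual s) x).
Definition scarry (s x : simp) : simp := squo (smeet (sdual s) x) x.

Lemma smeet_glb s t u : (sle u s && sle u t) == sle u (smeet s t).
Proof. by move: s t u; apply: forallS3; vm_compute. Qed.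

(** Inserting t and then s has the same effect as inserting their product: this is the local form of
    the action law [ins_smul]. *)
Lemma shead_smul s t x :
  sle t (sdual s) ==>
  [&& shead (smul s t) x == shead s (shead t x),
      sle (scarry t x) (sdual (scarry s (shead t x)))
    & scarry (smul s t) x == smul (scarry s (shead t x)) (scarry t x)].
Proof. by move: s t x; apply: forallS3; vm_compute. Qed.

(** The domino rule, by which a single pass from left to right restores left-weightedness. *)
Lemma slw_domino s x y :
  slw x y ==> slw (shead s x) (shead (scarry s x) y).
Proof. by move: s x y; apply: forallS3; vm_compute. Qed.

Lemma slw_carry s x : slw (shead s x) (scarry s x).
Proof. by move: s x; apply: forallS2; vm_compute. Qed.

Lemma shead_eq1 s x : (shead s x == sI) == (s == sI) && (x == sI).
Proof. by move: s x; apply: forallS2; vm_compute. Qed.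

Lemma shead1 x : shead sI x == x.
Proof. by move: x; apply: forallS; vm_compute. Qed.
Lemma scarry1 x : scarry sI x == sI.
Proof. by move: x; apply: forallS; vm_compute. Qed.
Lemma sheadD s : shead s sD == sD.
Proof. by move: s; apply: forallS; vm_compute. Qed.
Lemma scarryD s : scarry s sD == stau s.
Proof. by move: s; apply: forallS; vm_compute. Qed.
Lemma sDhead x : shead sD x == sD.
Proof. by move: x; apply: forallS; vm_compute. Qed.
Lemma sDcarry x : scarry sD x == x.
Proof. by move: x; apply: forallS; vm_compute. Qed.
Lemma slwD x : slw x sD == (x == sD).
Proof. by move: x; apply: forallS; vm_compute. Qed.
Lemma stau4 s : iter 4 stau s == s.
Proof. by move: s; apply: forallS; vm_compute. Qed.
Lemma stau_smul s t : sle t (sdual s) ==> sle (stau t) (sdual (stau s)) && (stau (smul s t) ==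
  smul (stau s) (stau t)).
Proof. by move: s t; apply: forallS2; vm_compute. Qed.
Lemma stau_head s x : stau (shead s x) == shead (stau s) (stau x).
Proof. by move: s x; apply: forallS2; vm_compute. Qed.
Lemma stau_carry s x : stau (scarry s x) == scarry (stau s) (stau x).
Proof. by move: s x; apply: forallS2; vm_compute. Qed.
Lemma scodualP s : sle s (sdual (scodual s)) && (smul (scodual s) s == sD).
Proof. by move: s; apply: forallS; vm_compute. Qed.
Lemma sdualP s : smul s (sdual s) == sD.
Proof. by move: s; apply: forallS; vm_compute. Qed.
Lemma smul_squo t x : sle t x ==> (sle (squo t x) (sdual t) && (smul t (squo t x) == x)).
Proof. by move: t x; apply: forallS2; vm_compute. Qed.
Lemma smeet_sle s x : sle (smeet s x) s && sle (smeet s x) x.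
Proof. by move: s x; apply: forallS2; vm_compute. Qed.
Lemma smul1 s : smul s sI == s.
Proof. by move: s; apply: forallS; vm_compute. Qed.
Lemma slw_split x y : slw x y ==> (shead x y == x) && (scarry x y == y).
Proof. by move: x y; apply: forallS2; vm_compute. Qed.

(** * The group of normal forms *)

Fixpoint ins (s : simp) (xs : seq simp) : seq simp :=
  if xs is x :: xs' then shead s x :: ins (scarry s x) xs'
  else if s == sI then [::] else [:: s].

Lemma ins1 xs : sI \notin xs -> ins sI xs = xs.
Proof.
elim: xs => //= x xs IH; rewrite inE negb_or => /andP[_ hx].
by rewrite (eqP (shead1 x)) (eqP (scarry1 x)) IH.
Qed.

Lemma ins_sI s xs : sI \notin xs -> sI \notin ins s xs.
Proof.
elim: xs s => /= [|x xs IH] s.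
  by case: eqP => //= hs _; rewrite inE; apply/eqP => h; apply: hs.
rewrite !inE !negb_or => /andP[hx hxs]; rewrite IH // andbT.
by rewrite eq_sym (eqP (shead_eq1 s x)) negb_and orbC eq_sym hx.
Qed.

Lemma ins_smul s t xs : sle t (sdual s) -> ins s (ins t xs) = ins (smul s t) xs.
Proof.
elim: xs s t => /= [|x xs IH] s t hst.
  case: eqP => [->|ht] /=.
    by rewrite (eqP (smul1 s)).
  have:= forallS2 (P := fun s t => sle t (sdual s) ==> (t != sI) ==>
    (ins s [:: t] == if smul s t == sI then [::] else [:: smul s t])).
  move/(_ isT s t); rewrite hst /= => /implyP h; apply/eqP; apply: h; exact/eqP.
have /implyP/(_ hst)/and3P[/eqP -> h2 /eqP ->] := shead_smul s t x.
by rewrite IH.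
Qed.

Lemma ins_sorted s xs : sorted slw xs -> sorted slw (ins s xs).
Proof.
case: xs => [|x xs] /=; first by case: eqP.
elim: xs s x => [|y xs IH] s x /=; first by case: eqP => //= _; rewrite slw_carry.
move=> /andP[hxy hp]; rewrite (implyP (slw_domino s x y) hxy) /=.
exact: IH.
Qed.

Definition tauz (k : int) (s : simp) : simp := iter `|k %% 4|%Z stau s.

Lemma iter_stau_mod n s : iter (n %% 4) stau s = iter n stau s.
Proof.
rewrite {2}(divn_eq n 4) addnC iterD.
congr iter; elim: (n %/ 4) => // k {1}->.
by rewrite mulSn addnC iterD (eqP (stau4 _)).
Qed.

Lemma tauzD a b s : tauz (a + b)%R s = tauz a (tauz b s).
Proof.
rewrite /tauz -iterD -[RHS]iter_stau_mod; congr (iter _ stau s); lia.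
Qed.

Lemma tauz0 s : tauz 0 s = s. Proof. by []. Qed.
Lemma tauz1 s : tauz 1 s = stau s. Proof. by []. Qed.

Lemma tauz_sle k s t : sle t (sdual s) ->
  sle (tauz k t) (sdual (tauz k s)) /\ tauz k (smul s t) = smul (tauz k s) (tauz k t).
Proof.
rewrite /tauz; elim: `|_| => //= n IH /IH[h1 ->].
by have /implyP/(_ h1)/andP[? /eqP] := stau_smul (iter n stau s) (iter n stau t).
Qed.

(** By [slwD] a factor [sD] of a left-weighted sequence is preceded only by factors [sD], so
    stripping the front is enough. *)
Fixpoint norm (p : int) (xs : seq simp) : int * seq simp :=
  if xs is sD :: xs' then norm (p + 1) xs' else (p, xs).

Lemma norm_cons p x xs : x <> sD -> norm p (x :: xs) = (p, x :: xs).
Proof. by case: x. Qed.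

Definition normal (xs : seq simp) : bool :=
  [&& sI \notin xs, sD \notin xs & sorted slw xs].

Lemma norm_normal p xs : sI \notin xs -> sorted slw xs -> normal (norm p xs).2.
Proof.
elim: xs p => // x xs IH p.
rewrite inE negb_or => /andP[hx hxs] hs.
case: (x =P sD) => [->|hxD]; first exact: IH hxs (path_sorted hs).
rewrite (norm_cons p xs hxD).
apply/and3P; split=> //=; first by rewrite inE negb_or hx.
elim: xs x hxD {IH hx hxs} hs => [|y xs IH] x hx /=.
  by move=> _; rewrite inE; apply/eqP => h; apply: hx.
move=> /andP[hxy hs]; rewrite inE negb_or; apply/andP; split.
  by apply/eqP => h; apply: hx.
apply: IH hs => hy; move: hxy; by rewrite hy (eqP (slwD x)) => /eqP.
Qed.

Lemma normK p xs : normal xs -> norm p xs = (p, xs).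
Proof. by case: xs => [|[] xs] //; rewrite /normal !inE /= andbF. Qed.

(** Moving s to the right across $\delta^p$ turns it into $\tau^p(s)$, which is then inserted. *)
Definition lact (s : simp) (g : int * seq simp) : int * seq simp :=
  norm g.1 (ins (tauz g.1 s) g.2).

Lemma lact_norm s p xs : lact s (norm p xs) = norm p (ins (tauz p s) xs).
Proof.
elim: xs p => // x xs IH p.
case: (x =P sD) => [->|hx]; last first.
  by rewrite (norm_cons p xs hx).
rewrite /= IH (eqP (sheadD _)) (eqP (scarryD _)) -tauz1 -tauzD addrC.
by [].
Qed.

Lemma lact_smul s t g : sle t (sdual s) -> lact s (lact t g) = lact (smul s t) g.
Proof.
move=> h; rewrite [lact t g]/lact lact_norm /lact.
by have [h1 h2] := tauz_sle g.1 h; rewrite ins_smul // h2.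
Qed.

Lemma lact_normal s g : normal g.2 -> normal (lact s g).2.
Proof.
case/and3P => h1 _ h3; apply: norm_normal; [exact: ins_sI | exact: ins_sorted].
Qed.

Definition dshift (k : int) (g : int * seq simp) : int * seq simp := ((k + g.1)%R, g.2).

Lemma norm_dshift k p xs : norm (k + p) xs = dshift k (norm p xs).
Proof. by elim: xs p => // -[] xs IH p //=; rewrite -addrA IH. Qed.

Lemma lact_dshift s k g : lact s (dshift k g) = dshift k (lact (tauz k s) g).
Proof. by rewrite /lact /= norm_dshift -tauzD addrC. Qed.

Lemma tauzsI k : tauz k sI = sI.
Proof. by rewrite /tauz; elim: `|_| => //= n ->. Qed.
Lemma tauzsD k : tauz k sD = sD.
Proof. by rewrite /tauz; elim: `|_| => //= n ->. Qed.

Lemma lact1 g : normal g.2 -> lact sI g = g.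
Proof.
case: g => p xs /= h; rewrite /lact /= tauzsI ins1 ?normK //.
by case/and3P: h.
Qed.

Lemma ins_lw x xs : sI \notin x :: xs -> path slw x xs -> ins x xs = x :: xs.
Proof.
elim: xs x => /= [|y xs IH] x; first by rewrite inE eq_sym => /negbTE ->.
rewrite inE negb_or => /andP[_ hy] /andP[hxy hp].
have /implyP/(_ hxy)/andP[/eqP-> /eqP->] := slw_split x y.
by rewrite IH.
Qed.

Lemma lactD g : normal g.2 -> lact sD g = dshift 1 g.
Proof.
case: g => p xs /= h; rewrite /lact /= tauzsD /dshift /= addrC -(normK _ h).
case: xs h => // x xs /and3P[h1 h2 h3] /=.
by rewrite (eqP (sDhead _)) (eqP (sDcarry _)) ins_lw.
Qed.

(** The factors of g act in turn on h, so associativity reduces to the action law [lact_smul]. *)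
Definition gmulr (g h : int * seq simp) : int * seq simp :=
  dshift g.1 (foldr lact h g.2).

Lemma foldr_lact_normal xs h : normal h.2 -> normal (foldr lact h xs).2.
Proof. by move=> hh; elim: xs => //= x xs; apply: lact_normal. Qed.

Lemma gmulr_normal g h : normal h.2 -> normal (gmulr g h).2.
Proof. exact: foldr_lact_normal. Qed.

Lemma lact_split s x g : lact s (lact x g) = lact (shead s x) (lact (scarry s x) g).
Proof.
have /andP[h1 h2] := smeet_sle (sdual s) x.
have /implyP/(_ h2)/andP[h3 /eqP h4] := smul_squo (smeet (sdual s) x) x.
by rewrite -[in LHS]h4 -(lact_smul g h3) (lact_smul _ h1).
Qed.

Lemma foldr_ins s xs h : normal h.2 ->
  foldr lact h (ins s xs) = lact s (foldr lact h xs).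
Proof.
move=> hh; elim: xs s => /= [|x xs IH] s; last by rewrite IH -lact_split.
by case: eqP => //= ->; rewrite lact1.
Qed.

Lemma gmulr_norm p xs h : normal h.2 -> gmulr (norm p xs) h = gmulr (p, xs) h.
Proof.
move=> hh; elim: xs p => // x xs IH p.
case: (x =P sD) => [->|hx]; last first.
  by rewrite (norm_cons p xs hx).
rewrite /= IH /gmulr /= lactD ?foldr_lact_normal //.
by rewrite /dshift /= addrA.
Qed.

Lemma gmulr_dshift k g h : gmulr (dshift k g) h = dshift k (gmulr g h).
Proof. by rewrite /gmulr /dshift /= addrA. Qed.

Lemma dshift0 g : dshift 0 g = g.
Proof. by case: g => p xs; rewrite /dshift add0r. Qed.

Lemma tauzK k : cancel (tauz k) (tauz (- k)).
Proof. by move=> s; rewrite -tauzD addNr tauz0. Qed.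
Lemma tauzNK k : cancel (tauz (- k)) (tauz k).
Proof. by move=> s; rewrite -tauzD addrN tauz0. Qed.

Lemma gmulr_lact s g h : normal h.2 -> gmulr (lact s g) h = lact s (gmulr g h).
Proof.
move=> hh; rewrite {1}/lact gmulr_norm // /gmulr foldr_ins //.
by rewrite lact_dshift.
Qed.

Lemma gmulrA g h k : normal k.2 -> gmulr g (gmulr h k) = gmulr (gmulr g h) k.
Proof.
move=> hk; case: g => p xs; rewrite [gmulr (p, xs) h]/gmulr gmulr_dshift.
rewrite [LHS]/gmulr /=; congr dshift.
by elim: xs => //= x xs ->; rewrite gmulr_lact.
Qed.

Record braid : Type := Braid { braid_val : int * seq simp; braid_normal : normal braid_val.2 }.
HB.instance Definition _ := [isSub for braid_val].
HB.instance Definition _ := [Choice of braid by <:].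

Definition bone : braid := @Braid (0%R, [::]) isT.
Definition bmul (g h : braid) : braid :=
  Braid (gmulr_normal (val g) (braid_normal h)).

Lemma bmulA : associative bmul.
Proof. by move=> g h k; apply: val_inj; apply: gmulrA (braid_normal k). Qed.

Lemma bmul1 : left_id bone bmul.
Proof. by move=> g; apply: val_inj; rewrite /= /gmulr /= dshift0. Qed.

Lemma foldr_lact_self xs : normal xs -> foldr lact (0%R, [::]) xs = (0%R, xs).
Proof.
elim: xs => // x xs IH /and3P[h1 h2 h3] /=.
rewrite IH; last first.
  move: h1 h2; rewrite /normal !inE !negb_or => /andP[_ ->] /andP[_ ->].
  exact: path_sorted h3.
by rewrite /lact /= tauz0 ins_lw // normK //; apply/and3P.
Qed.

Lemma bmulg1 : right_id bone bmul.
Proof.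
case=> -[p xs] h; apply: val_inj; rewrite /= /gmulr /= foldr_lact_self //.
by rewrite /dshift /= addr0.
Qed.

(** Division by s as $s^{-1} = \delta^{-1}(\delta s^{-1})$, where $\delta s^{-1}$ is the simple
    element [scodual s]. *)
Definition sinvact (g : int * seq simp) (s : simp) : int * seq simp :=
  dshift (-1) (lact (scodual s) g).

Definition ginvr (g : int * seq simp) : int * seq simp :=
  foldl sinvact ((- g.1)%R, [::]) g.2.

Lemma ginvr_normal g : normal (ginvr g).2.
Proof.
have: normal ((- g.1)%R, Nil simp).2 by [].
rewrite /ginvr; elim: g.2 (_, _) => //= x xs IH h hh.
by apply: IH; apply: lact_normal.
Qed.

Definition binv (g : braid) : braid := Braid (ginvr_normal (val g)).

Lemma gmulr_sinvact g s h : normal h.2 -> gmulr (sinvact g s) h = sinvact (gmulr g h) s.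
Proof. by move=> hh; rewrite /sinvact gmulr_dshift gmulr_lact. Qed.

Lemma sinvactK s g : normal g.2 -> sinvact (lact s g) s = g.
Proof.
move=> hg; rewrite /sinvact; have /andP[h /eqP e] := scodualP s.
rewrite lact_smul // e lactD // /dshift /=.
by case: (g) => p xs /=; rewrite addrA addNr add0r.
Qed.

Lemma bmulV : left_inverse bone binv bmul.
Proof.
case=> -[p xs] h; apply: val_inj; rewrite /= /ginvr /=.
have -> : forall acc k, normal k.2 ->
    gmulr (foldl sinvact acc xs) k = foldl sinvact (gmulr acc k) xs.
- by elim: xs {h} => //= x xs IH acc k hk; rewrite IH // gmulr_sinvact.
- rewrite /gmulr /= /dshift /= addNr.
  rewrite -{1}(foldr_lact_self h); elim: xs {h} => //= x xs IH.
  by rewrite sinvactK // foldr_lact_normal.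
- exact: h.
Qed.

Lemma bmulgV : right_inverse bone binv bmul.
Proof.
move=> g; rewrite -[LHS]bmul1 -[X in bmul X _](bmulV (binv g)) -bmulA.
by rewrite [bmul (binv g) (bmul _ _)]bmulA bmulV bmul1 bmulV.
Qed.

HB.instance Definition _ := isGroup.Build braid bmulA bmul1 bmulg1 bmulV bmulgV.

(** * Words *)

Lemma beq_refl u : beq u u. Proof. exact: rst_refl. Qed.
Lemma beq_sym u v : beq u v -> beq v u. Proof. exact: rst_sym. Qed.
Lemma beq_trans v u w : beq u v -> beq v w -> beq u w.
Proof. exact: rst_trans. Qed.

Lemma beq_ctx a b u v : beq u v -> beq (a ++ u ++ b) (a ++ v ++ b).
Proof.
elim=> [_ _ [c d l r h]|x|x y _ h|x y z _ h1 _ h2].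
- have e w : a ++ (c ++ w ++ d) ++ b = (a ++ c) ++ w ++ (d ++ b) by rewrite -!catA.
  by rewrite !e; apply: rst_step; apply: bstep_intro.
- exact: beq_refl.
- exact: beq_sym.
- exact: beq_trans h1 h2.
Qed.

Lemma beq_cat u u' v v' : beq u u' -> beq v v' -> beq (u ++ v) (u' ++ v').
Proof.
move=> hu hv; apply: (@beq_trans (u' ++ v)).
  by have := beq_ctx [::] v hu.
by have := beq_ctx u' [::] hv; rewrite !cats0.
Qed.

Lemma beq_catl w u v : beq u v -> beq (w ++ u) (w ++ v).
Proof. exact/beq_cat/beq_refl. Qed.
Lemma beq_catr w u v : beq u v -> beq (u ++ w) (v ++ w).
Proof. by move=> h; apply: beq_cat h (beq_refl w). Qed.

Lemma winv_cat u v : winv (u ++ v) = winv v ++ winv u.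
Proof. by rewrite /winv map_cat rev_cat. Qed.

Lemma beq_mulV u : beq (u ++ winv u) [::].
Proof.
elim/last_ind: u => [|u [i b] IH]; first exact: beq_refl.
rewrite -cats1 winv_cat -catA; apply: beq_trans IH.
have -> : [:: (i, b)] ++ winv [:: (i, b)] ++ winv u = [:: (i, b); (i, ~~ b)] ++ winv u by [].
apply: beq_catl; rewrite -{2}[winv u]cat0s; apply: beq_catr.
have := rst_step _ bstep _ _ (bstep_intro [::] [::] (br_free i b)).
by rewrite !cats0.
Qed.

Lemma winvK : involutive winv.
Proof.
move=> u; rewrite /winv map_rev revK -map_comp -[RHS]map_id.
by apply: eq_map => -[i b] /=; rewrite negbK.
Qed.

Lemma beq_mulVg u : beq (winv u ++ u) [::].
Proof. by have := beq_mulV (winv u); rewrite winvK. Qed.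

Lemma beq_mulKg u v : beq (winv u ++ u ++ v) v.
Proof. by rewrite catA; exact: beq_catr (beq_mulVg u). Qed.

Lemma beq_mulVKg u v : beq (u ++ winv u ++ v) v.
Proof. by rewrite catA; exact: beq_catr (beq_mulV u). Qed.

Lemma beq_winv u v : beq u v -> beq (winv u) (winv v).
Proof.
move=> h; apply: beq_sym; apply: beq_trans (beq_sym (beq_mulKg u (winv v))) _.
rewrite -{2}[winv u]cats0; apply: beq_catl.
by apply: beq_trans (beq_catr _ h) (beq_mulV v).
Qed.

(* Words with letters coded 0..5: k is sigma_(k+1) and k + 3 its inverse. *)
Definition dec (w : seq nat) : word :=
  [seq (if k < 3 then (inord k, true) else (inord (k - 3), false)) | k <- w].

Definition code_rels : seq (seq nat * seq nat) :=
  let r := [:: ([:: 0; 2], [:: 2; 0]); ([:: 0; 1; 0], [:: 1; 0; 1]);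
               ([:: 1; 2; 1], [:: 2; 1; 2]);
               ([:: 0; 3], [::]); ([:: 1; 4], [::]); ([:: 2; 5], [::]);
               ([:: 3; 0], [::]); ([:: 4; 1], [::]); ([:: 5; 2], [::])] in
  r ++ [seq (x.2, x.1) | x <- r].

Definition stepb (u v : seq nat) : bool :=
  has (fun x => has (fun k => (u == take k u ++ x.1 ++ drop (k + size x.1) u) &&
                 (v == take k u ++ x.2 ++ drop (k + size x.1) u))
               (iota 0 (size u).+1)) code_rels.

Lemma code_rels_beq x : x \in code_rels -> beq (dec x.1) (dec x.2).
Proof.
have free i b : beq [:: (i, b); (i, ~~ b)] [::].
  have := rst_step _ bstep _ _ (bstep_intro [::] [::] (br_free i b)).
  by rewrite !cats0.
have rel l r : brel l r -> beq l r.
  by move=> h; have := rst_step _ bstep _ _ (bstep_intro [::] [::] h); rewrite !cats0.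
suff half y : y \in take 9 code_rels -> beq (dec y.1) (dec y.2).
  rewrite /code_rels mem_cat => /orP[/half //|/mapP[y hy ->]].
  exact/beq_sym/half.
rewrite !inE => /or4P[/eqP->|/eqP->|/eqP->|].
- exact: rel br_comm.
- exact: rel br_12.
- exact: rel br_23.
- by case/or4P=> [/eqP->|/eqP->|/eqP->|/or3P[/eqP->|/eqP->|/eqP->]]; apply: free.
Qed.

Lemma stepb_beq u v : stepb u v -> beq (dec u) (dec v).
Proof.
case/hasP=> x /code_rels_beq hx /hasP[k _ /andP[/eqP eu /eqP ->]].
by rewrite {1}eu /dec !map_cat; exact: beq_ctx.
Qed.

Lemma chain_beq u us : path stepb u us -> beq (dec u) (dec (last u us)).
Proof.
elim: us u => /= [|v us IH] u; first by move=> _; exact: beq_refl.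
by case/andP=> /stepb_beq h /IH; apply: beq_trans.
Qed.

Definition atom_code (s : simp) : seq nat :=
  match s with
  | s12 => [:: 0] | s23 => [:: 1] | s34 => [:: 2]
  | s13 => [:: 4; 0; 1] | s24 => [:: 5; 1; 2] | s14 => [:: 5; 4; 0; 1; 2]
  | _ => [::]
  end.

Definition atoms : seq simp := [:: s12; s23; s34; s14; s13; s24].

Definition satoms (s : simp) : seq simp :=
  match s with
  | sI => [::] | s123 => [:: s12; s23] | s234 => [:: s23; s34]
  | s134 => [:: s13; s34] | s124 => [:: s12; s24] | s12_34 => [:: s12; s34]
  | s14_23 => [:: s14; s23] | sD => [:: s12; s23; s34] | _ => [:: s]
  end.

Definition aword (l : seq simp) : word := flatten [seq dec (atom_code a) | a <- l].
Definition wordS (s : simp) : word := aword (satoms s).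

Lemma aword_cat l l' : aword (l ++ l') = aword l ++ aword l'.
Proof. by rewrite /aword map_cat flatten_cat. Qed.

(* Derivations, found by search, of the length-two relations of the dual presentation:
   each step applies one Artin relation or one free reduction. *)
Definition derivations : seq (seq (seq nat)) :=
  [:: [:: [:: 2; 5; 1; 2]; [:: 1; 2]];
   [:: [:: 5; 1; 2; 1]; [:: 5; 2; 1; 2]; [:: 1; 2]];
   [:: [:: 2; 0]; [:: 0; 2]];
   [:: [:: 2; 5; 4; 0; 1; 2]; [:: 4; 0; 1; 2]];
   [:: [:: 5; 4; 0; 1; 2; 4; 0; 1]; [:: 5; 4; 5; 2; 0; 1; 2; 4; 0; 1]; [:: 5; 4; 5; 0; 2; 1; 2; 4;
     0; 1]; [:: 5; 4; 5; 0; 1; 2; 1; 4; 0; 1]; [:: 5; 4; 5; 0; 1; 2; 0; 1]; [:: 5; 4; 5; 0; 1; 0;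
     2; 1]; [:: 5; 4; 5; 1; 0; 1; 2; 1]; [:: 5; 4; 5; 1; 0; 2; 1; 2]; [:: 5; 4; 5; 1; 2; 0; 1; 2];
     [:: 5; 4; 5; 1; 2; 1; 4; 0; 1; 2]; [:: 5; 4; 5; 2; 1; 2; 4; 0; 1; 2]; [:: 5; 4; 1; 2; 4; 0;
     1; 2]; [:: 5; 2; 4; 0; 1; 2]; [:: 4; 0; 1; 2]];
   [:: [:: 1; 4; 0; 1]; [:: 0; 1]];
   [:: [:: 4; 0; 1; 0]; [:: 4; 1; 0; 1]; [:: 0; 1]];
   [:: [:: 1; 5; 4; 0; 1; 2]; [:: 5; 2; 1; 5; 4; 0; 1; 2]; [:: 5; 4; 1; 2; 1; 5; 4; 0; 1; 2]; [::
     5; 4; 2; 1; 2; 5; 4; 0; 1; 2]; [:: 5; 4; 2; 1; 4; 0; 1; 2]; [:: 5; 4; 2; 0; 1; 2]; [:: 5; 4;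
     0; 2; 1; 2]; [:: 5; 4; 0; 1; 2; 1]];
   [:: [:: 5; 4; 0; 1; 2; 0]; [:: 5; 4; 0; 1; 0; 2]; [:: 5; 4; 1; 0; 1; 2]; [:: 5; 0; 1; 2]; [::
     5; 0; 2; 5; 1; 2]; [:: 5; 2; 0; 5; 1; 2]; [:: 0; 5; 1; 2]];
   [:: [:: 5; 1; 2; 5; 4; 0; 1; 2]; [:: 5; 1; 4; 0; 1; 2]; [:: 5; 0; 1; 2]; [:: 5; 0; 2; 5; 1; 2];
     [:: 5; 2; 0; 5; 1; 2]; [:: 0; 5; 1; 2]]].

Lemma aword_code l : aword l = dec (flatten [seq atom_code a | a <- l]).
Proof. by elim: l => //= a l IH; rewrite /aword /= -/(aword l) IH /dec map_cat. Qed.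

Lemma smul_atoms_beq a b : a \in atoms -> b \in atoms -> sle b (sdual a) ->
  beq (aword [:: a; b]) (wordS (smul a b)).
Proof.
move=> ha hb hab; rewrite /wordS !aword_code.
set u := flatten _; set v := flatten _.
have: has (fun d => if (head [::] d == u) && (last [::] d == v) then
                     path stepb (head [::] d) (behead d) else false) ([:: u] :: derivations).
  rewrite /u /v {u v}; move: a b ha hb hab.
  have := forallS2 (P := fun a b => (a \in atoms) ==> (b \in atoms) ==> sle b (sdual a) ==>
    has (fun d => if (head [::] d == flatten [seq atom_code x | x <- [:: a; b]]) &&
      (last [::] d == flatten [seq atom_code x | x <- satoms (smul a b)])
      then path stepb (head [::] d) (behead d) else false)
      ([:: flatten [seq atom_code x | x <- [:: a; b]]] :: derivations)).
  by move=> h a b; have /implyP h' := h (ltac:(by vm_compute)) a b; move=> /h' /implyP h2 /h2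
    /implyP h3 /h3.
case/hasP=> d _; case: ifP => // /andP[/eqP <- /eqP <-].
by case: d => [|w ws] /=; [move=> _; exact: beq_refl | exact: chain_beq].
Qed.

Definition apair (a b u : simp) : bool :=
  [&& a \in atoms, b \in atoms, sle b (sdual a) & smul a b == u].

Lemma apair_beq a b c d u : apair a b u -> apair c d u ->
  beq (aword [:: a; b]) (aword [:: c; d]).
Proof.
move=> /and4P[ha hb hab /eqP eu] /and4P[hc hd hcd /eqP ev].
apply: beq_trans (smul_atoms_beq ha hb hab) _.
by rewrite eu -ev; apply/beq_sym/smul_atoms_beq.
Qed.

(** Transitivity of the Hurwitz action on factorizations of $\delta$ in explicit form: at most three
    exchanges of adjacent pairs suffice, the middle one creating [s12] in front. *)
Lemma atriple_beq a b c u : a \in atoms -> apair b c u -> smul a u == sD ->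
  beq (aword [:: a; b; c]) (aword [:: s12; s23; s34]).
Proof.
move=> ha hbc hu; case: (a =P s12) => [ea|na].
  subst a; rewrite (aword_cat [:: s12] [:: b; c]) (aword_cat [:: s12] [:: s23; s34]).
  apply/beq_catl/(apair_beq hbc).
  have := forallS (P := fun u => (smul s12 u == sD) ==> apair s23 s34 u).
  by move=> /(_ ltac:(by vm_compute) u)/implyP/(_ hu).
have : has (fun v => has (fun x => has (fun y => has (fun z =>
   [&& apair x z u, apair a x v, apair s12 y v & apair y z s234])
   atoms) atoms) atoms) allS.
  have := forallS2 (P := fun a u => (a \in atoms) ==> (a != s12) ==> (smul a u == sD) ==>
    has (fun v => has (fun x => has (fun y => has (fun z =>
   [&& apair x z u, apair a x v, apair s12 y v & apair y z s234])
   atoms) atoms) atoms) allS).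
  move=> /(_ ltac:(by vm_compute) a u)/implyP/(_ ha)/implyP h.
  by move: hu; apply/implyP/h/eqP.
case/hasP=> v _ /hasP[x _ /hasP[y _ /hasP[z _ /and4P[h1 h2 h3 h4]]]].
apply: (@beq_trans (aword [:: a; x; z])).
  rewrite (aword_cat [:: a] [:: b; c]) (aword_cat [:: a] [:: x; z]).
  exact/beq_catl/(apair_beq hbc h1).
apply: (@beq_trans (aword [:: s12; y; z])).
  rewrite (aword_cat [:: a; x]) (aword_cat [:: s12; y]).
  exact: beq_catr (apair_beq h2 h3).
rewrite (aword_cat [:: s12] [:: y; z]) (aword_cat [:: s12] [:: s23; s34]).
by apply/beq_catl/(apair_beq h4); vm_compute.
Qed.

Lemma wordS_smul s t : sle t (sdual s) -> beq (wordS s ++ wordS t) (wordS (smul s t)).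
Proof.
move=> hst; rewrite /wordS -aword_cat.
have: [|| satoms s ++ satoms t == satoms (smul s t),
   [&& size (satoms s) == 1, size (satoms t) == 1, head sI (satoms s) == s &
     (head sI (satoms t) == t) && apair s t (smul s t)] |
   (smul s t == sD) && (if satoms s ++ satoms t is [:: a; b; c] then
     (a \in atoms) && has (fun u => apair b c u && (smul a u == sD)) allS else false)].
  move: s t hst; have := forallS2 (P := fun s t => sle t (sdual s) ==>
    [|| satoms s ++ satoms t == satoms (smul s t),
   [&& size (satoms s) == 1, size (satoms t) == 1, head sI (satoms s) == s &
     (head sI (satoms t) == t) && apair s t (smul s t)] |
   (smul s t == sD) && (if satoms s ++ satoms t is [:: a; b; c] then
     (a \in atoms) && has (fun u => apair b c u && (smul a u == sD)) allS else false)]).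
  by move=> h s t; apply/implyP/h; vm_compute.
case/or3P=> [/eqP ->|/and5P[s1 t1 hs ht /and4P[h1 h2 h3 _]]|/andP[/eqP ->]].
- exact: beq_refl.
- move: s1 hs t1 ht; case: (satoms s) => [|a []] //= _ /eqP ->.
  by case: (satoms t) => [|b []] //= _ /eqP ->; apply: smul_atoms_beq.
- case: (satoms s ++ _) => [|a [|b [|c [|? ?]]]] // /andP[ha /hasP[u _ /andP[h1 h2]]].
  exact: atriple_beq ha h1 h2.
Qed.

(** * Strips of rows *)

Definition tri (y : simp) : bool := y \in [:: s123; s234; s134; s124].
Definition pairp (y : simp) : bool := y \in [:: s12_34; s14_23].

(* [nx y c z c']: the atom c below the letter y continues to the atom c' below
   the next letter z, i.e. y = c b and b c' is simple. *)
Definition nx (y c z c' : simp) : bool :=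
  [&& slen y == 2, slen z == 2, slw y z, slen c == 1, slen c' == 1, sle c y, sle c' z
    & sle c' (sdual (squo c y))].
Definition out (y c c' : simp) : simp := smul (squo c y) c'.
(* The two ways in which the backward atom b and the forward atom c sit below a 3-cycle y. *)
Definition Xt (y b c : simp) : bool := tri y && sprd b c y.
Definition Yt (y b c : simp) : bool := tri y && sprd c b y.

Definition all1 (P : pred simp) : bool := all P allS.
Lemma all1P P : all1 P -> forall s, P s. Proof. exact: forallS. Qed.

(** Write u = c b with c the atom [gu]. Two distinct continuations below v and below the complement
    of b, both of length 2, would make these equal; but the complement of b contains that of u,
    against [slw u v]. *)
Lemma nx_det u gu v gv e :
  nx u gu v gv ->
  nx u gu v e ->
  e == gv.
Proof.
have: all1 (fun u => all1 (fun gu => all1 (fun v => all1 (fun gv => if nx u gu v gv then all1 (fun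
  e => if nx u gu v e then e == gv else true) else true)))) by vm_compute.
move=> H h0 h1; move: H.
move=> /all1P/(_ u)/all1P/(_ gu)/all1P/(_ v)/all1P/(_ gv). rewrite h0. move/all1P/(_ e). by
  rewrite h1.
Qed.

Lemma nx_out u gu v gv :
  nx u gu v gv ->
  [&& slen (out u gu gv) == 2, sle (squo gu u) (out u gu gv), squo (squo gu u) (out u gu gv) == gv
    & slen (squo gu u) == 1].
Proof.
have: all1 (fun u => all1 (fun gu => all1 (fun v => all1 (fun gv => if nx u gu v gv then [&& slen
  (out u gu gv) == 2, sle (squo gu u) (out u gu gv), squo (squo gu u) (out u gu gv) == gv & slen
  (squo gu u) == 1] else true)))) by vm_compute.
move=> H h0; move: H.
move=> /all1P/(_ u)/all1P/(_ gu)/all1P/(_ v)/all1P/(_ gv). by rewrite h0.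
Qed.

Lemma nx_back u gu v gv :
  nx u gu v gv ->
  [&& out (out u gu gv) (squo gu u) (squo gv v) == v, sle (squo gv v) (sdual (squo (squo gu u)
    (out u gu gv))), slen (squo gv v) == 1 & sle (squo gu u) (out u gu gv)].
Proof.
have: all1 (fun u => all1 (fun gu => all1 (fun v => all1 (fun gv => if nx u gu v gv then [&& out
  (out u gu gv) (squo gu u) (squo gv v) == v, sle (squo gv v) (sdual (squo (squo gu u) (out u gu
  gv))), slen (squo gv v) == 1 & sle (squo gu u) (out u gu gv)] else true)))) by vm_compute.
move=> H h0; move: H.
move=> /all1P/(_ u)/all1P/(_ gu)/all1P/(_ v)/all1P/(_ gv). by rewrite h0.
Qed.

Lemma tri_pair y :
  slen y == 2 ->
  pairp y == ~~ tri y.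
Proof.
have: all1 (fun y => if slen y == 2 then pairp y == ~~ tri y else true) by vm_compute.
move=> H h0; move: H.
move/all1P/(_ y). by rewrite h0.
Qed.

Lemma type_tri y b c :
  tri y ->
  slen b == 1 ->
  slen c == 1 ->
  sle b y ->
  sle c y ->
  b != c ->
  Xt y b c == ~~ Yt y b c.
Proof.
have: all1 (fun y => all1 (fun b => all1 (fun c => if tri y then if slen b == 1 then if slen c ==
  1 then if sle b y then if sle c y then if b != c then Xt y b c == ~~ Yt y b c else true else
  true else true else true else true else true))) by vm_compute.
move=> H h0 h1 h2 h3 h4 h5; move: H.
move=> /all1P/(_ y)/all1P/(_ b)/all1P/(_ c). by rewrite h0 h1 h2 h3 h4 h5.
Qed.

Lemma type_pair y b c :
  pairp y ->
  slen b == 1 ->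
  slen c == 1 ->
  sle b y ->
  sle c y ->
  b != c ->
  (squo c y == b) && (squo b y == c).
Proof.
have: all1 (fun y => all1 (fun b => all1 (fun c => if pairp y then if slen b == 1 then if slen c
  == 1 then if sle b y then if sle c y then if b != c then (squo c y == b) && (squo b y == c) else
  true else true else true else true else true else true))) by vm_compute.
move=> H h0 h1 h2 h3 h4 h5; move: H.
move=> /all1P/(_ y)/all1P/(_ b)/all1P/(_ c). by rewrite h0 h1 h2 h3 h4 h5.
Qed.

(** The type passes between adjacent 3-cycles, so it belongs to a whole run of them. *)
Lemma type_F1 u gu v gv bu bv :
  nx u gu v gv ->
  nx u bu v bv ->
  bu != gu ->
  tri u ->
  tri v ->
  Xt u bu gu == Xt v bv gv.
Proof.
have: all1 (fun u => all1 (fun gu => all1 (fun v => all1 (fun gv => if nx u gu v gv then all1 (fun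
  bu => all1 (fun bv => if nx u bu v bv then if bu != gu then if tri u then if tri v then Xt u bu
  gu == Xt v bv gv else true else true else true else true)) else true)))) by vm_compute.
move=> H h0 h1 h2 h3 h4; move: H.
move=> /all1P/(_ u)/all1P/(_ gu)/all1P/(_ v)/all1P/(_ gv). rewrite h0. move=> /all1P/(_
  bu)/all1P/(_ bv). by rewrite h1 h2 h3 h4.
Qed.

Lemma type_Y_squo y b c :
  Yt y b c ->
  slen b == 1 ->
  slen c == 1 ->
  squo c y == b.
Proof.
have: all1 (fun y => all1 (fun b => all1 (fun c => if Yt y b c then if slen b == 1 then if slen c
  == 1 then squo c y == b else true else true else true))) by vm_compute.
move=> H h0 h1 h2; move: H.
move=> /all1P/(_ y)/all1P/(_ b)/all1P/(_ c). by rewrite h0 h1 h2.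
Qed.

Lemma type_X_squo y b c :
  Xt y b c ->
  slen b == 1 ->
  slen c == 1 ->
  squo b y == c.
Proof.
have: all1 (fun y => all1 (fun b => all1 (fun c => if Xt y b c then if slen b == 1 then if slen c
  == 1 then squo b y == c else true else true else true))) by vm_compute.
move=> H h0 h1 h2; move: H.
move=> /all1P/(_ y)/all1P/(_ b)/all1P/(_ c). by rewrite h0 h1 h2.
Qed.

(** This and the next three checks describe the two ends of a run of 3-cycles on passing to the next
    row: for type Y they keep their indices, for type X they move one index to the left. Letters in
    between may still turn into pairs. *)
Lemma Y_exit u gu v gv bu bv :
  nx u gu v gv ->
  nx u bu v bv ->
  bu != gu ->
  Yt u bu gu ->
  pairp v ->
  tri (out u gu gv).
Proof.
have: all1 (fun u => all1 (fun gu => all1 (fun v => all1 (fun gv => if nx u gu v gv then all1 (fun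
  bu => all1 (fun bv => if nx u bu v bv then if bu != gu then if Yt u bu gu then if pairp v then
  tri (out u gu gv) else true else true else true else true)) else true)))) by vm_compute.
move=> H h0 h1 h2 h3 h4; move: H.
move=> /all1P/(_ u)/all1P/(_ gu)/all1P/(_ v)/all1P/(_ gv). rewrite h0. move=> /all1P/(_
  bu)/all1P/(_ bv). by rewrite h1 h2 h3 h4.
Qed.

Lemma X_exit u gu v gv bu bv :
  nx u gu v gv ->
  nx u bu v bv ->
  bu != gu ->
  Xt u bu gu ->
  pairp v ->
  pairp (out u gu gv).
Proof.
have: all1 (fun u => all1 (fun gu => all1 (fun v => all1 (fun gv => if nx u gu v gv then all1 (fun
  bu => all1 (fun bv => if nx u bu v bv then if bu != gu then if Xt u bu gu then if pairp v then
  pairp (out u gu gv) else true else true else true else true)) else true)))) by vm_compute.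
move=> H h0 h1 h2 h3 h4; move: H.
move=> /all1P/(_ u)/all1P/(_ gu)/all1P/(_ v)/all1P/(_ gv). rewrite h0. move=> /all1P/(_
  bu)/all1P/(_ bv). by rewrite h1 h2 h3 h4.
Qed.

Lemma X_entry u gu v gv bu bv :
  nx u gu v gv ->
  nx u bu v bv ->
  bu != gu ->
  pairp u ->
  Xt v bv gv ->
  tri (out u gu gv).
Proof.
have: all1 (fun u => all1 (fun gu => all1 (fun v => all1 (fun gv => if nx u gu v gv then all1 (fun
  bu => all1 (fun bv => if nx u bu v bv then if bu != gu then if pairp u then if Xt v bv gv then
  tri (out u gu gv) else true else true else true else true)) else true)))) by vm_compute.
move=> H h0 h1 h2 h3 h4; move: H.
move=> /all1P/(_ u)/all1P/(_ gu)/all1P/(_ v)/all1P/(_ gv). rewrite h0. move=> /all1P/(_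
  bu)/all1P/(_ bv). by rewrite h1 h2 h3 h4.
Qed.

Lemma Y_entry u gu v gv bu bv :
  nx u gu v gv ->
  nx u bu v bv ->
  bu != gu ->
  pairp u ->
  Yt v bv gv ->
  pairp (out u gu gv).
Proof.
have: all1 (fun u => all1 (fun gu => all1 (fun v => all1 (fun gv => if nx u gu v gv then all1 (fun
  bu => all1 (fun bv => if nx u bu v bv then if bu != gu then if pairp u then if Yt v bv gv then
  pairp (out u gu gv) else true else true else true else true)) else true)))) by vm_compute.
move=> H h0 h1 h2 h3 h4; move: H.
move=> /all1P/(_ u)/all1P/(_ gu)/all1P/(_ v)/all1P/(_ gv). rewrite h0. move=> /all1P/(_
  bu)/all1P/(_ bv). by rewrite h1 h2 h3 h4.
Qed.

Lemma A_step u gu v gv w gw du dv :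
  nx u gu v gv ->
  nx v gv w gw ->
  tri v ->
  pairp (out u gu gv) ->
  tri (out v gv gw) ->
  nx (out u gu gv) du (out v gv gw) dv ->
  du != squo gu u ->
  Yt (out v gv gw) (squo gv v) dv.
Proof.
have: all1 (fun u => all1 (fun gu => all1 (fun v => all1 (fun gv => if nx u gu v gv then all1 (fun
  w => all1 (fun gw => if nx v gv w gw then if tri v then if pairp (out u gu gv) then if tri (out
  v gv gw) then all1 (fun du => all1 (fun dv => if nx (out u gu gv) du (out v gv gw) dv then if du
  != squo gu u then Yt (out v gv gw) (squo gv v) dv else true else true)) else true else true else
  true else true)) else true)))) by vm_compute.
move=> H h0 h1 h2 h3 h4 h5 h6; move: H.
move=> /all1P/(_ u)/all1P/(_ gu)/all1P/(_ v)/all1P/(_ gv). rewrite h0. move=> /all1P/(_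
  w)/all1P/(_ gw). rewrite h1 h2 h3 h4. move=> /all1P/(_ du)/all1P/(_ dv). by rewrite h5 h6.
Qed.

Lemma B_step u gu v gv w gw du dv :
  nx u gu v gv ->
  nx v gv w gw ->
  tri v ->
  pairp (out v gv gw) ->
  tri (out u gu gv) ->
  nx (out u gu gv) du (out v gv gw) dv ->
  du != squo gu u ->
  Xt (out u gu gv) (squo gu u) du.
Proof.
have: all1 (fun u => all1 (fun gu => all1 (fun v => all1 (fun gv => if nx u gu v gv then all1 (fun
  w => all1 (fun gw => if nx v gv w gw then if tri v then if pairp (out v gv gw) then if tri (out
  u gu gv) then all1 (fun du => all1 (fun dv => if nx (out u gu gv) du (out v gv gw) dv then if du
  != squo gu u then Xt (out u gu gv) (squo gu u) du else true else true)) else true else true else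
  true else true)) else true)))) by vm_compute.
move=> H h0 h1 h2 h3 h4 h5 h6; move: H.
move=> /all1P/(_ u)/all1P/(_ gu)/all1P/(_ v)/all1P/(_ gv). rewrite h0. move=> /all1P/(_
  w)/all1P/(_ gw). rewrite h1 h2 h3 h4. move=> /all1P/(_ du)/all1P/(_ dv). by rewrite h5 h6.
Qed.

Lemma two_tri u gu v gv bu bv :
  nx u gu v gv ->
  nx u bu v bv ->
  bu != gu ->
  tri u ->
  tri v ->
  tri (out u gu gv) ->
  tri (out u bu bv) ->
  if Xt u bu gu then out u gu gv == v else out u gu gv == u.
Proof.
have: all1 (fun u => all1 (fun gu => all1 (fun v => all1 (fun gv => if nx u gu v gv then all1 (fun
  bu => all1 (fun bv => if nx u bu v bv then if bu != gu then if tri u then if tri v then if tri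
  (out u gu gv) then if tri (out u bu bv) then if Xt u bu gu then out u gu gv == v else out u gu
  gv == u else true else true else true else true else true else true)) else true)))) by
  vm_compute.
move=> H h0 h1 h2 h3 h4 h5 h6; move: H.
move=> /all1P/(_ u)/all1P/(_ gu)/all1P/(_ v)/all1P/(_ gv). rewrite h0. move=> /all1P/(_
  bu)/all1P/(_ bv). by rewrite h1 h2 h3 h4 h5 h6.
Qed.

(** * Conjugation of transpositions in $S_4$ *)

Definition perms4 : seq (seq nat) := Eval vm_compute in permutations (iota 0 4).
Definition pcomp (u v : seq nat) : seq nat := [seq nth 0 v i | i <- u].

(* The atom with underlying transposition u c u^-1. *)
Definition pconj (u : seq nat) (c : simp) : simp :=
  nth sI atoms (find (fun s => pcomp (sperm s) u == pcomp u (sperm c)) atoms).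

Lemma pcomp_perms4 b u : b \in atoms -> u \in perms4 -> pcomp (sperm b) u \in perms4.
Proof.
have: all (fun b => all (fun u => pcomp (sperm b) u \in perms4) perms4) atoms by vm_compute.
by move=> /allP h /h /allP h' /h'.
Qed.

Lemma pconj_comp b u c : b \in atoms -> u \in perms4 -> c \in atoms ->
  pconj (pcomp (sperm b) u) c = pconj (sperm b) (pconj u c).
Proof.
have: all (fun b => all (fun u => all (fun c =>
  pconj (pcomp (sperm b) u) c == pconj (sperm b) (pconj u c)) atoms) perms4) atoms
  by vm_compute.
by move=> /allP h /h /allP h' /h' /allP h'' /h'' /eqP.
Qed.

(** 12 is the exponent of $S_4$, the least common multiple of the orders 1, 2, 3, 4. *)
Lemma pconj_order u c : u \in perms4 -> c \in atoms -> iter 12 (pconj u) c = c.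
Proof.
have: all (fun u => all (fun c => iter 12 (pconj u) c == c) atoms) perms4 by vm_compute.
by move=> /allP h /h /allP h' /h' /eqP.
Qed.

Lemma pconj_id c : c \in atoms -> pconj (iota 0 4) c = c.
Proof.
have: all (fun c => pconj (iota 0 4) c == c) atoms by vm_compute.
by move=> /allP h /h /eqP.
Qed.

(** Both factorizations multiply to y, so c' b = b c as permutations. *)
Lemma pconjP b c c' y : b \in atoms -> c \in atoms -> c' \in atoms ->
  sprd c' b y -> sprd b c y -> c' = pconj (sperm b) c.
Proof.
have: all (fun b => all (fun c => all (fun c' => all (fun y =>
  if sprd c' b y && sprd b c y then c' == pconj (sperm b) c else true) allS) atoms) atoms) atoms
  by vm_compute.
move=> /allP h /h /allP h' /h' /allP h'' /h'' /allP h3 h1 h2.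
by have := h3 y (mem_allS y); rewrite h1 h2 => /eqP.
Qed.

Lemma mem_atoms c : (c \in atoms) = (slen c == 1). Proof. by case: c. Qed.

Section PconjIteration.
Variables (N : nat) (f h : nat -> simp) (L : nat).
Hypothesis h_atom : forall j, slen (h j) == 1.
Hypothesis f_atom : forall j, j <= L -> slen (f j) == 1.
Hypothesis h_per : forall j, h (j + N) = h j.
Hypothesis f_rec : forall j, j < L -> f j = pconj (sperm (h j)) (f j.+1).

Let prd j n := foldr (fun k u => pcomp (sperm (h k)) u) (iota 0 4) (iota j n).

Lemma prd_perms4 j n : prd j n \in perms4.
Proof.
rewrite /prd; elim: n j => //= n IH j; apply: pcomp_perms4; last exact: IH.
by rewrite mem_atoms.
Qed.

Lemma pconj_prd j n : j + n <= L -> f j = pconj (prd j n) (f (j + n)).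
Proof.
elim: n j => [|n IH] j hj.
  by rewrite addn0 pconj_id // mem_atoms; apply: f_atom; lia.
rewrite f_rec; last by lia.
rewrite (IH j.+1); last by lia.
rewrite addSnnS /prd /= pconj_comp ?mem_atoms //; last by apply: f_atom; lia.
exact: prd_perms4.
Qed.

Lemma prd_per j k : prd (j + N * k) N = prd j N.
Proof.
have hk i : h (i + N * k) = h i.
  by elim: k => [|k IH]; rewrite ?muln0 ?addn0 // mulnS [N + _]addnC addnA h_per.
rewrite /prd; move: {2 3}N => n; elim: n j => //= n IH j.
by rewrite hk -addSn IH.
Qed.

(** Each period of h conjugates f by the same permutation [prd j N], whose twelfth power is
    trivial. *)
Lemma pconj_period j : j + 12 * N <= L -> f (j + 12 * N) = f j.
Proof.
move=> hj; have := pconj_order (prd_perms4 j N) (c := f (j + 12 * N)).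
rewrite mem_atoms => /(_ (f_atom hj)) <-.
have st k : k < 12 -> f (j + N * k) = pconj (prd j N) (f (j + N * k.+1)).
  move=> hk; rewrite -(prd_per j k) mulnS [N + _]addnC addnA; apply: pconj_prd; nia.
have it n : n <= 12 -> f (j + N * (12 - n)) = iter n (pconj (prd j N)) (f (j + 12 * N)).
  elim: n => [|n IH] hn; first by rewrite subn0 mulnC.
  rewrite st /= ?subnSK ?IH //; lia.
by rewrite -it // subnn muln0 addn0.
Qed.

End PconjIteration.

Lemma sprd_squo s t : sle s t -> sprd s (squo s t) t.
Proof.
have := forallS2 (P := fun s t => if sle s t then sprd s (squo s t) t else true)
  (ltac:(by vm_compute)) s t.
by case: ifP.
Qed.

Lemma nx_atom y c z c' : nx y c z c' -> (slen c == 1) && sle c y.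
Proof. by case/and5P=> _ _ _ -> /and4P[_ ->]. Qed.

Lemma smul_sprd s t u : sprd s t u -> u = smul s t.
Proof.
have := forallS3 (P := fun s t u => if sprd s t u then u == smul s t else true)
  (ltac:(by vm_compute)) s t u.
by case: ifP => // _ /eqP.
Qed.

Lemma stau_squo s t : stau (squo s t) == squo (stau s) (stau t).
Proof. by move: s t; apply: forallS2; vm_compute. Qed.

Lemma tauz_squo k s t : tauz k (squo s t) = squo (tauz k s) (tauz k t).
Proof. by rewrite /tauz; elim: `|_| => //= n ->; rewrite (eqP (stau_squo _ _)). Qed.

Lemma tauz4 k s : tauz k (tauz k (tauz k (tauz k s))) = s.
Proof.
rewrite -!tauzD /tauz (_ : `|_|%N = 0) //; lia.
Qed.

(** * Rows, strips and their reversal *)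

Section Rows.
Variables (r : nat) (p : int).
Hypothesis r_gt0 : 0 < r.

Let N := 4 * r.

Definition twist (f : nat -> simp) : Prop := forall i, f (i + r) = tauz (- p) (f i).

Lemma twist_per f : twist f -> forall n i, f (i + N * n) = f i.
Proof.
move=> hf n i; elim: n => [|n <-]; first by rewrite muln0 addn0.
rewrite (_ : i + N * n.+1 = i + N * n + r + r + r + r); last by rewrite /N; lia.
by rewrite !hf tauz4.
Qed.

Definition row2 (Y : nat -> simp) : Prop :=
  [/\ twist Y, forall i, slen (Y i) = 2 & forall i, slw (Y i) (Y i.+1)].

(* Conjugation of a rigid braid by a proper prefix c_0 of its first letter factors every
   letter as Y_i = c_i b_i and yields the letters b_i c_(i+1). *)
Definition strip (Y c Y' : nat -> simp) : Prop :=
  [/\ row2 Y, row2 Y', twist c, forall i, nx (Y i) (c i) (Y i.+1) (c i.+1) &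
      forall i, Y' i = out (Y i) (c i) (c i.+1)].

Definition bstrip (Y c : nat -> simp) (i : nat) : simp := squo (c i) (Y i).

Lemma row2_ext Y Z : Y =1 Z -> row2 Y -> row2 Z.
Proof.
by move=> e [h1 h2 h3]; split=> i; rewrite -!e; [exact: h1 | exact: h2 | exact: h3].
Qed.

Lemma strip_ext Y1 Y2 c1 c2 Z1 Z2 : Y1 =1 Y2 -> c1 =1 c2 -> Z1 =1 Z2 ->
  strip Y1 c1 Z1 -> strip Y2 c2 Z2.
Proof.
move=> eY ec eZ [h1 h2 h3 h4 h5]; split; first exact: row2_ext eY h1.
- exact: row2_ext eZ h2.
- by move=> i; rewrite -!ec h3.
- by move=> i; rewrite -!eY -!ec.
- by move=> i; rewrite -eZ h5 -eY -!ec.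
Qed.

Lemma row2_shift Y n : row2 Y -> row2 (fun i => Y (i + n)).
Proof.
case=> h1 h2 h3; split=> i; last by rewrite addSn.
  by rewrite addnAC h1.
exact: h2.
Qed.

Lemma strip_shift Y c Z n : strip Y c Z ->
  strip (fun i => Y (i + n)) (fun i => c (i + n)) (fun i => Z (i + n)).
Proof.
case=> h1 h2 h3 h4 h5; split; try exact: row2_shift.
- by move=> i; rewrite addnAC h3.
- by move=> i; rewrite addSn.
- by move=> i; rewrite addSn.
Qed.

(** With $Y_i = c_i b_i$ and $Z_i = b_i c_{i+1}$, exchanging again gives $c_{i+1} b_{i+1} =
    Y_{i+1}$; hence the shift by one. *)
Lemma strip_back Y c Z : strip Y c Z -> strip Z (bstrip Y c) (fun i => Y (i + 1)).
Proof.
case=> h1 h2 h3 h4 h5; split=> //; first exact: row2_shift.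
- by case: h1 => h1 _ _ i; rewrite /bstrip h3 h1 tauz_squo.
- move=> i; have /and4P[a1 a2 a3 a4] := nx_out (h4 i).
  have /and4P[b1 b2 b3 b4] := nx_out (h4 i.+1).
  have /and4P[c1 c2 c3 c4] := nx_back (h4 i).
  case: h2 => _ k2 k3; rewrite /nx !k2 k3 /= /bstrip !h5 a4 b4 a2 b2.
  exact: c2.
- move=> i; have /and4P[/eqP c1 _ _ _] := nx_back (h4 i).
  by rewrite addn1 /bstrip h5.
Qed.

(** One atom determines all atoms to its right by [nx_det], and periodicity carries this around to
    the indices on its left. *)
Lemma strip_det Y c d Z Z' : strip Y c Z -> strip Y d Z' ->
  forall j, c j = d j -> c =1 d /\ Z =1 Z'.
Proof.
move=> [_ _ tc n1 o1] [_ _ td n2 o2] j e.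
have h i : c (j + i) = d (j + i).
  elim: i => [|i IH]; first by rewrite addn0.
  rewrite addnS; have hd := n2 (j + i); rewrite -IH in hd.
  exact/esym/eqP/(nx_det (n1 _) hd).
have ec : c =1 d.
  move=> i; rewrite -(twist_per tc j i) -(twist_per td j i).
  by rewrite (_ : i + N * j = j + (i + (N.-1) * j)) ?h // /N; nia.
by split=> // i; rewrite o1 o2 !ec.
Qed.

Definition strip_path (m : nat) (Yr cs : nat -> nat -> simp) : Prop :=
  (forall k, k < m -> strip (Yr k) (cs k) (Yr k.+1)) /\
  (forall k, k.+1 < m -> cs k.+1 0 <> bstrip (Yr k) (cs k) 0).

(** * Types along a non-backtracking path *)

Section Path.
Variables (m : nat) (Yr cs : nat -> nat -> simp).
Hypothesis hp : strip_path m Yr cs.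

(* Row k.+1 carries the strip [cs k.+1] leading forward and the strip [back k]
   leading back to row k. *)
Local Notation back k := (bstrip (Yr k) (cs k)).

Lemma nx_cs k i : k < m -> nx (Yr k i) (cs k i) (Yr k i.+1) (cs k i.+1).
Proof. by case: hp => h _ /h[]. Qed.

Lemma out_cs k i : k < m -> Yr k.+1 i = out (Yr k i) (cs k i) (cs k i.+1).
Proof. by case: hp => h _ /h[]. Qed.

Lemma slen_Yr k i : k < m -> slen (Yr k.+1 i) = 2.
Proof. by case: hp => h _ /h[_ [_ ->]]. Qed.

Lemma nx_bk k i : k < m -> nx (Yr k.+1 i) (back k i) (Yr k.+1 i.+1) (back k i.+1).
Proof. by case: hp => h _ /h/strip_back[]. Qed.

(** A path avoids backtracking at index 0 by definition; agreement at any other index would spread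
    to 0 by [strip_det]. *)
Lemma cs_neq_back k i : k.+1 < m -> cs k.+1 i != back k i.
Proof.
move=> hk; apply/eqP => e; case: hp => h1 h2; apply: (h2 k hk).
have [h _] := strip_det (h1 _ hk) (strip_back (h1 _ (ltnW hk))) e.
exact: h.
Qed.

Lemma Yr_per k n i : k < m -> Yr k.+1 (i + N * n) = Yr k.+1 i.
Proof. by case: hp => h _ /h[_ [h1 _ _] _ _ _]; exact: twist_per h1 n i. Qed.

Lemma cs_per k n i : k < m -> cs k (i + N * n) = cs k i.
Proof. by case: hp => h _ /h[_ _ h1 _ _]; exact: twist_per h1 n i. Qed.

Lemma back_per k n i : k < m -> back k (i + N * n) = back k i.
Proof. by case: hp => h _ /h/strip_back[_ _ h1 _ _]; exact: twist_per h1 n i. Qed.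

Definition isX k i : bool := Xt (Yr k.+1 i) (back k i) (cs k.+1 i).
Definition isY k i : bool := Yt (Yr k.+1 i) (back k i) (cs k.+1 i).

Lemma isX_per k n i : k.+1 < m -> isX k (i + N * n) = isX k i.
Proof. by move=> hk; rewrite /isX Yr_per ?back_per ?cs_per // ltnW. Qed.
Lemma isY_per k n i : k.+1 < m -> isY k (i + N * n) = isY k i.
Proof. by move=> hk; rewrite /isY Yr_per ?back_per ?cs_per // ltnW. Qed.

Lemma pairpE k i : k < m -> pairp (Yr k.+1 i) = ~~ tri (Yr k.+1 i).
Proof. by move=> hk; apply/eqP/tri_pair; rewrite slen_Yr. Qed.

Lemma isXE k i : k.+1 < m -> tri (Yr k.+1 i) -> isX k i = ~~ isY k i.
Proof.
move=> hk ht; have h1 := nx_bk i (ltnW hk); have h2 := nx_cs i hk.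
apply/eqP; apply: type_tri => //.
- by case/and5P: h1.
- by case/and5P: h2.
- by case/and5P: h1 => _ _ _ _ /and4P[].
- by case/and5P: h2 => _ _ _ _ /and4P[].
- by rewrite eq_sym cs_neq_back.
Qed.

Lemma isX_tri k i : isX k i -> tri (Yr k.+1 i). Proof. by case/andP. Qed.
Lemma isY_tri k i : isY k i -> tri (Yr k.+1 i). Proof. by case/andP. Qed.

Lemma isX_next k i : k.+1 < m -> tri (Yr k.+1 i) -> tri (Yr k.+1 i.+1) ->
  isX k i = isX k i.+1.
Proof.
move=> hk h1 h2; apply/eqP.
by apply: type_F1 (nx_cs i hk) (nx_bk i (ltnW hk)) _ h1 h2; rewrite eq_sym cs_neq_back.
Qed.

Lemma isY_next k i : k.+1 < m -> tri (Yr k.+1 i) -> tri (Yr k.+1 i.+1) ->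
  isY k i = isY k i.+1.
Proof.
move=> hk h1 h2; apply/negb_inj; rewrite -!isXE //; exact: isX_next.
Qed.

Lemma A_step_path k i : k.+2 < m -> tri (Yr k.+1 i.+1) -> ~~ tri (Yr k.+2 i) ->
  tri (Yr k.+2 i.+1) -> isY k.+1 i.+1.
Proof.
move=> hk h1 h2 h3; have hk1 := ltnW hk.
have := @A_step _ _ _ _ _ _ (cs k.+2 i) (cs k.+2 i.+1) (nx_cs i hk1) (nx_cs i.+1 hk1) h1.
rewrite -!out_cs // pairpE // h2 /isY => h; apply: h => //.
  exact: nx_cs.
exact: cs_neq_back.
Qed.

Lemma B_step_path k i : k.+2 < m -> tri (Yr k.+1 i.+1) -> ~~ tri (Yr k.+2 i.+1) ->
  tri (Yr k.+2 i) -> isX k.+1 i.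
Proof.
move=> hk h1 h2 h3; have hk1 := ltnW hk.
have := @B_step _ _ _ _ _ _ (cs k.+2 i) (cs k.+2 i.+1) (nx_cs i hk1) (nx_cs i.+1 hk1) h1.
rewrite -!out_cs // pairpE // h2 /isX => h; apply: h => //.
  exact: nx_cs.
exact: cs_neq_back.
Qed.

(** Induction to the right, starting from the pair at j. If the new row has a pair just before,
    [A_step] restarts the run with type Y; otherwise the type is inherited from the left neighbour.
    [isX_persist] is the mirror image, anchored at a pair on the right. *)
Lemma isY_persist k j i : k.+2 < m -> ~~ tri (Yr k.+1 j) -> j < i -> isY k i ->
  tri (Yr k.+2 i) -> isY k.+1 i.
Proof.
move=> hk hj; elim: i => // i IH; rewrite ltnS => hji hY ht.
have hk1 := ltnW hk; have hk2 := ltnW hk1.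
case tu: (tri (Yr k.+1 i)); last first.
  apply: A_step_path => //; first exact: isY_tri hY.
  rewrite -pairpE // out_cs //.
  apply: Y_entry (nx_cs i hk1) (nx_bk i hk2) _ _ hY; last by rewrite pairpE // tu.
  by rewrite eq_sym cs_neq_back.
case tu': (tri (Yr k.+2 i)); last first.
  by apply: A_step_path; rewrite ?tu' //; exact: isY_tri hY.
rewrite -isY_next //; apply: IH => //.
  by rewrite ltn_neqAle hji andbT; apply: contraNneq hj => ->; rewrite tu.
by rewrite isY_next // (isY_tri hY).
Qed.

Lemma isX_persist k n i : k.+2 < m -> ~~ tri (Yr k.+1 (i.+1 + n)) -> isX k i.+1 ->
  tri (Yr k.+2 i) -> isX k.+1 i.
Proof.
move=> hk; have hk1 := ltnW hk; have hk2 := ltnW hk1.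
elim: n i => [|n IH] i hj hX ht; first by move: hj; rewrite addn0 (isX_tri hX).
case tv: (tri (Yr k.+2 i.+1)); last first.
  by apply: B_step_path; rewrite ?tv //; exact: isX_tri hX.
case tw: (tri (Yr k.+1 i.+2)); last first.
  have := X_exit (nx_cs i.+1 hk1) (nx_bk i.+1 hk2) _ hX.
  rewrite pairpE // tw -out_cs // pairpE // tv eq_sym cs_neq_back //.
  by move=> /(_ isT isT).
rewrite isX_next //; apply: IH => //; first by rewrite addSnnS.
by rewrite -isX_next // (isX_tri hX).
Qed.

Lemma Y_exit_path k i : k.+1 < m -> isY k i -> ~~ tri (Yr k.+1 i.+1) -> tri (Yr k.+2 i).
Proof.
move=> hk hY hp'; rewrite out_cs //.
apply: Y_exit (nx_cs i hk) (nx_bk i (ltnW hk)) _ hY _; last by rewrite pairpE // ltnW.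
by rewrite eq_sym cs_neq_back.
Qed.

Lemma X_entry_path k i : k.+1 < m -> ~~ tri (Yr k.+1 i) -> isX k i.+1 -> tri (Yr k.+2 i).
Proof.
move=> hk hp' hX; rewrite out_cs //.
apply: X_entry (nx_cs i hk) (nx_bk i (ltnW hk)) _ _ hX; last by rewrite pairpE // ltnW.
by rewrite eq_sym cs_neq_back.
Qed.

Hypothesis hpair : forall k, k < m -> exists i, ~~ tri (Yr k.+1 i).

Lemma pair_below k i : k < m -> exists n, exists2 j, ~~ tri (Yr k.+1 j) & j < i + N * n.
Proof.
move=> hk; have [j hj] := hpair hk; exists j.+1; exists j => //.
by rewrite /N; nia.
Qed.

Lemma pair_above k i : k < m -> exists n, ~~ tri (Yr k.+1 (i + n)).
Proof.
move=> hk; have [j hj] := hpair hk; exists (j + N * i - i).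
rewrite subnKC; last by rewrite /N; nia.
by rewrite Yr_per.
Qed.

Lemma isY_up k i : k.+2 < m -> isY k i -> tri (Yr k.+2 i) -> isY k.+1 i.
Proof.
move=> hk hY ht; have hk1 := ltnW hk; have hk2 := ltnW hk1.
have [n [j hj hlt]] := pair_below i hk2.
rewrite -(isY_per n) //; apply: isY_persist hj hlt _ _ => //.
  by rewrite isY_per.
by rewrite Yr_per.
Qed.

Lemma isX_up k i : k.+2 < m -> isX k i.+1 -> tri (Yr k.+2 i) -> isX k.+1 i.
Proof.
move=> hk hX ht; have [n hn] := pair_above i.+1 (ltnW (ltnW hk)).
exact: isX_persist hn hX ht.
Qed.

(* The pairs between a block of type Y and a later block of type X disappear
   one by one. *)
Lemma mixed_bound d k i : k.+1 < m -> isY k i -> isX k (i + d) -> m <= k.+1 + d.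
Proof.
elim: d k i => [|d IH] k i hk hY hX.
  by move: hX; rewrite addn0 isXE ?hY // (isY_tri hY).
case t1: (tri (Yr k.+1 i.+1)).
  rewrite addnS; apply: leqW; apply: (IH k i.+1) => //; last by rewrite addSnnS.
  by rewrite -isY_next // (isY_tri hY).
have t2 : tri (Yr k.+2 i) by apply: Y_exit_path => //; rewrite t1.
case: (ltnP k.+2 m) => hk2; last by rewrite addnS; apply: leq_trans hk2 _; lia.
have hY2 := isY_up hk2 hY t2.
rewrite addnS in hX.
case t3: (tri (Yr k.+1 (i + d))).
  rewrite addnS; apply: leqW; apply: (IH k i) => //.
  by rewrite isX_next // (isX_tri hX).
have t4 : tri (Yr k.+2 (i + d)) by apply: X_entry_path => //; rewrite t3.
by rewrite addnS -addSn; apply: (IH k.+1 i) => //; exact: isX_up.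
Qed.

(** Periodicity brings a letter of type X to less than N places to the right of the given letter of
    type Y, so the gap in [mixed_bound] is below N. *)
Lemma mixed_row k i j : k.+1 < m -> isY k i -> isX k j -> m <= k.+1 + N.
Proof.
move=> hk hY hX; have N0 : 0 < N by rewrite /N; lia.
pose e := (j + N * i - i) %% N.
apply: leq_trans (mixed_bound (d := e) hk hY _) _; last first.
  by rewrite leq_add2l ltnW // ltn_mod.
rewrite -(isX_per ((j + N * i - i) %/ N)) // -addnA [e + _]addnC mulnC -divn_eq.
by rewrite subnKC ?isX_per //; move: N0; nia.
Qed.

(** Type X survives at the left end of a run, where the pair in front turns into a 3-cycle of type
    X; type Y survives in the same way at the right end. *)
Lemma isX_some k i : k.+2 < m -> isX k i -> exists j, isX k.+1 j.
Proof.
move=> hk; have hk1 := ltnW hk; have hk2 := ltnW hk1.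
have [n [j hj hlt]] := pair_below i hk2; rewrite -(isX_per n) //.
move: (i + N * n) hlt; elim=> // l IH; rewrite ltnS leq_eqVlt => /orP[/eqP ej|hlt] hX.
  by subst l; exists j; apply: isX_up => //; apply: X_entry_path.
case tl: (tri (Yr k.+1 l)); last first.
  by exists l; apply: isX_up => //; apply: X_entry_path; rewrite ?tl.
by apply: IH => //; rewrite isX_next // (isX_tri hX).
Qed.

Lemma isY_some k i : k.+2 < m -> isY k i -> exists j, isY k.+1 j.
Proof.
move=> hk; have hk1 := ltnW hk; have hk2 := ltnW hk1.
have [n hn] := pair_above i hk2; elim: n i hn => [|n IH] i hn hY.
  by move: hn; rewrite addn0 (isY_tri hY).
case tl: (tri (Yr k.+1 i.+1)); last first.
  by exists i; apply: isY_up => //; apply: Y_exit_path; rewrite ?tl.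
by apply: (IH i.+1); rewrite ?addSnnS // -isY_next // (isY_tri hY).
Qed.

Lemma isX_later k k' i : k <= k' -> k'.+1 < m -> isX k i -> exists j, isX k' j.
Proof.
move=> /subnKC <-; elim: (k' - k) => [|d IH]; first by rewrite addn0; exists i.
by rewrite addnS => hd /IH[|j /isX_some]; [exact: ltnW | exact].
Qed.

Lemma isY_later k k' i : k <= k' -> k'.+1 < m -> isY k i -> exists j, isY k' j.
Proof.
move=> /subnKC <-; elim: (k' - k) => [|d IH]; first by rewrite addn0; exists i.
by rewrite addnS => hd /IH[|j /isY_some]; [exact: ltnW | exact].
Qed.

(** Since both types survive, two different types in rows of this range would meet in a common row,
    and [mixed_row] leaves room for at most N further steps. *)
Lemma pure_rows n : n.+1 + N < m ->
  (forall k i, k < n -> ~~ isX k i) \/ (forall k i, k < n -> ~~ isY k i).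
Proof.
move=> hn.
have nomix k i j : k < n -> isY k i -> isX k j -> False.
  by move=> hk hY hX; have := mixed_row (ltac:(lia) : k.+1 < m) hY hX; lia.
have [hX|hX] := Classical_Prop.classic (exists k i, k < n /\ isX k i); last first.
  by left=> k i hk; apply/negP => h; apply: hX; exists k, i.
right=> k i hk; apply/negP => hY; case: hX => k' [i' [hk' hX]].
case: (leqP k k') => hkk.
  have [j hj] := isY_later hkk (ltac:(lia) : k'.+1 < m) hY.
  exact: nomix hk' hj hX.
have [j hj] := isX_later (ltnW hkk) (ltac:(lia) : k.+1 < m) hX.
exact: nomix hk hY hj.
Qed.

Lemma cs_cell k i : k < m -> [/\ slen (cs k i) == 1, slen (back k i) == 1 &
  sprd (cs k i) (back k i) (Yr k i)].
Proof.
move=> hk; have h := nx_cs i hk; have /andP[h1 h2] := nx_atom h.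
by have /and4P[_ _ _ h3] := nx_out h; split=> //; exact: sprd_squo.
Qed.

Lemma bk_cell k i : k < m -> sprd (back k i) (cs k i.+1) (Yr k.+1 i).
Proof.
move=> hk; have := nx_cs i hk => /nx_out/and4P[_ h1 /eqP h2 _].
by rewrite out_cs // -{1}h2; exact: sprd_squo.
Qed.

(** Without type X the backward atoms are the same in all these rows and conjugate the forward
    atoms. Without type Y the forward atoms only shift and conjugate the backward atoms. Both cases
    have period 12 N. The comparison starts at row 1, since row 0 has no backward strip. *)
Lemma long_path_repeats (n := (12 * N).+1) : n.+1 + N < m ->
  cs n =1 cs 1 /\ Yr n =1 Yr 1.
Proof.
move=> hn; have lt k : k <= n -> k < m by move=> hk; lia.
suff [hc hb] : (forall i, cs n i = cs 1 i) /\ (forall i, back n i = back 1 i).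
  split=> // i; have [_ _ h1] := cs_cell i (lt n (leqnn n)).
  have [_ _ h2] := cs_cell i (lt 1 (ltac:(lia))).
  by rewrite (smul_sprd h1) (smul_sprd h2) hc hb.
have cper k j i : k <= n -> cs k (i + N * j) = cs k i.
  by move=> hk; apply: cs_per; exact: lt.
have bper k j i : k <= n -> back k (i + N * j) = back k i.
  by move=> hk; apply: back_per; exact: lt.
have sleb k i : k < n -> sle (back k i) (Yr k.+1 i) && sle (cs k.+1 i) (Yr k.+1 i).
  move=> hk; have /nx_atom/andP[_ ->] := nx_bk i (lt k (ltnW hk)).
  by have /nx_atom/andP[_ ->] := nx_cs i (lt k.+1 hk).
have pairs k i : k < n -> ~~ tri (Yr k.+1 i) ->
    (squo (cs k.+1 i) (Yr k.+1 i) == back k i) && (squo (back k i) (Yr k.+1 i) == cs k.+1 i).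
  move=> hk ht; have /andP[s1 s2] := sleb k i hk.
  have [a1 _ _] := cs_cell i (lt k.+1 hk); have [_ a2 _] := cs_cell i (lt k (ltnW hk)).
  apply: type_pair => //; first by rewrite pairpE // lt // ltnW.
  by rewrite eq_sym cs_neq_back //; apply: lt.
have [hX|hY] := pure_rows hn.
- have bS k i : k < n -> back k.+1 i = back k i.
    move=> hk; rewrite {1}/bstrip; apply/eqP.
    case t: (tri (Yr k.+1 i)); last by have /andP[] := pairs k i hk (negbT t).
    have hY : isY k i.
      by have := hX k i hk; rewrite isXE ?t ?negbK //; apply: lt.
    have [a1 _ _] := cs_cell i (lt k.+1 hk); have [_ a2 _] := cs_cell i (lt k (ltnW hk)).
    exact: type_Y_squo hY a2 a1.
  have b0 k i : k <= n -> back k i = back 0 i.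
    by elim: k => // k IH hk; rewrite bS // IH // ltnW.
  split=> i; last by rewrite !b0.
  (* The recursion links [cs k.+1 i] to [cs k i.+1], so it is read along the diagonal on which the
     row number falls as the index grows. *)
  have := @pconj_period N (fun j => cs (n - j) (i + j)) (fun j => back 0 (i + j)) n
     _ _ _ _ 0 _.
  rewrite add0n addn0 subn0 (_ : n - 12 * N = 1); last by rewrite /n; lia.
  rewrite [12 * N]mulnC cper // => h; symmetry; apply: h; last by rewrite /n; lia.
  + by move=> j; have [_ ? _] := cs_cell (i + j) (lt 0 isT).
  + by move=> j hj; have [] := cs_cell (i + j) (lt (n - j) (leq_subr _ _)).
  + by move=> j; rewrite addnA -(bper 0 1 (i + j)) ?muln1.
  + move=> j hj; rewrite addnS (_ : n - j = (n - j.+1).+1); last by lia.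
    set k := n - j.+1; have hk : k < n by rewrite /k; lia.
    have [a1 _ a3] := cs_cell (i + j) (lt k.+1 hk).
    have a4 := bk_cell (i + j) (lt k (ltnW hk)).
    have [a5 _ _] := cs_cell (i + j).+1 (lt k (ltnW hk)).
    have [_ a6 _] := cs_cell (i + j) (lt 0 isT).
    rewrite b0 // in a3; rewrite b0 ?(ltnW hk) // in a4.
    by apply: pconjP a3 a4; rewrite mem_atoms.
- have cS k i : k < n -> cs k.+1 i = cs k i.+1.
    move=> hk; have [a1 _ _] := cs_cell i (lt k.+1 hk).
    have [_ a2 _] := cs_cell i (lt k (ltnW hk)).
    have /nx_out/and4P[_ _ /eqP e _] := nx_cs i (lt k (ltnW hk)).
    rewrite -out_cs ?lt ?(ltnW hk) // in e.
    rewrite -e; apply/esym/eqP.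
    case t: (tri (Yr k.+1 i)); last by have /andP[] := pairs k i hk (negbT t).
    have hX : isX k i.
      by have := hY k i hk; rewrite isXE ?t //; apply: lt.
    exact: type_X_squo hX a2 a1.
  have c0 k i : k <= n -> cs k i = cs 0 (i + k).
    by elim: k i => [|k IH] i hk; rewrite ?addn0 // cS // IH ?(ltnW hk) // addSnnS.
  split=> i.
    rewrite (c0 n) // (c0 1) // (_ : i + n = i + 1 + N * 12); last by rewrite /n; lia.
    exact: cper.
  have := @pconj_period N (fun j => back j.+1 i) (fun j => cs 0 (i + j.+2)) (12 * N)
     _ _ _ _ 0 _.
  rewrite add0n => h; apply: h; last by [].
  + by move=> j; have [] := cs_cell (i + j.+2) (lt 0 isT).
  + by move=> j hj; have [_ ? _] := cs_cell i (lt j.+1 (ltac:(rewrite /n; lia))).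
  + by move=> j; rewrite -!addSn addnA -(cper 0 1 (i + j.+2)) ?muln1.
  + move=> j hj; have hk : j.+1 < n by rewrite /n; lia.
    rewrite -c0 //.
    have [a1 a2 a3] := cs_cell i (lt j.+2 hk).
    have [_ a5 _] := cs_cell i (lt j.+1 (ltnW hk)).
    have a4 := bk_cell i (lt j.+1 (ltnW hk)); rewrite -cS // in a4.
    by apply: pconjP a4 a3; rewrite mem_atoms.
Qed.

End Path.

End Rows.

(** * Rows reached through strips *)

Section Reach.
Variables (r : nat) (p : int).
Hypothesis r_gt0 : 0 < r.

Let N := 4 * r.
Local Notation strip := (strip r p).
Local Notation strip_path := (strip_path r p).

Variable Y0 : nat -> simp.
Hypothesis row_Y0 : row2 r p Y0.

(* Non-backtracking: Z is reached from Y0 through m strips, the first one starting with a. *)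
Definition NB (m : nat) (a : simp) (Z : nat -> simp) : Prop :=
  exists Yr cs, [/\ strip_path m Yr cs, Yr 0 =1 Y0, Yr m =1 Z & 0 < m -> cs 0 0 = a].

Lemma path_sub m k Yr cs : k <= m -> strip_path m Yr cs -> strip_path k Yr cs.
Proof. by move=> hk [h1 h2]; split=> l hl; [apply: h1 | apply: h2]; lia. Qed.

Lemma NB_sub m a Z k Yr cs : strip_path m Yr cs -> Yr 0 =1 Y0 -> Yr m =1 Z ->
  (0 < m -> cs 0 0 = a) -> k <= m -> NB k a (Yr k).
Proof.
move=> h1 h2 h3 h4 hk; exists Yr, cs; split=> //; first exact: path_sub hk h1.
by move=> k0; apply: h4; exact: leq_trans hk.
Qed.

Lemma NB_row m a Z : NB m a Z -> row2 r p Z.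
Proof.
case=> Yr [cs [[h1 _] h2 h3 _]]; case: m h1 h3 => [|m] h1 h3.
  by apply: row2_ext row_Y0 => i; rewrite -h3 h2.
by apply: row2_ext h3 _; case: (h1 m (ltnSn m)).
Qed.

Hypothesis has_pair : forall m a Z, NB m a Z -> exists i, ~~ tri (Z i).

(** At a pair letter only two atoms are available and the backward strip takes one of them; so two
    continuations agree there, and by [strip_det] everywhere. Only the first strip needs the atom
    a. *)
Lemma NB_uniq m a Z Z' : NB m a Z -> NB m a Z' -> Z =1 Z'.
Proof.
move=> [Yr [cs [h1 h2 h3 h4]]] [Yr' [cs' [h1' h2' h3' h4']]].
have main k : k <= m -> Yr k =1 Yr' k /\ (forall l, l < k -> Yr l =1 Yr' l /\ cs l =1 cs' l).
  elim: k => [|k IH] hk; first by split=> // i; rewrite h2 h2'.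
  have [eY ec] := IH (ltnW hk).
  case: (h1) => s1 n1; case: (h1') => s1' n1'.
  have st' : strip (Yr k) (cs' k) (Yr' k.+1).
    by apply: strip_ext (s1' k hk) => // i; rewrite eY.
  suff [j ej] : exists j, cs k j = cs' k j.
    have [e1 e2] := strip_det r_gt0 (s1 k hk) st' ej; split=> // l.
    by rewrite ltnS leq_eqVlt => /orP[/eqP->|/ec].
  case: k hk eY ec {IH st'} => [|k] hk eY ec.
    by exists 0; rewrite h4 // h4'.
  have [i hi] := has_pair (NB_sub h1 h2 h3 h4 (ltnW hk)).
  exists i; have hk1 := ltnW hk.
  have hpr : pairp (Yr k.+1 i) by rewrite (pairpE h1).
  have c1 := cs_neq_back r_gt0 h1 i hk; have c2 := cs_neq_back r_gt0 h1' i hk.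
  have /andP[b1 b2] := nx_atom (nx_bk h1 i hk1).
  have /andP[d1 d2] := nx_atom (nx_cs h1 i hk).
  have /andP[e1 e2] := nx_atom (nx_cs h1' i hk).
  have eb : bstrip (Yr' k) (cs' k) i = bstrip (Yr k) (cs k) i.
    by have [eYk eck] := ec k (ltnSn k); rewrite /bstrip eYk eck.
  rewrite eb in c2; rewrite -eY in e2.
  rewrite eq_sym in c1; rewrite eq_sym in c2.
  have /andP[_ /eqP <-] := type_pair hpr b1 d1 b2 d2 c1.
  by have /andP[_ /eqP <-] := type_pair hpr b1 e1 b2 e2 c2.
by move=> i; rewrite -h3 -h3'; case: (main m (leqnn m)).
Qed.

(** The middle alternative is the retracing of the last strip, which returns the previous row
    shifted by one. *)
Lemma NB_extend m a Z d Z' : NB m a Z -> strip Z d Z' ->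
  [\/ m = 0 /\ NB 1 (d 0) Z',
      exists2 W, NB m.-1 a W & Z' =1 (fun i => W (i + 1)) | NB m.+1 a Z'].
Proof.
move=> [Yr [cs [h1 h2 h3 h4]]] hd.
case: m h1 h3 h4 => [|m] h1 h3 h4.
  constructor 1; split=> //.
  exists (fun k => if k is 0 then Y0 else Z'), (fun _ => d); split=> //.
  split=> // -[|//] _; apply: strip_ext hd => // i; by rewrite -h3 h2.
case: (h1) => s1 n1.
have [e|ne] := eqVneq (d 0) (bstrip (Yr m) (cs m) 0).
  constructor 2; exists (Yr m); first exact: NB_sub h1 h2 h3 h4 (leqnSn m).
  have hb := strip_back (s1 m (ltnSn m)).
  have hd' : strip (Yr m.+1) d Z' by apply: strip_ext hd => // i; rewrite h3.
  by have [_] := strip_det r_gt0 hd' hb e.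
constructor 3.
exists (fun k => if k <= m.+1 then Yr k else Z'), (fun k => if k <= m then cs k else d).
split; [|by []|by move=> i; rewrite ltnn|by move=> _; apply: h4].
split=> k /= hk.
  case: (ltnP m k) => hkm.
    have e : k = m.+1 by lia.
    by subst k; rewrite leqnn ltnn; apply: strip_ext hd => // i; rewrite h3.
  by rewrite (leqW hkm) ltnS hkm; apply: s1.
rewrite !ltnS in hk; rewrite hk (leqW hk); case: (ltnP k m) => hkm.
  by apply: n1.
have e : k = m by lia.
by subst k; apply/eqP.
Qed.

(** Rows 1 and 12 N + 1 agree together with their forward strips, so rows 1 to 12 N can be cut out.
    Row 0 and its strip remain, which preserves a. *)
Lemma NB_short m a Z : (12 * N).+2 + N < m -> NB m a Z -> exists2 m', m' < m & NB m' a Z.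
Proof.
move=> hm [Yr [cs [h1 h2 h3 h4]]]; case: (h1) => s1 n1.
have hpair k : k < m -> exists i, ~~ tri (Yr k.+1 i).
  by move=> hk; apply: has_pair (NB_sub h1 h2 h3 h4 hk).
have [ec eY] := long_path_repeats r_gt0 h1 hpair hm.
set n := (12 * (4 * r)).+1 in ec eY.
pose q := n.-1; have q0 : 0 < q by rewrite /q /n; lia.
have hn : n = q + 1 by rewrite /q /n; lia.
have hqm : q.+2 < m by move: hm; rewrite /q /n /N; lia.
exists (m - q); first by lia.
exists (fun k => if k is 0 then Yr 0 else Yr (k + q)), (fun k => if k is 0 then cs 0 else cs (k +
  q)).
split; [|by []| |by move=> _; apply: h4; lia]; last first.
  by move=> i; case e: (m - q) => [|l]; [lia | rewrite -e subnK ?h3 //; lia].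
split.
- case=> [|k] hk; last by rewrite !addSn; apply: s1; lia.
  have e1 : Yr 1 =1 Yr (1 + q) by move=> i; rewrite addnC -hn eY.
  exact: strip_ext (frefl _) (frefl _) e1 (s1 0 (ltac:(lia))).
- case=> [|k] hk; last by rewrite !addSn; apply: n1; lia.
  have -> : cs (1 + q) 0 = cs 1 0 by rewrite addnC -hn ec.
  by apply: n1; lia.
Qed.

Definition coded (M : nat) (x : nat * simp * nat) (Z : nat -> simp) : Prop :=
  [/\ x.1.1 <= M, x.2 < N & exists2 W, NB x.1.1 x.1.2 W & Z =1 (fun i => W (i + x.2))].

Lemma coded_uniq M x Z Z' : coded M x Z -> coded M x Z' -> Z =1 Z'.
Proof.
move=> [_ _ [W h e]] [_ _ [W' h' e']] i.
by rewrite e e' (NB_uniq h h').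
Qed.

Let M := (12 * N).+2 + N.

Lemma NB_coded m a W j Z : NB m a W -> twist r p W -> Z =1 (fun i => W (i + j)) ->
  exists x, coded M x Z.
Proof.
move=> + tW eZ; elim/ltn_ind: m => m IH hW.
case: (leqP m M) => hm; last by have [m' hm' hW'] := NB_short hm hW; exact: IH hm' hW'.
exists (m, a, j %% N); split=> //=; first by rewrite ltn_mod /N; lia.
exists W => // i; rewrite eZ {1}(divn_eq j N) addnCA addnC mulnC.
exact: (twist_per r_gt0 tW).
Qed.

Lemma coded_step x Z c Z' : coded M x Z -> strip Z c Z' -> exists y, coded M y Z'.
Proof.
move=> [_ _ [W hW eZ]] hs; set j := x.2 in eZ.
have [[tZ _ _] [tZ' _ _] tc _ _] := hs.
(* l completes j to a multiple of the period, so a shift by l undoes a shift by j. *)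
pose l := N * j - j.
have hl : j + l = N * j by rewrite /l subnKC // /N; nia.
have rW := NB_row hW.
have hs' : strip W (fun i => c (i + l)) (fun i => Z' (i + l)).
  apply: strip_ext (strip_shift l hs) => // i.
  by rewrite eZ -addnA [l + j]addnC hl; case: rW => tW _ _; exact: (twist_per r_gt0 tW).
have eZ' : Z' =1 (fun i => Z' (i + l + j)).
  by move=> i; rewrite -addnA [l + j]addnC hl; exact/esym/(twist_per r_gt0 tZ').
have tS k : twist r p (fun i => Z' (i + k)) by move=> i; rewrite addnAC tZ'.
case: (NB_extend hW hs') => [[_ h]|[V h eV]|h].
- by apply: (NB_coded (j := j) h (tS l)) => i; rewrite eZ' addnAC.
- apply: (NB_coded (j := j + 1) h) => [|i]; first by case: (NB_row h).
  by rewrite eZ' addnAC eV -addnA.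
- by apply: (NB_coded (j := j) h (tS l)) => i; rewrite eZ' addnAC.
Qed.

End Reach.

(** * Classes containing a row of 3-cycles *)

Lemma tri_out_pair u gu v gv :
  nx u gu v gv ->
  tri u ->
  tri v ->
  ~~ tri (out u gu gv) ->
  v == stau u.
Proof.
have: all1 (fun u => all1 (fun gu => all1 (fun v => all1 (fun gv => if nx u gu v gv then if tri u
  then if tri v then if ~~ tri (out u gu gv) then v == stau u else true else true else true else
  true)))) by vm_compute.
move=> H h0 h1 h2 h3; move: H.
move=> /all1P/(_ u)/all1P/(_ gu)/all1P/(_ v)/all1P/(_ gv). by rewrite h0 h1 h2 h3.
Qed.

Lemma pairs_out_tri u gu v gv w gw d e :
  nx u gu v gv ->
  tri u ->
  tri v ->
  nx v gv w gw ->
  tri w ->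
  ~~ tri (out u gu gv) ->
  ~~ tri (out v gv gw) ->
  nx (out u gu gv) d (out v gv gw) e ->
  d != squo gu u ->
  tri (out (out u gu gv) d e).
Proof.
have: all1 (fun u => all1 (fun gu => all1 (fun v => all1 (fun gv => if nx u gu v gv then if tri u
  then if tri v then all1 (fun w => all1 (fun gw => if nx v gv w gw then if tri w then if ~~ tri
  (out u gu gv) then if ~~ tri (out v gv gw) then all1 (fun d => all1 (fun e => if nx (out u gu
  gv) d (out v gv gw) e then if d != squo gu u then tri (out (out u gu gv) d e) else true else
  true)) else true else true else true else true)) else true else true else true)))) by
  vm_compute.
move=> H h0 h1 h2 h3 h4 h5 h6 h7 h8; move: H.
move=> /all1P/(_ u)/all1P/(_ gu)/all1P/(_ v)/all1P/(_ gv). rewrite h0 h1 h2. move=> /all1P/(_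
  w)/all1P/(_ gw). rewrite h3 h4 h5 h6. move=> /all1P/(_ d)/all1P/(_ e). by rewrite h7 h8.
Qed.

Lemma pairs_out_rot u gu v gv w gw x gx d e f :
  nx u gu v gv ->
  tri u ->
  tri v ->
  nx v gv w gw ->
  tri w ->
  nx w gw x gx ->
  tri x ->
  ~~ tri (out u gu gv) ->
  ~~ tri (out v gv gw) ->
  ~~ tri (out w gw gx) ->
  nx (out u gu gv) d (out v gv gw) e ->
  d != squo gu u ->
  nx (out v gv gw) e (out w gw gx) f ->
  out (out v gv gw) e f == stau (out (out u gu gv) d e).
Proof.
have: all1 (fun u => all1 (fun gu => all1 (fun v => all1 (fun gv => if nx u gu v gv then if tri u
  then if tri v then all1 (fun w => all1 (fun gw => if nx v gv w gw then if tri w then all1 (fun x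
  => all1 (fun gx => if nx w gw x gx then if tri x then if ~~ tri (out u gu gv) then if ~~ tri
  (out v gv gw) then if ~~ tri (out w gw gx) then all1 (fun d => all1 (fun e => if nx (out u gu
  gv) d (out v gv gw) e then if d != squo gu u then all1 (fun f => if nx (out v gv gw) e (out w gw
  gx) f then out (out v gv gw) e f == stau (out (out u gu gv) d e) else true) else true else
  true)) else true else true else true else true else true)) else true else true)) else true else
  true else true)))) by vm_compute.
move=> H h0 h1 h2 h3 h4 h5 h6 h7 h8 h9 h10 h11 h12; move: H.
move=> /all1P/(_ u)/all1P/(_ gu)/all1P/(_ v)/all1P/(_ gv). rewrite h0 h1 h2. move=> /all1P/(_
  w)/all1P/(_ gw). rewrite h3 h4. move=> /all1P/(_ x)/all1P/(_ gx). rewrite h5 h6 h7 h8 h9. move=>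
  /all1P/(_ d)/all1P/(_ e). rewrite h10 h11. move/all1P/(_ f). by rewrite h12.
Qed.

Lemma stau_tri y z :
  tri y ->
  tri z ->
  has (fun j => iter j stau y == z) (iota 0 4).
Proof.
have: all1 (fun y => all1 (fun z => if tri y then if tri z then has (fun j => iter j stau y == z)
  (iota 0 4) else true else true)) by vm_compute.
move=> H h0 h1; move: H.
move=> /all1P/(_ y)/all1P/(_ z). by rewrite h0 h1.
Qed.

Section AllTri.
Variables (r : nat) (p : int).
Hypothesis r_gt0 : 0 < r.

Let N := 4 * r.
Local Notation strip := (strip r p).
Local Notation row2 := (row2 r p).

Definition all_tri (Y : nat -> simp) : Prop := forall i, tri (Y i).

Lemma strip_unshift Z c Z' j W : row2 W -> Z =1 (fun i => W (i + j)) -> strip Z c Z' ->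
  exists d W', strip W d W' /\ Z' =1 (fun i => W' (i + j)).
Proof.
move=> [tW _ _] eZ hs; have [_ [tZ' _ _] _ _ _] := hs.
pose l := N * j - j.
have hl : j + l = N * j by rewrite /l subnKC // /N; nia.
exists (fun i => c (i + l)), (fun i => Z' (i + l)); split.
  apply: strip_ext (strip_shift l hs) => // i.
  by rewrite eZ -addnA [l + j]addnC hl; exact: (twist_per r_gt0 tW).
by move=> i; rewrite -addnA hl; exact/esym/(twist_per r_gt0 tZ').
Qed.

Lemma row2_mod Y j i : row2 Y -> Y (i + j %% N) = Y (i + j).
Proof.
case=> tY _ _; rewrite {2}(divn_eq j N) addnA addnAC mulnC.
exact/esym/(twist_per r_gt0 tY).
Qed.

(** If Z mixes pairs and 3-cycles, a non-backtracking strip is impossible: a run of 3-cycles would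
    begin with type Y and end with type X. If Z has pairs only, both Y and W advance by $\tau$ at
    each index, and $\tau$ is transitive on the four 3-cycles. *)
Lemma dead_end Y c Z d W : all_tri Y -> strip Y c Z -> (exists i, ~~ tri (Z i)) ->
  strip Z d W -> exists j, W =1 (fun i => Y (i + j)).
Proof.
move=> tY hc [i0 hi0] hd.
have [e|ne] := eqVneq (d 0) (bstrip Y c 0).
  by exists 1; have [] := strip_det r_gt0 hd (strip_back hc) e.
pose Yr k := if k is k'.+1 then (if k' is 0 then Z else W) else Y.
pose cs k := if k is 0 then c else d.
have hp : strip_path r p 2 Yr cs.
  by split; [case=> [|[]] | case=> // _; exact/eqP].
have nb i : d i != bstrip Y c i by have := cs_neq_back r_gt0 hp i (ltnSn 1).
have [_ [tZ sZ _] _ nc oc] := hc; have [_ _ _ nd od] := hd.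
have pZE i : pairp (Z i) = ~~ tri (Z i) by apply/eqP/tri_pair; rewrite sZ.
have [tri_ex|no_tri] := classic (exists i, tri (Z i)); last first.
  have pZ i : ~~ tri (Z i) by apply/negP => h; apply: no_tri; exists i.
  have rotY i : Y i.+1 = stau (Y i).
    by apply/eqP/(tri_out_pair (nc i) (tY _) (tY _)); rewrite -oc.
  have W0 : tri (W 0).
    rewrite od !oc; apply: pairs_out_tri (nc 0) (tY _) (tY _) (nc 1) (tY _) _ _ _ (nb 0);
    by rewrite -!oc.
  have rotW i : W i.+1 = stau (W i).
    rewrite !od !oc; apply/eqP.
    apply: pairs_out_rot (nc i) (tY _) (tY _) (nc i.+1) (tY _) (nc i.+2) (tY _) _ _ _ _ (nb i) _;
    by rewrite -!oc.
  have /hasP[j _ /eqP ej] := stau_tri (tY 0) W0.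
  exists j => i; have it U : (forall i, U i.+1 = stau (U i)) -> forall k, U k = iter k stau (U 0).
    by move=> hU; elim=> //= k <-.
  by rewrite (it W rotW) (it Y rotY) -ej -iterD.
have [f [hf1 hf2]] : exists f, ~~ tri (Z f) /\ tri (Z f.+1).
  case: tri_ex => j hj; pose n := j + N * i0.+1 - i0.
  have hn : tri (Z (i0 + n)).
    by rewrite /n subnKC ?(twist_per r_gt0 tZ) // /N; nia.
  elim: n hn => [|n IH]; first by rewrite addn0 (negbTE hi0).
  rewrite addnS => h; case t: (tri (Z (i0 + n))); first exact: IH.
  by exists (i0 + n); rewrite t.
have hY : isY Yr cs 0 f.+1.
  have := @A_step _ _ _ _ _ _ (d f) (d f.+1) (nc f) (nc f.+1) (tY _).
  rewrite -!oc => h; apply: h => //.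
  by rewrite pZE.
have [n hn] : exists n, ~~ tri (Z (f.+1 + n)).
  exists (N * f.+1 + f - f.+1); rewrite subnKC; last by rewrite /N; nia.
  by rewrite addnC (twist_per r_gt0 tZ).
elim: n f hf2 {hf1} hY hn => [|n IH] f hf2 hY hn; first by rewrite addn0 hf2 in hn.
case t: (tri (Z f.+2)).
  apply: (IH f.+1) => //; last by rewrite addSnnS.
  by rewrite -(isY_next r_gt0 hp).
have : isX Yr cs 0 f.+1; last by rewrite (isXE r_gt0 hp) ?hY.
have := @B_step _ _ _ _ _ _ (d f.+1) (d f.+2) (nc f.+1) (nc f.+2) (tY _).
rewrite -!oc => h; apply: h => //.
by rewrite pZE t.
Qed.

(** The type comparing the two strips is constant along Y, and [two_tri] then returns at every index
    the right-hand letter or at every index the left-hand one. *)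
Lemma two_tri_nbrs Y c Z d Z' : all_tri Y -> strip Y c Z -> strip Y d Z' -> c 0 <> d 0 ->
  all_tri Z -> all_tri Z' -> Z =1 Y \/ Z =1 (fun i => Y (i + 1)).
Proof.
move=> tY hc hd ne tZ tZ'.
have nb i : d i != c i.
  apply/eqP => e; apply: ne.
  by have [h _] := strip_det r_gt0 hd hc e; rewrite h.
have [_ _ _ nc oc] := hc; have [_ _ _ nd od] := hd.
have cst i : Xt (Y i) (d i) (c i) = Xt (Y 0) (d 0) (c 0).
  by elim: i => // i <-; apply/esym/eqP/(type_F1 (nc i) (nd i)).
have key i : if Xt (Y i) (d i) (c i) then Z i == Y i.+1 else Z i == Y i.
  by rewrite oc; apply: (two_tri (nc i) (nd i)); rewrite -?oc -?od.
case e: (Xt (Y 0) (d 0) (c 0)); [right|left] => i; have := key i; rewrite cst e => /eqP //.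
by rewrite addn1.
Qed.

Variable Y0 : nat -> simp.
Hypothesis row_Y0 : row2 Y0.
Hypothesis tri_Y0 : all_tri Y0.

Definition nbr (Y : nat -> simp) (a : simp) (Z : nat -> simp) : Prop :=
  exists2 c, strip Y c Z & c 0 = a.

Lemma nbr_uniq Y Y' a Z Z' : Y =1 Y' -> nbr Y a Z -> nbr Y' a Z' -> Z =1 Z'.
Proof.
move=> eY [c hc ec] [d hd ed]; have hd' : strip Y d Z'.
  by apply: strip_ext hd => // i; rewrite eY.
by have [] := strip_det r_gt0 hc hd' (etrans ec (esym ed)).
Qed.

(* The rows at distance at most two from Y0, the intermediate row being without pairs. *)
Definition near (x : option (simp * option simp)) (W : nat -> simp) : Prop :=
  match x with
  | None => W =1 Y0
  | Some (a, None) => nbr Y0 a W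
  | Some (a, Some b) => exists V, [/\ nbr Y0 a V, all_tri V & nbr V b W]
  end.

Definition tcoded (x : option (simp * option simp) * nat) (Z : nat -> simp) : Prop :=
  x.2 < N /\ exists2 W, near x.1 W & Z =1 (fun i => W (i + x.2)).

Lemma near_uniq x W W' : near x W -> near x W' -> W =1 W'.
Proof.
case: x => [[a [b|]]|] /=.
- move=> [V [h1 _ h2]] [V' [h1' _ h2']].
  exact: nbr_uniq (nbr_uniq (frefl Y0) h1 h1') h2 h2'.
- exact: nbr_uniq.
- by move=> h h' i; rewrite h h'.
Qed.

Lemma tcoded_uniq x Z Z' : tcoded x Z -> tcoded x Z' -> Z =1 Z'.
Proof.
by move=> [_ [W h e]] [_ [W' h' e']] i; rewrite e e' (near_uniq h h').
Qed.

Lemma near_row x W : near x W -> row2 W.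
Proof.
case: x => [[a [b|]]|] /=.
- by move=> [V [_ _ [c [_ ? _ _ _] _]]].
- by move=> [c [_ ? _ _ _] _].
- by move=> h; apply: row2_ext row_Y0 => i; rewrite h.
Qed.

Lemma near_tcoded x W j Z : near x W -> Z =1 (fun i => W (i + j)) -> exists y, tcoded y Z.
Proof.
move=> h e; exists (x, j %% N); split; first by rewrite ltn_mod /N; lia.
by exists W => // i; rewrite e row2_mod //; exact: near_row h.
Qed.

(** Distance two suffices. There a row W with a pair is a dead end. Otherwise, unless W retraces the
    first step, the middle row V has two different strips to rows of 3-cycles, one of them back to
    Y0, and W is a shift of V. *)
Lemma near_step x W c W' : near x W -> strip W c W' -> exists y, tcoded y W'.
Proof.
have sh0 (U : nat -> simp) : U =1 (fun i => U (i + 0)) by move=> i; rewrite addn0.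
case: x => [[a [b|]]|] /=.
- move=> [V [hV tV [e he eb]]] hc.
  have [tW|pW] := classic (all_tri W); last first.
    have [i hi] : exists i, ~~ tri (W i).
      by apply: NNPP => h; apply: pW => i; apply/negPn/negP => hi; apply: h; exists i.
    have [j hj] := dead_end tV he (ex_intro _ i hi) hc.
    exact: (near_tcoded (x := Some (a, None)) hV hj).
  have [d hd ed] := hV; have hb := strip_back hd.
  have [e0|ne] := eqVneq (e 0) (bstrip Y0 d 0).
    have [_ eW] := strip_det r_gt0 he hb e0.
    have [c' [U [hU eU]]] := strip_unshift row_Y0 eW hc.
    by apply: (near_tcoded (x := Some (c' 0, None)) _ eU); exists c'.
  have rV : row2 V by case: hd.
  have [j ej] : exists j, W =1 (fun i => V (i + j)).
    have [h|h] := two_tri_nbrs tV he hb (elimN eqP ne) tW (fun i => tri_Y0 _).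
      by exists 0 => i; rewrite addn0.
    by exists 1.
  have [c' [U [hU eU]]] := strip_unshift rV ej hc.
  by apply: (near_tcoded (x := Some (a, Some (c' 0))) _ eU); exists V; split=> //; exists c'.
- move=> hW hc; have [tW|pW] := classic (all_tri W); last first.
    have [i hi] : exists i, ~~ tri (W i).
      by apply: NNPP => h; apply: pW => i; apply/negPn/negP => hi; apply: h; exists i.
    have [d hd ed] := hW.
    have [j hj] := dead_end tri_Y0 hd (ex_intro _ i hi) hc.
    exact: (near_tcoded (x := None) _ hj).
  apply: (near_tcoded (x := Some (a, Some (c 0))) (W := W') (j := 0) _ (sh0 W')).
  by exists W; split=> //; exists c.
- move=> eW hc; have hc' : strip Y0 c W' by apply: strip_ext hc.
  by apply: (near_tcoded (x := Some (c 0, None)) (W := W') (j := 0) _ (sh0 W')); exists c.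
Qed.

Lemma tcoded_step x Z c Z' : tcoded x Z -> strip Z c Z' -> exists y, tcoded y Z'.
Proof.
move=> [_ [W hW eZ]] hs; have [d [W' [hd eZ']]] := strip_unshift (near_row hW) eZ hs.
have [y [_ [U hU eW']]] := near_step hW hd.
apply: (near_tcoded (j := x.2 + y.2) hU) => i.
by rewrite eZ' eW' addnA.
Qed.

End AllTri.

(** * Values of words and the prefix order *)

Local Open Scope group_scope.

Definition inf (g : braid) : int := (val g).1.
Definition fac (g : braid) : seq simp := (val g).2.
Definition dz (k : int) : braid := @Braid (k, [::]) isT.
Definition sv (s : simp) : braid := Braid (lact_normal s (braid_normal bone)).

Arguments inf g%_g.
Arguments fac g%_g.
Arguments dz k%_R.

Lemma val_svM s g : val (sv s * g) = lact s (val g).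
Proof. by rewrite /= gmulr_lact ?braid_normal // /gmulr /= dshift0. Qed.

Lemma val_dzM k g : val (dz k * g) = dshift k (val g).
Proof. by []. Qed.

Lemma dzD a b : dz (a + b)%R = dz a * dz b.
Proof. by apply: val_inj. Qed.

Lemma dz0 : dz 0 = 1. Proof. by apply: val_inj. Qed.

Lemma dzN k : dz (- k)%R = (dz k)^-1.
Proof. by apply: (mulIg (dz k)); rewrite -dzD addNr mulVg dz0. Qed.

Lemma sv_smul s t : sle t (sdual s) -> sv (smul s t) = sv s * sv t.
Proof.
move=> h; apply: val_inj; rewrite val_svM /= -lact_smul //.
Qed.

Lemma sv1 : sv sI = 1. Proof. by apply: val_inj. Qed.
Lemma svD : sv sD = dz 1. Proof. by apply: val_inj. Qed.

Lemma sv_dz s k : sv s * dz k = dz k * sv (tauz k s).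
Proof.
apply: val_inj; rewrite val_svM val_dzM.
by rewrite (_ : val (dz k) = dshift k (0%R, [::])) ?lact_dshift // /dshift addr0.
Qed.

Lemma sv_sdual s : sv s * sv (sdual s) = dz 1.
Proof.
have := forallS (P := fun s => sle (sdual s) (sdual s)) (ltac:(by vm_compute)) s.
by move=> h; rewrite -sv_smul // (eqP (sdualP s)) svD.
Qed.

Definition prodS (xs : seq simp) : braid := foldr (fun s g => sv s * g) 1 xs.

Lemma val_prodS xs : normal xs -> val (prodS xs) = (0%R, xs).
Proof.
move=> h; rewrite -(foldr_lact_self h) /prodS.
by elim: xs {h} => // x xs IH; rewrite [LHS]val_svM IH.
Qed.

Lemma braidE g : g = dz (inf g) * prodS (fac g).
Proof.
apply: val_inj; rewrite val_dzM val_prodS ?braid_normal //.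
by rewrite /dshift addr0 /inf /fac; case: (val g).
Qed.

Lemma prodS_cat xs ys : prodS (xs ++ ys) = prodS xs * prodS ys.
Proof. by elim: xs => /= [|x xs ->]; rewrite ?mul1g ?mulgA. Qed.

Definition latom (i : 'I_3) : simp := nth sI [:: s12; s23; s34] i.
Definition lval (l : letter) : braid :=
  if l.2 then sv (latom l.1) else (sv (latom l.1))^-1.
Definition bval (w : word) : braid := foldr (fun l g => lval l * g) 1 w.

Lemma bval_cat u v : bval (u ++ v) = bval u * bval v.
Proof. by elim: u => /= [|l u ->]; rewrite ?mul1g ?mulgA. Qed.

Lemma lvalN i b : lval (i, ~~ b) = (lval (i, b))^-1.
Proof. by case: b; rewrite /lval /= ?invgK. Qed.

Lemma bval_winv w : bval (winv w) = (bval w)^-1.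
Proof.
rewrite /winv; elim: w => /= [|[i b] w IH]; first by rewrite invg1.
by rewrite rev_cons -cats1 bval_cat IH /= lvalN mulg1 invgM.
Qed.

Lemma latomE : (latom g1 = s12) * (latom g2 = s23) * (latom g3 = s34).
Proof. by rewrite /latom /g1 /g2 /g3 !inordK. Qed.

Lemma beq_bval u v : beq u v -> bval u = bval v.
Proof.
elim=> [_ _ [c d l r h]|x|x y _ h|x y z _ h1 _ h2] //; last by rewrite h1.
rewrite !bval_cat; congr (_ * (_ * _)).
case: h => [i b||| ] /=; rewrite ?mulg1 ?lvalN ?mulgV //= /lval /= ?latomE.
- by rewrite -!sv_smul.
- have e1 : sv s12 * sv s23 = sv s23 * sv s13 by rewrite -!sv_smul.
  have e2 : sv s13 * sv s12 = sv s12 * sv s23 by rewrite -!sv_smul.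
  by rewrite [LHS]mulgA [in LHS]e1 -mulgA e2.
- have e1 : sv s23 * sv s34 = sv s34 * sv s24 by rewrite -!sv_smul.
  have e2 : sv s24 * sv s23 = sv s23 * sv s34 by rewrite -!sv_smul.
  by rewrite [LHS]mulgA [in LHS]e1 -mulgA e2.
Qed.

Lemma dpowS n : dpow n.+1 = delta ++ dpow n. Proof. by []. Qed.
Lemma dpowNS n : dpow (Negz n) = winv delta ++ dpow (- n%:Z)%R.
Proof. by case: n. Qed.

Lemma beq_delta_dpow k : beq (delta ++ dpow k) (dpow (1 + k)%R).
Proof.
case: k => n; first exact: beq_refl.
rewrite dpowNS (_ : (1 + Negz n = - n%:Z)%R); last by lia.
exact: beq_mulVKg.
Qed.

Lemma beq_deltaV_dpow k : beq (winv delta ++ dpow k) (dpow (-1 + k)%R).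
Proof.
case: k => [[|n]|n]; first by rewrite cats0; exact: beq_refl.
  rewrite dpowS (_ : (-1 + n.+1%:Z = n%:Z)%R); last by lia.
  exact: beq_mulKg.
by rewrite (_ : (-1 + Negz n = Negz n.+1)%R); [exact: beq_refl | lia].
Qed.

Lemma wordSD : wordS sD = delta. Proof. by []. Qed.

Lemma beq_wordS_delta s : beq (wordS s ++ delta) (delta ++ wordS (stau s)).
Proof.
have := forallS (P := fun s => [&& sle (sdual s) (sdual s), smul s (sdual s) == sD,
  sle (stau s) (sdual (sdual s)) & smul (sdual s) (stau s) == sD]) (ltac:(by vm_compute)) s.
case/and4P=> h1 /eqP h2 h3 /eqP h4.
have e1 := wordS_smul h1; have e2 := wordS_smul h3; move: e1 e2.
rewrite h2 h4 wordSD => e1 e2.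
apply: beq_trans (beq_catl _ (beq_sym e2)) _; rewrite catA; exact: beq_catr.
Qed.

Lemma beq_wordS_dpow s k : beq (wordS s ++ dpow k) (dpow k ++ wordS (tauz k s)).
Proof.
case: k => n.
  elim: n s => [|n IH] s; first by rewrite cats0; exact: beq_refl.
  rewrite dpowS catA; apply: beq_trans (beq_catr _ (beq_wordS_delta s)) _.
  rewrite -(catA delta (wordS _)) -(catA delta (dpow n)); apply: beq_catl.
  have := IH (stau s); rewrite -tauz1 -tauzD.
  by rewrite (_ : (n%:Z + 1 = n.+1%:Z)%R); last by lia.
have neg u : beq (wordS u ++ winv delta) (winv delta ++ wordS (tauz (-1) u)).
  apply: beq_trans (beq_sym (beq_mulKg delta _)) _; apply: beq_catl.
  rewrite catA -{1}(tauzNK 1 u) tauz1.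
  apply: beq_trans (beq_catr _ (beq_sym (beq_wordS_delta _))) _.
  rewrite -catA -[X in beq _ X]cats0; apply: beq_catl; exact: beq_mulV.
elim: n s => [|n IH] s; first by rewrite dpowNS cats0; exact: neg.
rewrite (_ : dpow (Negz n.+1) = winv delta ++ dpow (Negz n)) // catA.
apply: beq_trans (beq_catr _ (neg s)) _.
rewrite -!catA; apply: beq_catl.
have := IH (tauz (-1) s); rewrite -tauzD.
by rewrite (_ : (Negz n + -1 = Negz n.+1)%R); last by lia.
Qed.

Definition seqword (xs : seq simp) : word := flatten (map wordS xs).
Definition gword (g : int * seq simp) : word := dpow g.1 ++ seqword g.2.

Lemma beq_ins s xs : beq (wordS s ++ seqword xs) (seqword (ins s xs)).
Proof.
elim: xs s => [|x xs IH] s /=.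
  by case: eqP => [->|_]; rewrite /seqword /= ?cats0; exact: beq_refl.
rewrite /seqword /= -/(seqword xs) -/(seqword (ins (scarry s x) xs)).
have /andP[h1 h2] := smeet_sle (sdual s) x.
have /implyP/(_ h2)/andP[h3 /eqP h4] := smul_squo (smeet (sdual s) x) x.
apply: beq_trans (beq_catl _ (IH _)).
apply: (@beq_trans (wordS s ++ (wordS (smeet (sdual s) x) ++ wordS (scarry s x)) ++ seqword xs)).
  apply/beq_catl/beq_catr; rewrite -{1}h4; apply/beq_sym; exact: wordS_smul.
rewrite -catA catA; apply: beq_catr; exact: wordS_smul.
Qed.

Lemma beq_norm p xs : beq (gword (p, xs)) (gword (norm p xs)).
Proof.
elim: xs p => [|x xs IH] p; first exact: beq_refl.
case: (x =P sD) => [->|hx]; last by rewrite norm_cons //; exact: beq_refl.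
apply: beq_trans (IH _).
have -> : gword (p, sD :: xs) = dpow p ++ delta ++ seqword xs by [].
have -> : gword ((p + 1)%R, xs) = dpow (p + 1)%R ++ seqword xs by [].
rewrite catA.
apply: beq_catr; apply: beq_sym; rewrite addrC.
apply: beq_trans (beq_sym (beq_delta_dpow p)) _.
by have := beq_wordS_dpow sD p; rewrite tauzsD wordSD.
Qed.

Lemma beq_lact s g : beq (wordS s ++ gword g) (gword (lact s g)).
Proof.
apply: beq_trans (beq_norm _ _); rewrite /gword catA.
apply: beq_trans (beq_catr _ (beq_wordS_dpow s g.1)) _.
rewrite -catA; apply: beq_catl; exact: beq_ins.
Qed.

(** Faithfulness of the model: a word can be recovered up to [beq] from its normal form. This uses
    only derivations in the Artin presentation. *)
Lemma beq_gword w : beq w (gword (val (bval w))).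
Proof.
elim: w => [|[i b] w IH]; first exact: beq_refl.
have hS : sg i = wordS (latom i).
  rewrite /sg; case: i => -[|[|[|//]]] hi; rewrite /latom /wordS /aword /dec /= ;
  by congr [:: (_, _)]; apply: val_inj; rewrite /= inordK.
apply: beq_trans (beq_catl [:: (i, b)] IH) _.
case: b {IH}.
  have -> : bval ((i, true) :: w) = sv (latom i) * bval w by [].
  by rewrite val_svM -[X in beq X _]/(sg i ++ gword (val (bval w))) hS; exact: beq_lact.
have -> : bval ((i, false) :: w) = lval (i, false) * bval w by [].
set s := latom i in hS *.
have e : lval (i, false) = dz (-1) * sv (scodual s).
  rewrite /lval /= -/s; apply: (mulIg (sv s)); rewrite mulVg -mulgA.
  have /andP[h1 /eqP h2] := scodualP s.
  by rewrite -sv_smul // h2 svD -dzD dz0.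
rewrite e -mulgA val_dzM val_svM.
set g := lact _ _.
apply: (@beq_trans (winv delta ++ gword g)); last first.
  by rewrite /gword catA; apply: beq_catr; exact: beq_deltaV_dpow.
rewrite -[X in beq X _]/(winv (sg i) ++ gword (val (bval w))) hS; apply: (@beq_trans (winv delta
  ++ wordS (scodual s) ++ gword (val (bval w)))).
  rewrite catA; apply: beq_catr.
  have /andP[h1 /eqP h2] := scodualP s.
  have := wordS_smul h1; rewrite h2 wordSD => h.
  apply: beq_sym; apply: beq_trans (beq_catr _ (beq_winv (beq_sym h))) _.
  rewrite winv_cat -catA -[X in beq _ X]cats0; apply: beq_catl; exact: beq_mulVg.
apply: beq_catl; exact: beq_lact.
Qed.

Lemma beqP u v : beq u v <-> bval u = bval v.
Proof.
split; first exact: beq_bval.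
move=> e; apply: beq_trans (beq_gword u) _; rewrite e; exact: beq_sym (beq_gword v).
Qed.

Lemma inf_dzM k g : inf (dz k * g) = (k + inf g)%R. Proof. by []. Qed.

Lemma norm_ge p xs : (p <= (norm p xs).1)%R.
Proof. by elim: xs p => [|[] xs IH] p //=; apply: le_trans (IH _); lia. Qed.

Lemma inf_svM s g : (inf g <= inf (sv s * g)%g)%R.
Proof. by rewrite /inf val_svM; exact: norm_ge. Qed.

Lemma infM g h : (inf g + inf h <= inf (g * h)%g)%R.
Proof.
rewrite {2}(braidE g) -mulgA inf_dzM lerD2l.
elim: (fac g) => /= [|x xs IH]; first by rewrite mul1g.
by rewrite -mulgA; apply: le_trans IH (inf_svM _ _).
Qed.

Lemma inf_dz k : inf (dz k) = k. Proof. by []. Qed.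

Lemma inf_Mdz g k : inf (g * dz k) = (inf g + k)%R.
Proof.
apply/eqP; rewrite eq_le; apply/andP; split; last exact: infM.
have := infM (g * dz k) (dz (- k)).
by rewrite -mulgA -dzD addrN dz0 mulg1 !inf_dz; lia.
Qed.

Definition pos (g : braid) : bool := (0 <= inf g)%R.
Definition ple (g h : braid) : bool := pos (g^-1 * h).

Arguments pos g%_g.
Arguments ple (g h)%_g.

Lemma posM g h : pos g -> pos h -> pos (g * h).
Proof. by rewrite /pos => a b; apply: le_trans (infM g h); lia. Qed.
Lemma pos_dz k : pos (dz k) = (0 <= k)%R. Proof. by []. Qed.
Lemma pos_sv s : pos (sv s).
Proof. by rewrite -[sv s]mulg1; exact: (inf_svM s 1). Qed.
Lemma pos_prodS xs : pos (prodS xs).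
Proof. by elim: xs => //= x xs; apply/posM/pos_sv. Qed.

Lemma ple1g g : ple 1 g = pos g. Proof. by rewrite /ple invg1 mul1g. Qed.
Lemma ple_refl g : ple g g. Proof. by rewrite /ple mulVg. Qed.
Lemma ple_trans h g k : ple g h -> ple h k -> ple g k.
Proof. by move=> a b; rewrite /ple -[g^-1](mulgK h) -mulgA; exact: posM. Qed.
Lemma ple_mul2l k g h : ple (k * g) (k * h) = ple g h.
Proof. by rewrite /ple invgM -mulgA mulKg. Qed.
Lemma ple_dzr k g h : ple (g * dz k) (h * dz k) = ple g h.
Proof.
rewrite /ple /pos invgM -dzN -mulgA inf_dzM mulgA inf_Mdz.
by rewrite addrCA addNr addr0.
Qed.
Lemma ple_mulr g h : pos h -> ple g (g * h).
Proof. by rewrite /ple mulKg. Qed.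
Lemma ple_dz a b : ple (dz a) (dz b) = (a <= b)%R.
Proof. by rewrite /ple -dzN -dzD pos_dz; lia. Qed.
Lemma ple_dz_inf k g : ple (dz k) g = (k <= inf g)%R.
Proof. by rewrite /ple -dzN /pos inf_dzM; lia. Qed.
Lemma ple_Ml k g h : ple g (k * h) = ple (k^-1 * g) h.
Proof. by rewrite -[RHS](ple_mul2l k) mulVKg. Qed.

(** * Length, heads and meets *)

Lemma sum_ins s xs :
  \sum_(x <- ins s xs) slen x = slen s + \sum_(x <- xs) slen x.
Proof.
elim: xs s => [|x xs IH] s /=.
  by case: eqP => [->|_]; rewrite ?big_seq1 big_nil ?addn0.
rewrite !big_cons IH.
have := forallS2 (P := fun s x => slen (shead s x) + slen (scarry s x) == slen s + slen x)
  (ltac:(by vm_compute)) s x.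
by move/eqP; lia.
Qed.

Lemma slen_tauz k s : slen (tauz k s) = slen s.
Proof.
rewrite /tauz; elim: `|_| => //= n <-; apply/eqP.
by move: (iter n stau s); apply: forallS; vm_compute.
Qed.

(** The exponent sum of a braid, $\delta$ being a product of three atoms. *)
Definition lenr (g : int * seq simp) : int := (3%:Z * g.1 + (\sum_(x <- g.2) slen x)%N%:Z)%R.
Definition len (g : braid) : int := lenr (val g).

Arguments len g%_g.

Lemma lenr_norm p xs : lenr (norm p xs) = lenr (p, xs).
Proof.
elim: xs p => // x xs IH p; case: (x =P sD) => [->|hx]; last by rewrite norm_cons.
rewrite /= IH /lenr /= big_cons /=; lia.
Qed.

Lemma len_svM s g : len (sv s * g) = ((slen s)%:Z + len g)%R.
Proof.
rewrite /len val_svM /lact lenr_norm /lenr /= sum_ins slen_tauz; lia.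
Qed.

Lemma len_dzM k g : len (dz k * g) = (3%:Z * k + len g)%R.
Proof. by rewrite /len /lenr /=; lia. Qed.

Lemma len1 : len 1 = 0%R. Proof. by rewrite /len /lenr /= big_nil. Qed.
Lemma lenM g h : len (g * h) = (len g + len h)%R.
Proof.
rewrite (braidE g) -mulgA !len_dzM -addrA; congr (_ + _)%R.
elim: (fac g) => /= [|x xs IH]; first by rewrite mul1g len1 add0r.
by rewrite -mulgA !len_svM IH addrA.
Qed.

Lemma lenV g : len g^-1 = (- len g)%R.
Proof. by apply/eqP; rewrite -addr_eq0 -lenM mulVg len1. Qed.
Lemma len_sv s : len (sv s) = slen s.
Proof. by rewrite -[sv s]mulg1 len_svM len1 addr0. Qed.
Lemma len_dz k : len (dz k) = (3%:Z * k)%R.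
Proof. by rewrite -[dz k]mulg1 len_dzM len1 addr0. Qed.

Lemma pos_len g : pos g -> (0 <= len g)%R.
Proof. by rewrite /pos /inf /len /lenr; lia. Qed.

Lemma slen_eq0 s : (slen s == 0) = (s == sI). Proof. by case: s. Qed.

Lemma pos_len0 g : pos g -> len g = 0%R -> g = 1.
Proof.
move=> hp hl; apply: val_inj; have /and3P[hI _ _] := braid_normal g.
move: hp hl hI; rewrite /pos /inf /len /lenr -[braid_val g]/(val g).
case: (val g) => p [|x xs] /= hp; rewrite ?big_nil ?big_cons => hl.
  by move=> _; congr (_, _); lia.
rewrite inE negb_or => /andP[hx _]; suff: slen x == 0 by rewrite slen_eq0 eq_sym (negbTE hx).
lia.
Qed.

Lemma ple_anti g h : ple g h -> ple h g -> g = h.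
Proof.
move=> a b; have hl : len (g^-1 * h) = 0%R.
  have := pos_len a; have := pos_len b; rewrite !lenM !lenV; lia.
by have := congr1 (fun z => g * z) (pos_len0 a hl); rewrite /= mulVKg mulg1.
Qed.

Lemma ple_len g h : ple g h -> (len g <= len h)%R.
Proof. by move/pos_len; rewrite lenM lenV; lia. Qed.

(** For positive g this is the meet of g and $\delta$, see [ple_hd_gen]. *)
Definition hd (g : braid) : simp := if (0 < inf g)%R then sD else head sI (fac g).

Arguments hd g%_g.

Lemma sle_sv s t : sle s t -> sv t = sv s * sv (squo s t).
Proof.
move=> h; have /implyP/(_ h)/andP[h1 /eqP h2] := smul_squo s t.
by rewrite -sv_smul // h2.
Qed.

Lemma ple_hd g : pos g -> ple (sv (hd g)) g.
Proof.
rewrite /hd; case: ltP => hp hg.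
  by rewrite svD ple_dz_inf; lia.
have e : inf g = 0%R by move: hg; rewrite /pos; lia.
rewrite {2}(braidE g) e dz0 mul1g; case: (fac g) => [|x xs] /=.
  by rewrite sv1 ple_refl.
exact/ple_mulr/pos_prodS.
Qed.

Lemma sle_hd s g : pos g -> sle s (hd (sv s * g)).
Proof.
move=> hg; rewrite /hd; case: ltP => hp; first by apply: (forallS (P := fun s => sle s sD));
  vm_compute.
have e : inf g = 0%R by have := inf_svM s g; move: hg hp; rewrite /pos; lia.
move: hp; rewrite /inf /fac val_svM /lact -/(inf g) e tauz0.
set zs := ins _ _.
have : sle s (head sI zs).
  rewrite /zs; case: (val g).2 => [|x xs] /=.
    by case: eqP => [->|_] //=; apply: (forallS (P := fun s => sle s s)); vm_compute.
  by apply: (forallS2 (P := fun s x => sle s (shead s x))); vm_compute.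
case: zs => // z zs; case: (z =P sD) => [->|hz]; last by rewrite norm_cons.
by move=> _ /= hp; have := le_trans (norm_ge (0 + 1)%R zs) hp.
Qed.

Lemma ple_sv s g : pos g -> ple (sv s) g = sle s (hd g).
Proof.
move=> hg; apply/idP/idP => [h|h].
  by rewrite -[g](mulVKg (sv s)); exact: sle_hd.
apply: ple_trans (ple_hd hg); rewrite (sle_sv h); exact/ple_mulr/pos_sv.
Qed.

Lemma hd_eq1 g : pos g -> hd g = sI -> g = 1.
Proof.
rewrite /hd; case: ltP => // hp hg.
have e : inf g = 0%R by move: hg; rewrite /pos; lia.
move=> ex; have /and3P[hI _ _] := braid_normal g; move: hI.
rewrite -[(braid_val g).2]/(fac g) => hI; rewrite (braidE g) e dz0 mul1g.
by case: (fac g) ex hI => //= x xs ->.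
Qed.

Lemma hdK g : pos g -> exists2 g', pos g' & g = sv (hd g) * g'.
Proof. by move=> hg; exists ((sv (hd g))^-1 * g); [exact: ple_hd | rewrite mulVKg]. Qed.

(** Induction on the length of U, splitting off the meet m of the heads. A common prefix E need not
    contain m; it begins with some e below m. The induction hypothesis is therefore used again after
    removing e alone, where the meet contains both the rest of E and the rest of m. *)
Lemma meet_pos U V : pos U -> pos V -> exists M, [/\ pos M, ple M U, ple M V &
  forall E, pos E -> ple E U -> ple E V -> ple E M].
Proof.
have [n] := ubnP `|len U|%N; elim: n U V => // n IH U V hn pU pV.
case: (smeet (hd U) (hd V) =P sI) => [em|nm].
  exists 1; split; rewrite ?ple1g // => E pE hEU hEV.
  have : sle (hd E) (smeet (hd U) (hd V)).
    rewrite -(eqP (smeet_glb _ _ _)) -!ple_sv //.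
    by apply/andP; split; apply: ple_trans (ple_hd pE) _.
  rewrite em => h; have e : hd E = sI.
    move: h; have := forallS (P := fun s => sle s sI ==> (s == sI)) (ltac:(by vm_compute)) (hd E).
    by move=> /implyP h /h /eqP.
  by rewrite (hd_eq1 pE e) ple_refl.
set m := smeet _ _ in nm.
have [hmU hmV] : ple (sv m) U /\ ple (sv m) V.
  by rewrite !ple_sv //; apply/andP; rewrite (eqP (smeet_glb _ _ _));
     apply: (forallS (P := fun s => sle s s)); vm_compute.
pose U' := (sv m)^-1 * U; pose V' := (sv m)^-1 * V.
have [eU eV] : U = sv m * U' /\ V = sv m * V' by rewrite !mulVKg.
have lm s : s <> sI -> (0 < slen s)%N.
  by move/eqP; rewrite -slen_eq0 lt0n.
have lU' : len U = ((slen m)%:Z + len U')%R by rewrite eU lenM len_sv.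
have [|D [pD hDU hDV hD]] := IH U' V' _ hmU hmV.
  by move: (lm _ nm) (pos_len pU) (pos_len (hmU : pos U')) hn lU'; clear; lia.
exists (sv m * D); split.
- exact: posM (pos_sv _) pD.
- by rewrite eU ple_mul2l.
- by rewrite eV ple_mul2l.
- move=> E pE hEU hEV.
  case: (hd E =P sI) => [e|ne].
    by rewrite (hd_eq1 pE e) ple1g; exact: posM (pos_sv _) pD.
  have he : sle (hd E) m.
    rewrite -(eqP (smeet_glb _ _ _)) -!ple_sv //.
    by apply/andP; split; apply: ple_trans (ple_hd pE) _.
  have [E' pE' eE] := hdK pE.
  set e := hd E in ne he eE; set m' := squo e m.
  have em : sv m = sv e * sv m' by exact: sle_sv.
  have pU2 : pos (sv m' * U') by exact: posM (pos_sv _) hmU.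
  have hl : (`|len (sv m' * U')%g| < n)%N.
    have eq1 : len U = ((slen e)%:Z + len (sv m' * U')%g)%R by rewrite {1}eU em -mulgA !lenM
      !len_sv.
    by move: (lm _ ne) (pos_len pU) (pos_len pU2) hn eq1; clear; lia.
  have [M2 [pM2 hM2U hM2V hM2]] := IH _ (sv m' * V') hl pU2 (posM (pos_sv _) hmV).
  have hm' : ple (sv m') M2.
    by apply: hM2; rewrite ?pos_sv //; exact: ple_mulr.
  pose W := (sv m')^-1 * M2; have eW : M2 = sv m' * W by rewrite mulVKg.
  have hW : ple W D.
    by apply: hD => //; rewrite -(ple_mul2l (sv m')) -eW.
  have hE' : ple E' M2.
    apply: hM2 => //.
      by rewrite -(ple_mul2l (sv e)) -eE mulgA -em -eU.
    by rewrite -(ple_mul2l (sv e)) -eE mulgA -em -eV.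
  rewrite eE em -mulgA ple_mul2l; apply: ple_trans hE' _.
  by rewrite eW ple_mul2l.
Qed.

Lemma pos_dzM g : exists2 k : int, (0 <= k)%R & pos (dz k * g).
Proof. by exists `|inf g|%R; rewrite ?normr_ge0 // /pos inf_dzM; lia. Qed.

(** Left multiplication by a large power of $\delta$ preserves the order and makes E positive. *)
Lemma meetP U V : pos U -> pos V -> exists M, [/\ pos M, ple M U, ple M V &
  forall E, ple E U -> ple E V -> ple E M].
Proof.
move=> pU pV; have [M [pM hMU hMV hM]] := meet_pos pU pV.
exists M; split=> // E hEU hEV; have [k hk pE] := pos_dzM E.
have pk : pos (dz k) by [].
have [M2 [pM2 hU hV hM2]] := meet_pos (posM pk pU) (posM pk pV).
have hkM : ple (dz k) M2 by apply: hM2 => //; exact: ple_mulr.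
rewrite -(ple_mul2l (dz k)); apply: (@ple_trans M2).
  by apply: hM2; rewrite ?ple_mul2l.
rewrite -[M2](mulVKg (dz k)) ple_mul2l; apply: hM => //.
  by rewrite -(ple_mul2l (dz k)) mulVKg.
by rewrite -(ple_mul2l (dz k)) mulVKg.
Qed.

Definition coprime_braids (A B : braid) : Prop :=
  forall s, ple (sv s) A -> ple (sv s) B -> s = sI.

Lemma coprime_ple1 A B h : pos A -> pos B -> coprime_braids A B ->
  ple h A -> ple h B -> ple h 1.
Proof.
move=> pA pB hco hA hB; have [M [pM hMA hMB hM]] := meetP pA pB.
have -> : 1 = M; last exact: hM.
by apply/esym/hd_eq1/hco => //; [apply: ple_trans hMA | apply: ple_trans hMB]; exact: ple_hd.
Qed.

Definition bsup (g : braid) : int := (- inf g^-1)%R.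

Arguments bsup g%_g.

Lemma ple_dz_sup k g : ple g (dz k) = (bsup g <= k)%R.
Proof. by rewrite /ple /pos inf_Mdz /bsup; lia. Qed.

Lemma bsupV g : bsup g^-1 = (- inf g)%R.
Proof. by rewrite /bsup invgK. Qed.

Lemma infV g : inf g^-1 = (- bsup g)%R.
Proof. by rewrite /bsup opprK. Qed.

Lemma sle_refl s : sle s s.
Proof. by apply: (forallS (P := fun s => sle s s)); vm_compute. Qed.

Lemma slesD s : sle s sD.
Proof. by apply: (forallS (P := fun s => sle s sD)); vm_compute. Qed.

Lemma ple_sv_dz1 s : ple (sv s) (dz 1).
Proof. by rewrite -svD (sle_sv (slesD s)); exact/ple_mulr/pos_sv. Qed.

Lemma hd_sv s : hd (sv s) = s.
Proof.
rewrite /hd /inf /fac /= /lact /= tauz0.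
by apply/eqP; move: s; apply: forallS; vm_compute.
Qed.

Lemma ple_svE s t : ple (sv s) (sv t) = sle s t.
Proof. by rewrite ple_sv ?pos_sv // hd_sv. Qed.

Lemma sv_inj : injective sv.
Proof. by move=> s t e; rewrite -(hd_sv s) e hd_sv. Qed.

Lemma sle_anti s t : sle s t -> sle t s -> s = t.
Proof. by move=> a b; apply: sv_inj; apply: ple_anti; rewrite ple_svE. Qed.

Lemma slw_meet s t u : slw s t -> sle u (sdual s) -> sle u t -> u = sI.
Proof.
move=> /eqP hm a b; have := smeet_glb (sdual s) t u; rewrite hm a b /= => /eqP/esym h.
by apply: sle_anti h _; apply: (forallS (P := fun s => sle sI s)); vm_compute.
Qed.

Lemma simple_sv g : pos g -> ple g (dz 1) -> g = sv (hd g).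
Proof.
move=> pg hg; have [g' pg' eg] := hdK pg.
case: (ltP 0%R (inf g)) => hi.
  have e : hd g = sD by rewrite /hd hi.
  rewrite e {1}eg e; suff -> : g' = 1 by rewrite mulg1.
  apply: pos_len0 => //; move: (ple_len hg) (pos_len pg').
  by rewrite {1}eg e lenM len_sv len_dz [slen sD]/=; clear; lia.
suff e : hd g' = sI by rewrite {1}eg (hd_eq1 pg' e) mulg1.
have e0 : inf g = 0%R by move: pg; rewrite /pos; lia.
have eg2 := braidE g; rewrite e0 dz0 mul1g in eg2.
have := braid_normal g; rewrite -[(braid_val g).2]/(fac g).
move: (eg); rewrite {1}eg2 {1}/hd e0 ltxx.
case ef: (fac g) => [|x [|y xs]] /=.
- rewrite sv1 mul1g => <- _; rewrite -sv1; exact: hd_sv.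
- by rewrite mulg1 -{1}[sv x]mulg1 => /mulgI <- _; rewrite -sv1 hd_sv.
move/mulgI => <- /and3P[hI hD /andP[/= hxy hs]].
have eh : hd (sv y * prodS xs) = y.
  have hn : normal (y :: xs).
    move: hI hD; rewrite !(inE, negb_or) => /andP[_ h1] /andP[_ h2].
    by apply/and3P; split; rewrite // ?inE ?negb_or.
  by rewrite /hd /inf /fac -[sv y * _]/(prodS (y :: xs)) val_prodS.
rewrite eh; apply: (slw_meet hxy); rewrite ?sle_refl //.
rewrite -ple_svE; have : ple (sv x * sv y) (sv x * sv (sdual x)).
  rewrite sv_sdual; apply: ple_trans hg; rewrite eg2 ef /= mulgA.
  exact/ple_mulr/pos_prodS.
by rewrite ple_mul2l.
Qed.

Lemma ple_hd_gen A h : pos A -> ple h A -> ple h (dz 1) -> ple h (sv (hd A)).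
Proof.
move=> pA hA h1; have [M [pM MA M1 hM]] := meetP pA (isT : pos (dz 1)).
apply: ple_trans (hM _ hA h1) _.
rewrite (simple_sv pM M1) ple_svE -ple_sv //.
by apply: ple_trans MA; exact: ple_hd.
Qed.

Lemma dz_central k : forall g, g * dz (4%:Z * k)%R = dz (4%:Z * k)%R * g.
Proof.
move=> g; have h s : sv s * dz (4%:Z * k)%R = dz (4%:Z * k)%R * sv s.
  by rewrite sv_dz /tauz (_ : `|(4%:Z * k)%R %% 4|%Z = 0) //; lia.
rewrite (braidE g) -mulgA [in RHS]mulgA -dzD addrC dzD -mulgA; congr (_ * _).
elim: (fac g) => /= [|x xs IH]; first by rewrite mul1g mulg1.
by rewrite -mulgA IH mulgA h mulgA.
Qed.

Lemma conj_dz4 k g h : g ^ (h * dz (4%:Z * k)%R) = g ^ h.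
Proof. by rewrite conjgM conjgE dz_central mulKg. Qed.

(** $\delta^4$ is central, so its powers can be appended to a conjugator for free. *)
Lemma conj_pos x y g : y = x ^ g -> exists2 h, pos h & y = x ^ h.
Proof.
move=> ->; exists (g * dz (4%:Z * `|inf g|)%R); last by rewrite conj_dz4.
by rewrite /pos inf_Mdz; lia.
Qed.

(** * Sliding circuits of rigid braids *)

(* The sliding conjugator, characterized without reference to normal forms. *)
Definition slide (q s : int) (Y g : braid) : Prop :=
  [/\ ple g (Y * dz (- q)), ple g (Y^-1 * dz s), ple g (dz 1) &
   forall h, ple h (Y * dz (- q)) -> ple h (Y^-1 * dz s) -> ple h (dz 1) -> ple h g].

Lemma slideV q s Y g : slide q s Y g -> slide (- s) (- q) Y^-1 g.
Proof.
by case=> h1 h2 h3 h4; split; rewrite ?invgK ?opprK // => h a b; exact: h4.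
Qed.

Lemma slide_pos Y g : slide (inf Y) (bsup Y) Y g -> pos g.
Proof.
case=> _ _ _ h; rewrite -ple1g; by apply: h; rewrite ple1g /pos ?inf_Mdz ?infV ?inf_dz ?addrN
  ?addNr.
Qed.

Lemma inf_conj_ge q Y g : pos g -> ple g (Y * dz (- q)) -> (q <= inf (Y ^ g))%R.
Proof.
move=> pg h; rewrite -ple_dz_inf conjgE ple_Ml invgK.
apply: (@ple_trans Y); last exact: ple_mulr.
by move: h; rewrite -(ple_dzr q) -mulgA -dzD addNr dz0 mulg1.
Qed.

Fixpoint bslides (k : nat) (Y Z : braid) : Prop :=
  if k is k'.+1 then
    exists2 g, slide (inf Y) (bsup Y) Y g & bslides k' (Y ^ g) Z
  else Y = Z.

Lemma slide_mono Y g : slide (inf Y) (bsup Y) Y g ->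
  (inf Y <= inf (Y ^ g))%R /\ (inf Y^-1 <= inf (Y ^ g)^-1)%R.
Proof.
move=> hs; have pg := slide_pos hs; case: hs => h1 h2 _ _; split.
  exact: inf_conj_ge.
by rewrite -conjVg; apply: inf_conj_ge => //; rewrite infV opprK.
Qed.

Lemma bslides_mono k Y Z : bslides k Y Z ->
  (inf Y <= inf Z)%R /\ (inf Y^-1 <= inf Z^-1)%R.
Proof.
elim: k Y => /= [|k IH] Y; first by move=> ->.
by case=> g /slide_mono[a b] /IH[c d]; split; [apply: le_trans c | apply: le_trans d].
Qed.

Lemma bslides_rcons k Y Z g : bslides k Y Z -> slide (inf Z) (bsup Z) Z g ->
  bslides k.+1 Y (Z ^ g).
Proof.
move=> h hs; elim: k Y h => [|k IH] Y /=; first by move=> ->; exists g.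
by case=> g' h1 /IH h2; exists g'.
Qed.

Definition on_circuit (Y : braid) : Prop := exists k, bslides k.+1 Y Y.

Lemma on_circuit_next Y : on_circuit Y -> exists g,
  [/\ slide (inf Y) (bsup Y) Y g, pos g, on_circuit (Y ^ g),
      inf (Y ^ g) = inf Y & bsup (Y ^ g) = bsup Y].
Proof.
case=> k /= [g hs hk]; exists g; split=> //; first exact: slide_pos hs.
- by exists k; exact: bslides_rcons hk hs.
- by have [a _] := slide_mono hs; have [b _] := bslides_mono hk; apply/le_anti/andP.
- have [_ a] := slide_mono hs; have [_ b] := bslides_mono hk.
  by rewrite /bsup; congr (- _)%R; apply/le_anti/andP.
Qed.

Lemma bslidesV k Y Z : bslides k Y Z -> bslides k Y^-1 Z^-1.
Proof.
elim: k Y => /= [|k IH] Y; first by move=> ->.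
case=> g hs /IH h; exists g; last by rewrite conjVg.
by have := slideV hs; rewrite /bsup opprK invgK.
Qed.

Lemma on_circuitV Y : on_circuit Y -> on_circuit Y^-1.
Proof. by case=> k h; exists k; exact: bslidesV h. Qed.

(** a, b and c count how often each of the three upper bounds in [slide] has been used. *)
Definition slide_term (q s : int) (Y : braid) (a b c : nat) : braid :=
  Y ^+ a * Y^-1 ^+ b * dz (- q *+ a + s *+ b + c%:Z)%R.

Lemma conj_mulX (Y g : braid) a : Y ^+ a * g = g * (Y ^ g) ^+ a.
Proof. by rewrite -conjXg conjgE mulVKg. Qed.

Lemma slide_term0 q s Y : slide_term q s Y 0 0 0 = 1.
Proof. by rewrite /slide_term !expg0 !mul1g -dz0. Qed.

Lemma slide_term_a q s Y a b c :
  Y ^+ a * Y^-1 ^+ b * (Y * dz (- q)) * dz (- q *+ a + s *+ b + c%:Z) =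
  slide_term q s Y a.+1 b c.
Proof.
have e : Y^-1 ^+ b * Y = Y * Y^-1 ^+ b.
  by apply/commute_sym/commuteX/commuteV/commute_refl.
rewrite -[Y ^+ a * _ * _]mulgA [_ * (Y * _)]mulgA e -!mulgA -dzD mulgA -expgSr mulgA.
by rewrite (_ : - q + _ = - q *+ a.+1 + s *+ b + c%:Z)%R // mulrS !addrA.
Qed.

Lemma slide_term_b q s Y a b c :
  Y ^+ a * Y^-1 ^+ b * (Y^-1 * dz s) * dz (- q *+ a + s *+ b + c%:Z) =
  slide_term q s Y a b.+1 c.
Proof.
rewrite -!mulgA -dzD [_ * (Y^-1 * _)]mulgA -expgSr mulgA.
by rewrite (_ : s + _ = - q *+ a + s *+ b.+1 + c%:Z)%R // mulrS; lia.
Qed.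

Lemma slide_term_c q s Y a b c :
  Y ^+ a * Y^-1 ^+ b * dz 1 * dz (- q *+ a + s *+ b + c%:Z) =
  slide_term q s Y a b c.+1.
Proof.
rewrite -!mulgA -dzD mulgA.
by rewrite (_ : 1 + _ = - q *+ a + s *+ b + c.+1%:Z)%R //; lia.
Qed.

Lemma ple_sandwich w e u v : ple u (w * v * dz e) = ple (w^-1 * u * dz (- e)) v.
Proof.
by rewrite -[RHS](ple_dzr e) -[_ * dz (- e) * _]mulgA -dzD addNr dz0 mulg1 -mulgA [LHS]ple_Ml.
Qed.

(* Iterated sliding: the product of n consecutive conjugators is the meet of all terms
   of total weight n. *)
Lemma slide_prod n Y : on_circuit Y -> exists P,
  [/\ inf (Y ^ P) = inf Y,
      forall a b c, a + b + c = n -> ple P (slide_term (inf Y) (bsup Y) Y a b c) &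
      forall h, (forall a b c, a + b + c = n ->
                 ple h (slide_term (inf Y) (bsup Y) Y a b c)) -> ple h P].
Proof.
elim: n Y => [|n IH] Y hY.
  exists 1; split; first by rewrite conjg1.
    move=> a b c e; have [-> [-> ->]] : a = 0 /\ b = 0 /\ c = 0 by lia.
    by rewrite slide_term0 ple_refl.
  by move=> h /(_ 0 0 0 erefl); rewrite slide_term0.
have [g [hs pg hYg e1 e2]] := on_circuit_next hY.
have [P [eP hP1 hP2]] := IH _ hYg; rewrite e1 e2 in eP hP1 hP2.
set q := inf Y in hs e1 eP hP1 hP2 *; set s := bsup Y in hs e2 hP1 hP2 *.
have cj a b c : g * slide_term q s (Y ^ g) a b c =
    Y ^+ a * Y^-1 ^+ b * g * dz (- q *+ a + s *+ b + c%:Z).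
  by rewrite /slide_term !mulgA -conj_mulX -conjVg -!mulgA [g * (_ * _)]mulgA -conj_mulX -!mulgA.
case: (hs) => hs1 hs2 hs3 hs4.
exists (g * P); split; first by rewrite conjgM.
- move=> a b c e.
  have step a' b' c' v : a' + b' + c' = n -> ple g v ->
      ple (g * P) (Y ^+ a' * Y^-1 ^+ b' * v * dz (- q *+ a' + s *+ b' + c'%:Z)).
    move=> en hv; apply: (@ple_trans (g * slide_term q s (Y ^ g) a' b' c')).
      by rewrite ple_mul2l; exact: hP1.
    by rewrite cj ple_dzr ple_mul2l.
  case: a e => [|a] e; last by rewrite -slide_term_a; apply: step hs1; lia.
  case: b e => [|b] e; last by rewrite -slide_term_b; apply: step hs2; lia.
  by case: c e => // c e; rewrite -slide_term_c; apply: step hs3; lia.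
- move=> h hh; rewrite -[h](mulVKg g) ple_mul2l; apply: hP2 => a b c e.
  rewrite -(ple_mul2l g) mulVKg cj ple_sandwich; apply: hs4; rewrite -ple_sandwich.
  + by rewrite slide_term_a; apply: hh; lia.
  + by rewrite slide_term_b; apply: hh; lia.
  + by rewrite slide_term_c; apply: hh; lia.
Qed.

(** * Optimality of inf on a circuit *)

Definition cyc_term (q : int) (Y : braid) (a c : nat) : braid :=
  Y ^+ a * dz (- q *+ a + c%:Z).

Lemma cyc_term0 q Y : cyc_term q Y 0 0 = 1.
Proof. by rewrite /cyc_term expg0 mul1g -dz0. Qed.

(** C is the conjugator of n iterated cyclings, again a meet of terms of weight n. As long as inf
    stays equal to q, each new factor differs from $\delta$ and has length at most 2. *)
Lemma cyc_prod n Y (q := inf Y) : exists C,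
  [/\ (q <= inf (Y ^ C))%R,
      forall h, ple h C <-> (forall a c, a + c = n -> ple h (cyc_term q Y a c)) &
      (forall m D, (m < n)%N ->
         (forall h, ple h D <-> (forall a c, a + c = m -> ple h (cyc_term q Y a c))) ->
         (inf (Y ^ D) <= q)%R) -> (len C <= n%:Z *+ 2)%R].
Proof.
elim: n => [|n [C [h1 h2 h3]]].
  exists 1; split; rewrite ?conjg1 ?len1 // => h; split.
    move=> hh a c e; have [-> ->] : a = 0 /\ c = 0 by lia.
    by rewrite cyc_term0.
  by move/(_ 0 0 erefl); rewrite cyc_term0.
pose A := Y ^ C * dz (- q).
have pA : pos A by rewrite /pos inf_Mdz; lia.
exists (C * sv (hd A)); split.
- rewrite conjgM; apply: inf_conj_ge (pos_sv _) _; exact: ple_hd.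
- move=> h; rewrite ple_Ml; split=> hh.
    move=> a c e.
    have [hA hd1] : ple (C^-1 * h) A /\ ple (C^-1 * h) (dz 1).
      by split; apply: ple_trans hh _; [exact: ple_hd | exact: ple_sv_dz1].
    case: a e => [|a] e.
      case: c e => // c e.
      move: hd1; rewrite -ple_Ml -(ple_dzr (-1)) -mulgA -dzD addrN dz0 mulg1.
      move/h2/(_ 0 c); rewrite -(ple_dzr 1) -mulgA -dzD addNr dz0 mulg1.
      move=> hx; have := hx (ltac:(lia)); rewrite /cyc_term expg0 !mul1g -dzD.
      by rewrite (_ : (_ + c%:Z + 1 = - q *+ 0 + c.+1%:Z)%R) //; lia.
    move: hA; rewrite /A -ple_Ml conjgE -!mulgA mulVKg mulgA.
    rewrite ple_sandwich => /h2/(_ a c).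
    rewrite -ple_sandwich /cyc_term mulgA -expgS -mulgA -dzD => hx; have := hx (ltac:(lia)).
    by rewrite (_ : (_ + c%:Z + - q = - q *+ a.+1 + c%:Z)%R) // mulrS; lia.
  apply: ple_hd_gen => //.
    rewrite /A -ple_Ml conjgE -!mulgA mulVKg mulgA ple_sandwich; apply/h2 => a c e.
    rewrite -ple_sandwich /cyc_term mulgA -expgS -mulgA -dzD.
    rewrite (_ : (_ + c%:Z + - q = - q *+ a.+1 + c%:Z)%R); last by rewrite mulrS; lia.
    by apply: hh; lia.
  rewrite -ple_Ml -(ple_dzr (-1)) -mulgA -dzD addrN dz0 mulg1; apply/h2 => a c e.
  rewrite -(ple_dzr 1) -mulgA -dzD addNr dz0 mulg1 /cyc_term -mulgA -dzD.
  rewrite (_ : (_ + c%:Z + 1 = - q *+ a + c.+1%:Z)%R); last by lia.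
  by apply: hh; lia.
- move=> hm; rewrite lenM len_sv.
  have hA : inf A = 0%R.
    have := hm n C (ltnSn n) h2; move: h1; rewrite /A inf_Mdz; lia.
  have : (slen (hd A) <= 2)%N.
    rewrite /hd hA ltxx; have := braid_normal A; rewrite -[(braid_val A).2]/(fac A).
    case: (fac A) => //= x xs /and3P[_ hD _]; move: hD; rewrite inE negb_or => /andP[hx _].
    by case: (x) hx.
  have := h3 (fun m D hmn => hm m D (ltnW hmn)); lia.
Qed.

Lemma inf_exp_ge (X : braid) q n : (q <= inf X)%R -> (q *+ n <= inf (X ^+ n))%R.
Proof.
move=> h; elim: n => [|n IH]; first by rewrite expg0 mulr0n.
by rewrite expgS mulrS; apply: le_trans (infM _ _); exact: lerD.
Qed.

(** Cycling cannot raise inf: the sliding product of the same weight is a meet of these and further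
    terms, so it would raise inf too, which a circuit forbids. The terms with b > 0 are harmless
    because sup exceeds inf by at least 2. Hence C has length at most 2n, whereas a conjugate with
    larger inf puts $a^{-1}\delta^n$ below C. *)
Lemma circuit_inf_max Y b : on_circuit Y -> (inf Y + 2 <= bsup Y)%R ->
  (inf Y + 1 <= inf (Y ^ b))%R -> False.
Proof.
move=> hY h2 hb; set q := inf Y in h2 hb.
pose cyc n D := forall h, ple h D <-> (forall a c, a + c = n -> ple h (cyc_term q Y a c)).
have main n D : cyc n D -> (q + 1 <= inf (Y ^ D))%R -> False.
  move=> hD hi; have [P [eP P1 P2]] := slide_prod n hY.
  suff : (q + 1 <= inf (Y ^ P))%R by rewrite eP -/q; clear; lia.
  have conjE Z : (q + 1 <= inf (Y ^ Z))%R = ple (Z * dz (q + 1)) (Y * Z).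
    by rewrite -ple_dz_inf conjgE [LHS]ple_Ml invgK.
  move: hi; rewrite !conjE => hi.
  rewrite ple_Ml; apply: P2 => a [|b'] c e; rewrite -ple_Ml.
    have t0 a' c' : slide_term q (bsup Y) Y a' 0 c' = cyc_term q Y a' c'.
      by rewrite /slide_term /cyc_term expg0 mulg1 mulr0n addr0.
    have hPD : ple P D.
      by apply/hD => a' c' e'; rewrite -t0; apply: P1; rewrite addn0.
    apply: (@ple_trans (D * dz (q + 1))); first by rewrite ple_dzr.
    apply: ple_trans hi _; rewrite ple_mul2l t0.
    have/hD := ple_refl D; apply; lia.
  have hP := P1 a b' c.+1 (ltac:(lia)).
  apply: (@ple_trans (slide_term q (bsup Y) Y a b' c.+1 * dz (q + 1))).
    by rewrite ple_dzr.
  rewrite -slide_term_b !mulgA -expgS -[Y ^+ a.+1 * _ * Y^-1]mulgA -expgSr.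
  have -> : Y ^+ a.+1 * Y^-1 ^+ b'.+1 = Y ^+ a * Y^-1 ^+ b'.
    by rewrite expgSr expgS -mulgA mulVKg.
  rewrite /slide_term -!mulgA !ple_mul2l -!dzD ple_dz; move: h2; clear; lia.
have [a pa ea] := @conj_pos (Y ^ b) Y b^-1 (esym (conjgK _ _)).
(* 3 n - [len a] is at most 2 n only if n is at most [len a]. *)
pose n := `|len a|.+1.
have [C [h1 hC hl]] := cyc_prod n Y.
have {hl}hl : (len C <= n%:Z *+ 2)%R.
  apply: hl => m D _ hD; rewrite leNgt; apply/negP => hi.
  by apply: (main m D hD); move: hi; rewrite -/q; clear; lia.
have : ple (a^-1 * dz n%:Z) C.
  apply/hC => i c e; rewrite -ple_Ml /cyc_term mulgA.
  have -> : a * Y ^+ i = (Y ^ b) ^+ i * a by rewrite conj_mulX -ea.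
  rewrite -mulgA ple_dz_inf.
  apply: le_trans (infM _ _); rewrite inf_Mdz.
  apply: (@le_trans _ _ ((q + 1) *+ i + (0 + (- q *+ i + c%:Z)))%R).
    by rewrite add0r mulrnDl mulNrn addrACA addrN add0r natz -PoszD e.
  by apply: lerD; [exact: inf_exp_ge | rewrite lerD2r].
move/ple_len; rewrite lenM lenV len_dz; move: hl (pos_len pa); rewrite /n; clear; lia.
Qed.

(* For inf Y = q and sup Y = s the two braids in [coprime_braids] begin with the
   initial factor of Y and with the complement of its final factor. *)
Definition rig (q s : int) (Y : braid) : Prop :=
  [/\ inf Y = q, bsup Y = s & coprime_braids (Y * dz (- q)) (Y^-1 * dz s)].

Lemma rigV q s Y : rig q s Y -> rig (- s) (- q) Y^-1.
Proof.
case=> h1 h2 h3; split; rewrite ?infV ?bsupV ?h1 ?h2 // !opprK invgK.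
by move=> u a b; exact: h3.
Qed.

Lemma rig_pos q s Y : rig q s Y -> pos (Y * dz (- q)) /\ pos (Y^-1 * dz s).
Proof. by case=> h1 h2 _; rewrite /pos !inf_Mdz infV h1 h2 addrN addNr. Qed.

Lemma rig_ple1 q s Y h : rig q s Y ->
  ple h (Y * dz (- q)) -> ple h (Y^-1 * dz s) -> ple h 1.
Proof. by move=> hY; have [p1 p2] := rig_pos hY; case: hY => _ _; exact: coprime_ple1. Qed.

Lemma rig_slide q s Y : rig q s Y -> slide q s Y 1.
Proof.
move=> hY; have [p1 p2] := rig_pos hY; split; rewrite ?ple1g // => h a b _.
exact: rig_ple1 hY a b.
Qed.

Lemma rig_circuit q s Y : rig q s Y -> on_circuit Y.
Proof.
move=> hY; exists 0; exists 1; last by rewrite conjg1.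
by case: (hY) => -> -> _; exact: rig_slide.
Qed.

(** If s = q + 1, X lies below $\delta^{q+1}$ while a conjugate with larger inf lies above it; their
    equal lengths force X to be $\delta^{q+1}$, whose inf is not q. *)
Lemma rig_inf_max q s X b : rig q s X -> (q < s)%R -> (inf (X ^ b) <= q)%R.
Proof.
move=> hX hqs; rewrite leNgt; apply/negP => hb.
case: (leP (q + 2)%R s) => hs.
  case: (hX) => e1 e2 _.
  by apply: (@circuit_inf_max X b (rig_circuit hX)); rewrite ?e1 ?e2 //; move: hb; clear; lia.
have es : s = (q + 1)%R by move: hs hqs; clear; lia.
case: (hX) => e1 e2 _.
have h1 : ple X (dz (q + 1)) by rewrite ple_dz_sup e2 es.
have h2 : len X = (3%:Z * (q + 1))%R.
  have := ple_len h1; rewrite len_dz.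
  have := @ple_len (dz (q + 1)) (X ^ b); rewrite ple_dz_inf len_dz => h.
  have {}h := h (ltac:(move: hb; clear; lia)).
  move: h; rewrite conjgE !lenM lenV; clear; lia.
have : X = dz (q + 1).
  rewrite -[RHS](mulVKg X); suff -> : X^-1 * dz (q + 1) = 1 by rewrite mulg1.
  by apply: pos_len0 h1 _; rewrite lenM lenV len_dz h2 addNr.
by move=> eX; move: e1; rewrite eX inf_dz; clear; lia.
Qed.

(** $b^{-1} g$ is a common prefix of the two coprime braids attached to [Y ^ b]. *)
Lemma rig_ple Y q s g b : ple g (Y * dz (- q)) -> ple g (Y^-1 * dz s) -> pos b ->
  rig q s (Y ^ b) -> ple g b.
Proof.
move=> h1 h2 pb hb.
rewrite -[b]mulg1 ple_Ml; apply: (rig_ple1 hb).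
  apply: (@ple_trans (b^-1 * (Y * dz (- q)))); first by rewrite ple_mul2l.
  by rewrite conjgE -!mulgA ple_mul2l ple_mul2l -{1}[dz _]mul1g ple_dzr ple1g.
apply: (@ple_trans (b^-1 * (Y^-1 * dz s))); first by rewrite ple_mul2l.
by rewrite conjgE !invgM invgK -!mulgA ple_mul2l ple_mul2l -{1}[dz _]mul1g ple_dzr ple1g.
Qed.

Lemma slide_ple Y q s g b : slide q s Y g -> pos b -> rig q s (Y ^ b) -> ple g b.
Proof. by case=> h1 h2 _ _; exact: rig_ple. Qed.

(** Each sliding conjugator on the circuit is a prefix of the remaining conjugator to the rigid
    braid. One turn brings Y back with a shorter conjugator, unless the first slide is trivial. *)
Lemma circuit_rig q s Y b : on_circuit Y -> inf Y = q -> bsup Y = s ->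
  rig q s (Y ^ b) -> rig q s Y.
Proof.
move=> hY eq es hb.
have [c pc ec] := conj_pos (erefl (Y ^ b)); rewrite ec in hb.
suff hs : slide q s Y 1.
  split=> // u h1 h2; case: hs => _ _ _ /(_ (sv u) h1 h2 (ple_sv_dz1 u)).
  by rewrite -sv1 ple_svE => h; apply: sle_anti h _; apply: (forallS (P := fun s => sle sI s));
    vm_compute.
have [n] := ubnP `|len c|%N; elim: n c pc {b ec} hb => // n IH c pc hc hn.
case: (hY) => k /= [g]; rewrite eq es => hg hk.
have pg : pos g by apply: (@slide_pos Y); rewrite eq es.
have hgc := slide_ple hg pc hc.
have hmono : forall Z d, bslides k Z Y -> inf Z = q -> bsup Z = s -> pos d -> rig q s (Z ^ d) ->
    exists d', [/\ pos d', rig q s (Y ^ d') & (len d' <= len d)%R].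
  move: hk => _; elim: k => [|k IHk] Z d /=; first by move=> <- _ _ pd hd; exists d.
  case=> g' hg' hk' e1 e2 pd hd; rewrite e1 e2 in hg'.
  have pg' : pos g' by apply: (@slide_pos Z); rewrite e1 e2.
  have hgd := slide_ple hg' pd hd.
  have [i1 i2] : (inf Z <= inf (Z ^ g'))%R /\ (inf Z^-1 <= inf (Z ^ g')^-1)%R.
    by apply: slide_mono; rewrite e1 e2.
  have [j1 j2] := bslides_mono hk'.
  have [||||d' [p' r' l']] := IHk (Z ^ g') (g'^-1 * d) hk'.
  - by move: i1 j1; rewrite e1 eq; clear; lia.
  - by move: i2 j2; rewrite !infV e2 es; clear; lia.
  - exact: hgd.
  - by rewrite -conjgM mulVKg.
  exists d'; split=> //; apply: le_trans l' _; rewrite lenM lenV.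
  by move: (pos_len pg'); clear; lia.
have [i1 i2] : (inf Y <= inf (Y ^ g))%R /\ (inf Y^-1 <= inf (Y ^ g)^-1)%R.
  by apply: slide_mono; rewrite eq es.
have [j1 j2] := bslides_mono hk.
have [||||d [pd hd ld]] := hmono (Y ^ g) (g^-1 * c) hk.
- by move: i1 j1; rewrite eq; clear; lia.
- by move: i2 j2; rewrite !infV es; clear; lia.
- exact: hgc.
- by rewrite -conjgM mulVKg.
case: (leP (len g) 0%R) => lg.
  by rewrite -[1](pos_len0 pg) //; move: lg (pos_len pg); clear; lia.
apply: (IH d pd hd); move: ld lg hn (pos_len pd); rewrite lenM lenV; clear; lia.
Qed.

(** A defect of inf or sup against the rigid values would open the gap of 2 under which
    [circuit_inf_max] applies, to Y or to its inverse. *)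
Lemma circuit_conj_rig q s X Y b : rig q s X -> (q < s)%R -> on_circuit Y -> Y ^ b = X ->
  rig q s Y.
Proof.
move=> hX hqs hY eX; have eY : Y = X ^ b^-1 by rewrite -eX conjgK.
have h1 : (inf Y <= q)%R by rewrite eY; exact: rig_inf_max hX hqs.
have h2 : (inf Y^-1 <= - s)%R.
  rewrite eY -conjVg; apply: rig_inf_max (rigV hX) _; move: hqs; clear; lia.
case: (hX) => e1 e2 _.
have h3 : inf Y = q.
  apply/le_anti/andP; split=> //; rewrite leNgt; apply/negP => hlt.
  apply: (@circuit_inf_max Y b hY); rewrite ?eX ?e1; move: h2 hqs hlt; rewrite infV; clear; lia.
have h4 : bsup Y = s.
  apply/le_anti/andP; split; last by move: h2; rewrite infV; clear; lia.
  rewrite leNgt; apply/negP => hlt.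
  apply: (@circuit_inf_max Y^-1 b (on_circuitV hY)).
    by rewrite infV bsupV h3; move: hqs hlt; clear; lia.
  by rewrite conjVg eX !infV e2; move: hlt; clear; lia.
by apply: (@circuit_rig q s Y b) => //; rewrite eX.
Qed.

(** * Rows of rigid braids *)

Lemma stau_slw s t : slw (stau s) (stau t) == slw s t.
Proof. by move: s t; apply: forallS2; vm_compute. Qed.
Lemma tauz_slw k s t : slw (tauz k s) (tauz k t) = slw s t.
Proof. by rewrite /tauz; elim: `|_| => //= n <-; rewrite (eqP (stau_slw _ _)). Qed.
Lemma stau_sle s t : sle (stau s) (stau t) == sle s t.
Proof. by move: s t; apply: forallS2; vm_compute. Qed.
Lemma tauz_sleE k s t : sle (tauz k s) (tauz k t) = sle s t.
Proof. by rewrite /tauz; elim: `|_| => //= n <-; rewrite (eqP (stau_sle _ _)). Qed.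
Lemma stau_smeet s t : stau (smeet (sdual s) t) == smeet (sdual (stau s)) (stau t).
Proof. by move: s t; apply: forallS2; vm_compute. Qed.
Lemma tauz_smeet k s t : tauz k (smeet (sdual s) t) = smeet (sdual (tauz k s)) (tauz k t).
Proof. by rewrite /tauz; elim: `|_| => //= n ->; rewrite (eqP (stau_smeet _ _)). Qed.
Lemma tauz_shead k s t : tauz k (shead s t) = shead (tauz k s) (tauz k t).
Proof. by rewrite /tauz; elim: `|_| => //= n ->; rewrite (eqP (stau_head _ _)). Qed.
Lemma tauz_scarry k s t : tauz k (scarry s t) = scarry (tauz k s) (tauz k t).
Proof. by rewrite /tauz; elim: `|_| => //= n ->; rewrite (eqP (stau_carry _ _)). Qed.

Lemma tauz_inj k : injective (tauz k).
Proof. exact: can_inj (tauzK k). Qed.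
Lemma tauz_eq1 k s : (tauz k s == sI) = (s == sI).
Proof. by rewrite -(inj_eq (@tauz_inj k) s) tauzsI. Qed.
Lemma tauz_eqD k s : (tauz k s == sD) = (s == sD).
Proof. by rewrite -(inj_eq (@tauz_inj k) s) tauzsD. Qed.

Lemma normal_tauz k xs : normal [seq tauz k x | x <- xs] = normal xs.
Proof.
rewrite /normal; congr [&& ~~ _, ~~ _ & _].
- by rewrite -{1}(tauzsI k) mem_map //; exact: tauz_inj.
- by rewrite -{1}(tauzsD k) mem_map //; exact: tauz_inj.
- by rewrite sorted_map; apply: eq_sorted => s t /=; rewrite tauz_slw.
Qed.

Lemma prodS_dz xs k : prodS xs * dz k = dz k * prodS [seq tauz k x | x <- xs].
Proof.
elim: xs => /= [|x xs IH]; first by rewrite mul1g mulg1.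
by rewrite -mulgA IH mulgA sv_dz mulgA.
Qed.

Fixpoint inv_rev (xs : seq simp) : seq simp :=
  if xs is x :: xs' then sdual x :: [seq tauz 1 y | y <- inv_rev xs'] else [::].

Lemma prodS_inv_rev xs : (prodS (rev xs))^-1 = prodS (inv_rev xs) * dz (- (size xs)%:Z).
Proof.
elim: xs => [|x xs IH]; first by rewrite /= mul1g invg1 -dz0.
have e1 : (sv x)^-1 = sv (sdual x) * dz (-1).
  by apply: (mulgI (sv x)); rewrite mulgV mulgA sv_sdual -dzD -dz0.
have e2 zs : dz (-1) * prodS zs = prodS [seq tauz 1 y | y <- zs] * dz (-1).
  rewrite prodS_dz -map_comp; congr (_ * prodS _).
  by rewrite -[LHS]map_id; apply: eq_map => y /=; rewrite (tauzK 1).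
rewrite rev_cons -cats1 prodS_cat invgM IH /= mulg1 e1 -!mulgA.
rewrite [dz (-1) * (_ * _)]mulgA e2 -mulgA -dzD; congr (_ * (_ * dz _)); lia.
Qed.

Lemma slw_inv x y : slw x y -> slw (sdual y) (tauz 1 (sdual x)).
Proof.
have := forallS2 (P := fun x y => if slw x y then slw (sdual y) (tauz 1 (sdual x)) else true)
  (ltac:(by vm_compute)) x y.
by case: ifP.
Qed.

Lemma sdual_eq s : ((sdual s == sI) == (s == sD)) && ((sdual s == sD) == (s == sI)).
Proof. by move: s; apply: forallS; vm_compute. Qed.

Lemma normal_cons x y xs : normal (x :: y :: xs) =
  [&& x != sI, x != sD, slw x y & normal (y :: xs)].
Proof.
rewrite /normal [sI \in x :: _]inE [sD \in x :: _]inE !negb_or /= ![_ == x]eq_sym.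
by case: (x == sI); case: (x == sD); case: (slw x y); rewrite /= ?andbF.
Qed.

Lemma normal_inv_rev xs : normal (rev xs) -> normal (inv_rev xs).
Proof.
have rs ys : normal (rev ys) = [&& sI \notin ys, sD \notin ys & sorted (fun x y => slw y x) ys].
  by rewrite /normal !mem_rev rev_sorted.
have n1 x : x != sI -> x != sD -> (sdual x != sI) && (sdual x != sD).
  by move=> h1 h2; have /andP[/eqP -> /eqP ->] := sdual_eq x; rewrite h1 h2.
rewrite rs; elim: xs => // x xs IH; rewrite !inE !negb_or => /and3P[/andP[x1 a1] /andP[x2 a2] hs].
rewrite eq_sym in x1; rewrite eq_sym in x2; have /andP[d1 d2] := n1 x x1 x2.
have := IH; rewrite a1 a2 (path_sorted hs) => /(_ isT) {}IH.
case: xs hs a1 a2 IH => [|y xs] /= hs a1 a2 IH.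
  by rewrite /normal !inE ![_ == sdual x]eq_sym d1 d2.
rewrite normal_cons d1 d2 slw_inv ?(proj1 (andP hs)) //=.
by rewrite -[tauz 1 (sdual y) :: _]/[seq tauz 1 z | z <- sdual y :: _] normal_tauz.
Qed.

(* A rigid braid delta^p x_1 ... x_r is read as the infinite sequence of letters of its
   powers, with all powers of delta moved to the right; it is r-periodic up to tau^-p. *)
Definition isrow (r : nat) (p : int) (Y : nat -> simp) : Prop :=
  [/\ twist r p Y, forall i, (Y i != sI) && (Y i != sD) & forall i, slw (Y i) (Y i.+1)].

Definition rowval (r : nat) (p : int) (Y : nat -> simp) : braid :=
  prodS (mkseq Y r) * dz p.

Lemma normal_row r p Y : isrow r p Y -> forall j n, normal [seq Y i | i <- iota j n].
Proof.
move=> [_ h1 h2] j n; elim: n j => // n IH j; case: n IH => [|n] IH.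
  by have /andP[a b] := h1 j; rewrite /normal /= !inE ![_ == Y j]eq_sym a b.
by have /andP[a b] := h1 j; rewrite /= normal_cons a b h2; exact: (IH j.+1).
Qed.

Lemma inf_prodS xs : normal xs -> inf (prodS xs) = 0%R.
Proof. by move=> h; rewrite /inf val_prodS. Qed.

Lemma hd_prodS xs : normal xs -> hd (prodS xs) = head sI xs.
Proof. by move=> h; rewrite /hd inf_prodS // ltxx /fac val_prodS. Qed.

Lemma inf_prodSV xs : normal xs -> inf (prodS xs)^-1 = (- (size xs)%:Z)%R.
Proof.
rewrite -{1}[xs]revK => h; rewrite -{1}[xs]revK prodS_inv_rev inf_Mdz.
by rewrite inf_prodS ?normal_inv_rev // add0r size_rev.
Qed.

Lemma hd_NF p xs : normal xs -> xs != [::] ->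
  let B := prodS xs * dz p in
  [/\ inf B = p, bsup B = (p + (size xs)%:Z)%R, hd (B * dz (- p)) = head sI xs &
      hd (B^-1 * dz (p + (size xs)%:Z)) = tauz p (sdual (last sI xs))].
Proof.
move=> hn hx B; split.
- by rewrite inf_Mdz inf_prodS // add0r.
- by rewrite /bsup /B invgM -dzN inf_dzM inf_prodSV // opprD !opprK.
- by rewrite /B -mulgA -dzD addrN dz0 mulg1 hd_prodS.
- case/lastP: xs hn hx @B => // xs x hn _ B.
  rewrite /B invgM -dzN -{1}[rcons xs x]revK prodS_inv_rev size_rev -!mulgA -dzD.
  rewrite addrCA addNr addr0 prodS_dz mulgA -dzD addNr dz0 mul1g.
  rewrite hd_prodS ?normal_tauz ?normal_inv_rev ?revK // rev_rcons last_rcons.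
  by [].
Qed.

Lemma rowval_rig r p Y : 0 < r -> isrow r p Y -> rig p (p + r%:Z) (rowval r p Y).
Proof.
move=> r0 hY; have hn : normal (mkseq Y r) := normal_row hY 0 r.
have := hd_NF p hn; rewrite size_mkseq -/(rowval r p Y) => -[|h1 h2 h3 h4].
  by case: (r) r0.
have pr : pos (rowval r p Y * dz (- p)) /\ pos ((rowval r p Y)^-1 * dz (p + r%:Z)).
  by rewrite /pos (inf_Mdz (rowval r p Y)) (inf_Mdz (rowval r p Y)^-1) infV h1 h2 addrN addNr.
split=> // s; rewrite !ple_sv ?(proj1 pr) ?(proj2 pr) // h3 h4.
case: r r0 hY hn {h1 h2 h3 h4 pr} => // r _ [tY _ lw] hn /=.
rewrite (last_map Y) => a b; apply/eqP; rewrite -(tauz_eq1 (- p)); apply/eqP.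
apply: (slw_meet (lw r)).
  rewrite -(tauz_sleE p) tauzNK; suff -> : Y r = Y (last 0 (iota 1 r)) by [].
  by rewrite (last_nth 0) size_iota -[0 :: _]/(iota 0 r.+1) nth_iota.
by rewrite -[r.+1]add0n tY tauz_sleE.
Qed.

Lemma tauz_sdual k s : tauz k (sdual s) = sdual (tauz k s).
Proof. by rewrite /sdual tauz_squo tauzsD. Qed.

Lemma rowval_ext r p Y Z : Y =1 Z -> rowval r p Y = rowval r p Z.
Proof. by move=> e; rewrite /rowval (eq_mkseq e). Qed.

Lemma rig_row r p B : 0 < r -> rig p (p + r%:Z) B ->
  exists2 Y, isrow r p Y & B = rowval r p Y.
Proof.
move=> r0 [hi hs hco]; pose zs := [seq tauz (- p) x | x <- fac B].
have nz : normal zs by rewrite normal_tauz; exact: braid_normal.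
have eB : B = prodS zs * dz p.
  rewrite {1}(braidE B) hi prodS_dz -map_comp.
  by rewrite (eq_map (g := id)) ?map_id // => x; rewrite /= tauzNK.
have sz : size zs = r.
  by move: hs; rewrite eB /bsup invgM -dzN inf_dzM inf_prodSV //; lia.
have := hd_NF p nz; rewrite -eB sz => -[|_ _ h3 h4]; first by rewrite -size_eq0 sz -lt0n.
(* Coprimality is left-weightedness across the seam between two consecutive periods. *)
have bd : slw (nth sI zs r.-1) (tauz (- p) (nth sI zs 0)).
  rewrite nth0 /slw -sz nth_last -(tauz_eq1 p) tauz_smeet tauzNK; apply/eqP; apply: hco.
    rewrite ple_sv ?h3; last by rewrite /pos inf_Mdz hi addrN.
    by case/andP: (smeet_sle (sdual (tauz p (last sI zs))) (head sI zs)).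
  rewrite ple_sv ?h4; last by rewrite /pos inf_Mdz infV hs addNr.
  rewrite tauz_sdual.
  by case/andP: (smeet_sle (sdual (tauz p (last sI zs))) (head sI zs)).
have lt i : i %% r < size zs by rewrite sz ltn_mod.
exists (fun i => tauz (- p *+ (i %/ r)) (nth sI zs (i %% r))); last first.
  rewrite {1}eB /rowval; congr (prodS _ * _); apply: (@eq_from_nth _ sI); rewrite ?size_mkseq //.
  by move=> i; rewrite sz => hr; rewrite nth_mkseq // divn_small // modn_small // mulr0n tauz0.
case/and3P: nz => n1 n2 n3; split.
- by move=> i; rewrite divnDr ?dvdnn // divnn r0 modnDr addn1 mulrS tauzD.
- move=> i; rewrite tauz_eq1 tauz_eqD; apply/andP; split.
    by apply: contraNneq n1 => <-; rewrite mem_nth.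
  by apply: contraNneq n2 => <-; rewrite mem_nth.
- move=> i; have := ltn_mod i r; rewrite r0.
  have -> : i.+1 %/ r = i %/ r + (i %% r).+1 %/ r by rewrite {1}(divn_eq i r) -addnS divnMDl.
  have -> : i.+1 %% r = (i %% r).+1 %% r by rewrite {1}(divn_eq i r) -addnS modnMDl.
  set q := i %/ r; set j := i %% r => hj.
  have [hj1|hj1] := ltnP j.+1 r.
    rewrite divn_small // addn0 modn_small // tauz_slw.
    by move/(sortedP sI): n3; apply; rewrite sz.
  have ej : j.+1 = r by apply/eqP; rewrite eqn_leq hj.
  rewrite ej divnn modnn r0 addn1 mulrSr tauzD tauz_slw.
  by move: bd; rewrite -ej.
Qed.

Lemma rowval_tauz r p k Y : (rowval r p Y) ^ (dz k) = rowval r p (fun i => tauz k (Y i)).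
Proof.
apply: (mulgI (dz k)); rewrite conjgE mulVKg /rowval mulgA.
have -> : mkseq (fun i => tauz k (Y i)) r = [seq tauz k x | x <- mkseq Y r].
  by rewrite /mkseq -map_comp.
by rewrite -prodS_dz -!mulgA -!dzD addrC.
Qed.

Lemma rowval_conj r p Y Y' s : sv s * prodS (mkseq Y' r) = prodS (mkseq Y r) * sv (tauz (- p) s) ->
  (rowval r p Y) ^ (sv s) = rowval r p Y'.
Proof.
move=> e; apply: (mulgI (sv s)); rewrite conjgE mulVKg /rowval mulgA e -!mulgA; congr (_ * _).
by rewrite sv_dz tauzNK.
Qed.

Lemma rowval_shift r p Y : twist r p Y -> 
  (rowval r p Y) ^ (sv (Y 0)) = rowval r p (fun i => Y (i + 1)).
Proof.
move=> tY; apply: rowval_conj.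
rewrite -[X in tauz (- p) (Y X)]/0 -tY add0n.
have -> : sv (Y 0) * prodS (mkseq (fun i => Y (i + 1)) r) = prodS (mkseq Y r.+1).
  rewrite /mkseq /= (iotaDl 1 0) -map_comp; congr (_ * prodS _).
  by apply: eq_map => i /=; rewrite addnC.
by rewrite mkseqS -cats1 prodS_cat /= mulg1.
Qed.

Lemma conj_of_carries r p Y b c Y' : twist r p c ->
  (forall i, sv (Y i) = sv (c i) * sv (b i)) ->
  (forall i, sv (Y' i) = sv (b i) * sv (c i.+1)) ->
  (rowval r p Y) ^ (sv (c 0)) = rowval r p Y'.
Proof.
move=> tc h1 h2; apply: rowval_conj; rewrite -tc add0n.
elim: r {tc} => [|r IH]; first by rewrite /= mulg1 mul1g.
rewrite !mkseqS -!cats1 !prodS_cat /= !mulg1 mulgA IH -!mulgA; congr (_ * _).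
by rewrite h1 h2 !mulgA.
Qed.

Lemma conj_of_strip r p Y c Y' : strip r p Y c Y' ->
  (rowval r p Y) ^ (sv (c 0)) = rowval r p Y'.
Proof.
case=> _ _ tc h4 h5.
apply: (conj_of_carries (b := fun i => squo (c i) (Y i)) tc) => i.
  by apply: sle_sv; have /andP[] := nx_atom (h4 i).
rewrite h5; apply: sv_smul; by have /and5P[_ _ _ _ /and4P[]] := h4 i.
Qed.

Definition carries (u : simp) (Y : nat -> simp) (i : nat) : simp :=
  iteri i (fun j s => scarry s (Y j)) u.

Lemma ins_carries u Y n : let c := carries u Y in
  ins u (mkseq Y n) = mkseq (fun i => shead (c i) (Y i)) n ++ (if c n == sI then [::] else [:: c
    n]).
Proof.
have h (m : nat) (a : simp) : let c := fun i => iteri i (fun j s => scarry s (Y (m + j))) a in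
  ins a [seq Y i | i <- iota m n] =
  [seq shead (c i) (Y (m + i)) | i <- iota 0 n] ++ (if c n == sI then [::] else [:: c n]).
  elim: n m a => [|n IH] m a //=; rewrite addn0 IH /=; congr cons.
  rewrite (iotaDl 1 0) -map_comp.
  have e i : iteri i (fun j s => scarry s (Y (m.+1 + j))) (scarry a (Y m)) =
             iteri i.+1 (fun j s => scarry s (Y (m + j))) a.
    elim: i => [|i ei] /=; first by rewrite addn0.
    by rewrite ei addSnnS.
  by congr cat; [apply: eq_map => i; rewrite /= e addSnnS | rewrite e].
exact: (h 0 u).
Qed.

Lemma strip_cell s x : s != sI -> smeet (sdual s) x != sI -> scarry s x != sI ->
  shead s x != sD -> x != sD ->
  [/\ [&& slen (shead s x) == 2%N, slen x == 2%N, slen s == 1%N & slen (scarry s x) == 1%N],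
   sle s (shead s x), sle (scarry s x) (sdual (squo s (shead s x))) &
   x = out (shead s x) s (scarry s x)].
Proof.
have: all1 (fun s => all1 (fun x => [|| s == sI, smeet (sdual s) x == sI, scarry s x == sI,
  shead s x == sD, x == sD | [&& [&& slen (shead s x) == 2%N, slen x == 2%N, slen s == 1%N &
  slen (scarry s x) == 1%N], sle s (shead s x), sle (scarry s x) (sdual (squo s (shead s x))) &
   x == out (shead s x) s (scarry s x)]])) by vm_compute.
move=> /all1P/(_ s)/all1P/(_ x) + h1 h2 h3 h4 h5.
by rewrite (negPf h1) (negPf h2) (negPf h3) (negPf h4) (negPf h5) /= => /and4P[h6 h7 h8 /eqP h9].
Qed.

Lemma slw_sle s t u : slw s t -> sle u t -> slw s u.
Proof.
have := forallS3 (P := fun s t u => if slw s t then if sle u t then slw s u else true else true)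
  (ltac:(by vm_compute)) s t u.
by case: ifP => // _; case: ifP.
Qed.

Lemma normal_rcons xs x y : normal (rcons xs x) -> slw x y -> y != sI -> y != sD ->
  normal (rcons (rcons xs x) y).
Proof.
rewrite /normal ![_ \in rcons (rcons _ _) _]mem_rcons ![_ \in y :: _]inE !negb_or ![_ == y]eq_sym.
move=> /and3P[-> -> h] hxy -> -> /=.
case: xs h => [|z xs] /= h; first by rewrite hxy.
by rewrite (rcons_path _ _ (rcons xs x)) last_rcons h.
Qed.

Lemma norm_idem p xs : (norm p xs).1 = p -> norm p xs = (p, xs).
Proof.
case: xs => // x xs; case: (x =P sD) => [->|hx]; last by rewrite norm_cons.
by move=> /= e; have := norm_ge (p + 1)%R xs; rewrite e; lia.
Qed.

(** Inserting u into the row Y' must reproduce Y followed by the twisted u, so the carries form a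
    twisted sequence. Once carries and absorbed parts are all non-trivial, [strip_cell] forces
    length 2 on the letters. *)
Lemma strip_of_conj r p Y Y' u : 0 < r -> isrow r p Y -> isrow r p Y' ->
  (rowval r p Y) ^ (sv u) = rowval r p Y' -> sle u (Y 0) -> u != sI -> u != Y 0 ->
  exists c, strip r p Y c Y'.
Proof.
move=> r0 hY hY' hc uY u1 u0; have [tY nY lY] := hY; have [tY' nY' lY'] := hY'.
have hv : sv u * prodS (mkseq Y' r) = prodS (mkseq Y r) * sv (tauz (- p) u).
  apply: (mulIg (dz p)); rewrite -[LHS]mulgA -/(rowval r p Y') -hc conjgE mulVKg.
  by rewrite /rowval -!mulgA sv_dz tauzNK.
pose c := carries u Y'.
have uD : u != sD.
  apply: contraTneq uY => ->; apply/negP => h; have /andP[_ /eqP] := nY 0; apply.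
  exact: sle_anti (slesD _) h.
have nR : normal (rcons (mkseq Y r) (tauz (- p) u)).
  have := normal_row hY 0 r; rewrite -/(mkseq Y r); case: (r) r0 tY => // r' _ tY.
  rewrite mkseqS => /normal_rcons; apply; rewrite ?tauz_eq1 ?tauz_eqD //.
  apply: slw_sle (lY r') _; by rewrite -[r'.+1]add0n tY tauz_sleE.
have hins : ins u (mkseq Y' r) = rcons (mkseq Y r) (tauz (- p) u).
  have := congr1 val hv; rewrite val_svM -[sv (tauz _ _)]mulg1.
  rewrite -[sv _ * 1]/(prodS [:: tauz (- p) u]) -prodS_cat cats1 (val_prodS nR).
  rewrite (val_prodS (normal_row hY' 0 r : normal (mkseq Y' r))).
  by rewrite /lact /= tauz0 => e; have := norm_idem (congr1 fst e); rewrite e => -[].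
have [hcr hY1] : c r = tauz (- p) u /\ forall i, i < r -> Y i = shead (c i) (Y' i).
  have := ins_carries u Y' r; rewrite hins /= -/c.
  case: eqP => [_ e|_]; last first.
    rewrite cats1 => /rcons_inj[e1 ->]; split=> // i hi.
    by rewrite -(nth_mkseq sI Y hi) e1 nth_mkseq.
  by have := congr1 size e; rewrite size_rcons cats0 !size_mkseq; lia.
have tc : twist r p c.
  elim=> [|i IH]; first by rewrite add0n.
  by rewrite addSn /= -/(c _) -/(c _) IH tY' tauz_scarry.
have hY2 i : Y i = shead (c i) (Y' i).
  elim/ltn_ind: i => i IH; have [hi|hi] := ltnP i r; first exact: hY1.
  by rewrite -(subnK hi) tY tY' tc IH ?tauz_shead // ltn_subrL r0 (leq_trans r0 hi).
have cN i : c (4 * r * i)%N = u by rewrite -[(_ * _)%N]add0n (twist_per r0 tc).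
(* A trivial carry would stay trivial, yet u returns at every multiple of 4 r. *)
have c1 i : c i != sI.
  apply/eqP => e; have h j : c (i + j)%N = sI.
    by elim: j => [|j IH]; rewrite ?addn0 // addnS /= -/(c _) IH (eqP (scarry1 _)).
  move/eqP: u1; apply; rewrite -(cN i) -(h (4 * r * i - i)%N) subnKC //; nia.
pose b i := smeet (sdual (c i)) (Y' i).
(* If nothing of a letter is absorbed, the whole letter is carried on and nothing is absorbed
   afterwards; by periodicity this reaches index 0 and gives [u = Y 0]. *)
have b1 i : b i != sI.
  apply/eqP => e; have h j : b (i + j)%N = sI.
    elim: j => [|j IH]; rewrite ?addn0 // addnS /b.
    have -> : c (i + j).+1 = Y' (i + j)%N.
      rewrite /= -/(c _) /scarry -/(b _) IH.
      by apply/eqP; move: (Y' _); apply: forallS; vm_compute.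
    exact/eqP/lY'.
  have := h (4 * r * i - i)%N; rewrite subnKC; last by nia.
  rewrite /b cN -[(4 * r * i)%N]add0n (twist_per r0 tY') => e0.
  move/eqP: u0; apply; rewrite hY2 /= /shead e0.
  exact/esym/eqP/smul1.
have cell i := strip_cell (c1 i) (b1 i) (c1 i.+1).
have {}cell i : [/\ [&& slen (Y i) == 2%N, slen (Y' i) == 2%N, slen (c i) == 1%N & slen (c i.+1)
  == 1%N],
   sle (c i) (Y i), sle (c i.+1) (sdual (squo (c i) (Y i))) & Y' i = out (Y i) (c i) (c i.+1)].
  rewrite hY2; apply: cell; last by case/andP: (nY' i).
  by rewrite -hY2; case/andP: (nY i).
exists c; split=> //.
- by split=> // i; have [/and4P[/eqP]] := cell i.
- by split=> // i; have [/and4P[_ /eqP]] := cell i.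
- move=> i; have [/and4P[a1 a2 a3 a4] a5 a6 _] := cell i.
  have [/and4P[d1 _ _ _] d5 _ _] := cell i.+1.
  by rewrite /nx a1 d1 lY a3 a4 a5 d5 a6.
- by move=> i; have [_ _ _] := cell i.
Qed.

Lemma sle_sI s : sle s sI -> s = sI.
Proof. by move=> h; apply: sle_anti h _; apply: (forallS (P := fun s => sle sI s)); vm_compute. Qed.

(** * Connecting rigid conjugates *)

Lemma conj_inf_meet q Y a b M : (q <= inf (Y ^ a))%R -> (q <= inf (Y ^ b))%R ->
  ple M a -> ple M b -> (forall E, ple E a -> ple E b -> ple E M) -> (q <= inf (Y ^ M))%R.
Proof.
move=> ha hb Ma Mb hM; rewrite -ple_dz_inf conjgE ple_Ml invgK.
have aux c : (q <= inf (Y ^ c))%R -> ple M c -> ple (Y^-1 * (M * dz q)) c.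
  rewrite -ple_dz_inf conjgE ple_Ml invgK => hc Mc; rewrite -ple_Ml.
  by apply: ple_trans hc; rewrite ple_dzr.
by rewrite ple_Ml; apply: hM; exact: aux.
Qed.

(** If t were a common prefix obstructing rigidity of [Y ^ M], [rig_ple] would put M t below both a
    and b, hence below their meet M. *)
Lemma rig_meet q s Y a b M : (q < s)%R -> rig q s (Y ^ a) -> rig q s (Y ^ b) ->
  ple M a -> ple M b -> (forall E, ple E a -> ple E b -> ple E M) -> rig q s (Y ^ M).
Proof.
move=> qs ha hb Ma Mb hM; have [a1 a2 _] := ha; have [b1 b2 _] := hb.
have eM : Y ^ M = (Y ^ a) ^ (a^-1 * M) by rewrite -conjgM mulVKg.
have i1 : inf (Y ^ M) = q.
  apply/le_anti/andP; split; first by rewrite eM; exact: rig_inf_max ha qs.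
  by apply: (conj_inf_meet (a := a) (b := b)); rewrite ?a1 ?b1.
have i2 : bsup (Y ^ M) = s.
  suff : inf (Y ^ M)^-1 = (- s)%R by rewrite infV => /oppr_inj.
  apply/le_anti/andP; split.
    rewrite eM -conjVg; apply: rig_inf_max (rigV ha) _; move: qs; clear; lia.
  rewrite -conjVg; apply: (conj_inf_meet (a := a) (b := b)) => //.
    by rewrite conjVg infV a2.
  by rewrite conjVg infV b2.
split=> // t h1 h2.
have aux c : ple M c -> rig q s (Y ^ c) -> ple (M * sv t) c.
  move=> Mc hc; rewrite -[c](mulVKg M) ple_mul2l; apply: (rig_ple h1 h2) => //.
  by rewrite -conjgM mulVKg.
have := hM _ (aux _ Ma ha) (aux _ Mb hb).
rewrite -[M in ple _ M]mulg1 ple_mul2l -sv1 ple_svE; exact: sle_sI.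
Qed.

Lemma sv_meet s t E : ple E (sv s) -> ple E (sv t) -> ple E (sv (smeet s t)).
Proof.
move=> hs ht; have [M [pM Ms Mt hM]] := meetP (pos_sv s) (pos_sv t).
apply: ple_trans (hM _ hs ht) _.
have eM := simple_sv pM (ple_trans Ms (ple_sv_dz1 s)).
by move: Ms Mt; rewrite eM !ple_svE => h1 h2; rewrite -(eqP (smeet_glb s t _)) h1.
Qed.

Lemma isrow_shift r p Y n : isrow r p Y -> isrow r p (fun i => Y (i + n)%N).
Proof.
by case=> h1 h2 h3; split=> i; rewrite ?addSn //; rewrite addnAC h1.
Qed.

Lemma isrow_tauz r p k Y : isrow r p Y -> isrow r p (fun i => tauz k (Y i)).
Proof.
case=> h1 h2 h3; split=> i; rewrite ?tauz_eq1 ?tauz_eqD ?tauz_slw //.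
by rewrite h1 -!tauzD addrC.
Qed.

Lemma rowval_inj r p Y Z : 0 < r -> isrow r p Y -> isrow r p Z ->
  rowval r p Y = rowval r p Z -> Y =1 Z.
Proof.
move=> r0 hY hZ /mulIg e; have [tY _ _] := hY; have [tZ _ _] := hZ.
have := congr1 val e; rewrite (val_prodS (normal_row hY 0 r : normal (mkseq Y r))).
rewrite (val_prodS (normal_row hZ 0 r : normal (mkseq Z r))) => -[{}e].
elim/ltn_ind => i IH; have [hi|hi] := ltnP i r.
  by rewrite -(nth_mkseq sI Y hi) e nth_mkseq.
by rewrite -(subnK hi) tY tZ IH // ltn_subrL r0 (leq_trans r0 hi).
Qed.

(** With $\delta^p$ moved to the left the final factor is [tauz p (Y r.-1)]; this is its
    complement. *)
Definition cophi (r : nat) (p : int) (Y : nat -> simp) : simp := sdual (tauz p (Y r.-1)).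

(** The conjugator is the inverse of the final factor times $\delta$, so it decycles and applies
    $\tau$. The shift 4 r - 1 stands for -1, by periodicity. *)
Lemma rowval_unshift r p Y : 0 < r -> twist r p Y ->
  (rowval r p Y) ^ (sv (cophi r p Y)) = rowval r p (fun i => tauz 1 (Y (i + (4 * r).-1)%N)).
Proof.
move=> r0 tY; pose Z i := Y (i + (4 * r).-1)%N.
have tZ : twist r p Z by move=> i; rewrite /Z addnAC tY.
have Z0 : Z 0 = tauz p (Y r.-1).
  rewrite /Z add0n (_ : (4 * r).-1 = r.-1 + r + r + r)%N; last by lia.
  by rewrite !tY; apply: (@tauz_inj (- p)); rewrite tauz4 tauzK.
have eY : rowval r p Y = (rowval r p Z) ^ sv (Z 0).
  rewrite rowval_shift //; apply: rowval_ext => i.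
  by rewrite /Z -addnA add1n prednK ?muln_gt0 // -[(4 * r)%N]muln1 (twist_per r0 tY).
rewrite eY -conjgM /cophi -Z0 sv_sdual; exact: rowval_tauz.
Qed.

Lemma hd_row r p Y : 0 < r -> isrow r p Y ->
  hd (rowval r p Y * dz (- p)) = Y 0 /\ hd ((rowval r p Y)^-1 * dz (p + r%:Z)) = cophi r p Y.
Proof.
move=> r0 hY; have hn : normal (mkseq Y r) := normal_row hY 0 r.
have := hd_NF p hn; rewrite size_mkseq -/(rowval r p Y) => -[|_ _ -> ->].
  by case: (r) r0.
rewrite -nth_last size_mkseq -nth0 !nth_mkseq //; last by rewrite prednK.
by rewrite tauz_sdual.
Qed.

(** The meet t of a and $\delta$ still leads to a rigid conjugate, because $\delta$ does. If t
    continues the last letter left-weightedly, the letters followed by the twisted t are in normal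
    form and the value of inf forces t below [Y 0]. Otherwise t meets [cophi], and that meet serves
    as z. *)
Lemma rig_step r p Y a : 0 < r -> isrow r p Y -> pos a -> a <> 1 ->
  rig p (p + r%:Z) (rowval r p Y ^ a) ->
  exists z, [/\ z <> sI, ple (sv z) a, rig p (p + r%:Z) (rowval r p Y ^ sv z) &
    sle z (Y 0) \/ sle z (cophi r p Y)].
Proof.
move=> r0 hY pa a1 ha; set B := rowval r p Y; have [tY nY lY] := hY.
have qs : (p < p + r%:Z)%R by lia.
pose t := hd a; have ta : ple (sv t) a := ple_hd pa.
have t1 : t <> sI by move=> e; apply: a1; exact: hd_eq1.
have rt : rig p (p + r%:Z) (B ^ sv t).
  apply: (@rig_meet _ _ B a (dz 1) _ qs ha _ ta (ple_sv_dz1 t)).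
    by rewrite rowval_tauz; apply: rowval_rig => //; exact: isrow_tauz.
  move=> E; exact: ple_hd_gen.
have [hw|hw] := boolP (slw (Y r.-1) (tauz (- p) t)).
  exists t; split=> //; left.
  have tD : t != sD.
    apply: contraTneq hw => ->; rewrite tauzsD (eqP (slwD _)).
    by have /andP[] := nY r.-1.
  have nR : normal (rcons (mkseq Y r) (tauz (- p) t)).
    have := normal_row hY 0 r; rewrite -/(mkseq Y r); case: (r) r0 hw => // r' _ hw.
    by rewrite mkseqS => /normal_rcons; apply; rewrite ?tauz_eq1 ?tauz_eqD //; apply/eqP.
  have hR : hd (prodS (rcons (mkseq Y r) (tauz (- p) t))) = Y 0.
    by rewrite hd_prodS //; case: (r) r0.
  rewrite -hR -ple_sv ?pos_prodS // -cats1 prodS_cat /= mulg1.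
  have [hi _ _] := rt.
  have : (p <= inf (B ^ sv t))%R by rewrite hi.
  rewrite -ple_dz_inf conjgE (ple_Ml (sv t)^-1) invgK /B /rowval -mulgA.
  by rewrite -[dz p * sv t](_ : sv (tauz (- p) t) * dz p = _) ?mulgA ?ple_dzr // sv_dz tauzNK.
pose z := smeet (cophi r p Y) t.
have /andP[z1 z2] := smeet_sle (cophi r p Y) t.
exists z; split; last by right.
- move=> e; move/negP: hw; apply; rewrite /slw -(tauz_eq1 p) tauz_smeet tauzNK.
  exact/eqP.
- by apply: ple_trans ta; rewrite ple_svE.
- apply: (@rig_meet _ _ B (sv (cophi r p Y)) (sv t)) => //; rewrite ?ple_svE //.
    rewrite rowval_unshift //; apply: rowval_rig => //; apply: isrow_tauz.
    exact: isrow_shift.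
  move=> E; exact: sv_meet.
Qed.

Lemma len_prodS xs : len (prodS xs) = (\sum_(x <- xs) slen x)%N.
Proof.
elim: xs => [|x xs IH] /=; first by rewrite big_nil len1.
by rewrite lenM len_sv IH big_cons PoszD.
Qed.

Lemma len_row2 r p Y : row2 r p Y -> len (rowval r p Y) = ((2 * r)%N%:Z + 3%:Z * p)%R.
Proof.
case=> _ h _; rewrite /rowval lenM len_dz len_prodS; congr (_%:Z + _)%R.
rewrite big_map (eq_bigr (fun=> 2%N)) // big_const_seq count_predT size_iota iter_addn_0.
by [].
Qed.

Lemma lenJ (g h : braid) : len (g ^ h) = len g.
Proof. by rewrite conjgE !lenM lenV addrCA addNr addr0. Qed.

Lemma row2_isrow r p Y : row2 r p Y -> isrow r p Y.
Proof.
case=> h1 h2 h3; split=> // i; have := h2 i.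
by have := forallS (P := fun y => if slen y == 2%N then (y != sI) && (y != sD) else true)
  (ltac:(by vm_compute)) (Y i); case: ifP => // /eqP.
Qed.

Lemma rig_ind r p (Q : (nat -> simp) -> Prop) : 0 < r ->
  (forall Y Z, Y =1 Z -> Q Y -> Q Z) ->
  (forall Y, Q Y -> isrow r p Y -> Q (fun i => Y (i + 1)%N)) ->
  (forall Y, Q Y -> isrow r p Y -> Q (fun i => tauz 1 (Y i))) ->
  (forall Y c Z, Q Y -> strip r p Y c Z -> Q Z) ->
  forall Y Z b, isrow r p Y -> isrow r p Z -> len (rowval r p Y) <> (r%:Z + 3%:Z * p)%R ->
    (rowval r p Y) ^ b = rowval r p Z -> Q Y -> Q Z.
Proof.
move=> r0 Qe Qs Qt Qc Y Z b hY hZ hl hb hQ.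
have Qs' n W : Q W -> isrow r p W -> Q (fun i => W (i + n)%N).
  elim: n W => [|n IH] W q w; first by apply: Qe q => i; rewrite addn0.
  apply: (Qe (fun i => W (i + n + 1)%N)); first by move=> i; rewrite -addnA addn1.
  by apply: (IH (fun i => W (i + 1)%N)); [exact: Qs | exact: isrow_shift].
have [{}b pb {}hb] := conj_pos (esym hb); move/esym: hb => hb.
have [n] := ubnP `|len b|%N; elim: n b pb Y hY hQ hl hb => // n IH b pb Y hY hQ hl hb hn.
have [b1|/eqP b1] := eqVneq b 1.
  apply: Qe hQ; apply: (rowval_inj r0 hY hZ); by rewrite -hb b1 conjg1.
have rZ : rig p (p + r%:Z) (rowval r p Y ^ b) by rewrite hb; exact: rowval_rig.
have [z [z1 zb rz hz]] := rig_step r0 hY pb b1 rZ.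
have [W hW eW] := rig_row r0 rz.
have lz : (0 < len (sv z))%R.
  rewrite len_sv; move: z1; have := forallS (P := fun z => (z == sI) || (0 < slen z)%N)
    (ltac:(by vm_compute)) z; case: eqP => //= _ h _; move: h; clear; lia.
apply: (IH ((sv z)^-1 * b) zb W hW).
- have [tY _ _] := hY; case: hz => hz.
    have [ez|nz] := eqVneq z (Y 0).
      apply: Qe (Qs _ hQ hY); apply: (rowval_inj r0 (isrow_shift 1 hY) hW).
      by rewrite -rowval_shift // -eW ez.
    have [c hc] := strip_of_conj r0 hY hW eW hz (introN eqP z1) nz.
    exact: Qc hQ hc.
  have [ez|nz] := eqVneq z (cophi r p Y).
    have hu := isrow_tauz 1 (isrow_shift (4 * r).-1 hY).
    apply: (Qe (fun i => tauz 1 (Y (i + (4 * r).-1)%N))).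
      by apply: (rowval_inj r0 hu hW); rewrite -rowval_unshift // -eW ez.
    apply: (Qt (fun i => Y (i + (4 * r).-1)%N)); last exact: isrow_shift.
    exact: Qs'.
  (* A proper prefix of the complement gives a strip for the inverse. *)
  have inv V : rig p (p + r%:Z) V -> rig (- (p + r%:Z)) (- (p + r%:Z) + r%:Z) V^-1.
    by move/rigV; rewrite opprD addrNK.
  have [V hV eV] := rig_row r0 (inv _ (rowval_rig r0 hY)).
  have [V' hV' eV'] := rig_row r0 (inv _ rz).
  have V0 : V 0 = cophi r p Y.
    have [<- _] := hd_row r0 hV; have [_ <-] := hd_row r0 hY.
    by rewrite -eV opprK.
  have [||||c [hV2 _ _ _ _]] := strip_of_conj (u := z) r0 hV hV'.
  - by rewrite -eV -eV' conjVg.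
  - by rewrite V0.
  - exact/eqP.
  - by rewrite V0.
  (* A strip needs all letters of the inverse to have length 2, which gives the row exactly the
     excluded length. *)
  case: hl; have := len_row2 hV2; rewrite -eV lenV; clear; lia.
- by rewrite -eW lenJ.
- by rewrite -eW -conjgM mulVKg.
- by move: lz hn (pos_len pb) (pos_len zb); rewrite lenM lenV; clear; lia.
Qed.

(** * Counting rigid conjugates by codes *)

Lemma size_le_codes (A C : eqType) (R : A -> C -> Prop) (s : seq A) (cs : seq C) :
  uniq s -> (forall a, a \in s -> exists2 c, c \in cs & R a c) ->
  (forall a b c, R a c -> R b c -> a = b) -> size s <= size cs.
Proof.
move=> us hs inj.
suff [ds [sz ud sub _]] : exists ds, [/\ size ds = size s, uniq ds, {subset ds <= cs} &
    forall d, d \in ds -> exists2 a, a \in s & R a d].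
  by rewrite -sz; exact: uniq_leq_size.
elim: s us hs => [|a s IH] /= us hs; first by exists [::].
case/andP: us => as_ us.
have [|ds [sz ud sub rel]] := IH us; first by move=> b hb; apply: hs; rewrite inE hb orbT.
have [c hc hac] := hs a (mem_head a s).
exists (c :: ds); split=> /=.
- by rewrite sz.
- rewrite ud andbT; apply/negP => /rel[b hb hbc]; move/negP: as_; apply.
  by rewrite (inj _ _ _ hac hbc).
- by move=> d; rewrite inE => /orP[/eqP ->|/sub].
- move=> d; rewrite inE => /orP[/eqP ->|/rel[b hb hbd]]; first by exists a; rewrite ?mem_head.
  by exists b; rewrite // inE hb orbT.
Qed.

Section Count.
Variables (r : nat) (p : int).
Hypothesis r_gt0 : 0 < r.

Definition rigconj (X y : braid) : Prop := rig p (p + r%:Z) y /\ exists b, X ^ b = y.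

Lemma row2_tauz k Y : row2 r p Y -> row2 r p (fun i => tauz k (Y i)).
Proof.
case=> h1 h2 h3; split=> i; rewrite ?slen_tauz ?tauz_slw //.
by rewrite h1 -!tauzD addrC.
Qed.

Lemma strip_tauz k Y c Z : strip r p Y c Z ->
  strip r p (fun i => tauz k (Y i)) (fun i => tauz k (c i)) (fun i => tauz k (Z i)).
Proof.
case=> h1 h2 h3 h4 h5; split; try exact: row2_tauz.
- by move=> i; rewrite h3 -!tauzD addrC.
- move=> i; move: (h4 i); rewrite /nx !slen_tauz tauz_slw !tauz_sleE -tauz_squo -tauz_sdual.
  by rewrite tauz_sleE.
- move=> i; rewrite h5 /out -tauz_squo.
  have /and5P[_ _ _ _ /and4P[_ _ _ hh]] := h4 i.
  by have [_ ->] := tauz_sle k hh.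
Qed.

(** Codes only have to follow shifts and strips: $\tau$ commutes with both, has order dividing 4,
    and is recorded separately by the factor 4. *)
Lemma count_codes (C : eqType) (cs : seq C) (cd : C -> (nat -> simp) -> Prop) (Y : nat -> simp) s :
  isrow r p Y -> len (rowval r p Y) <> (r%:Z + 3%:Z * p)%R ->
  (forall x Z, cd x Z -> x \in cs) ->
  (forall x Z Z', cd x Z -> cd x Z' -> Z =1 Z') ->
  (exists x, cd x Y) ->
  (forall x Z, cd x Z -> exists y, cd y (fun i => Z (i + 1)%N)) ->
  (forall x Z c Z', cd x Z -> strip r p Z c Z' -> exists y, cd y Z') ->
  uniq s -> (forall y, y \in s -> rigconj (rowval r p Y) y) -> size s <= 4 * size cs.
Proof.
move=> hY hl hcs hu h0 hs hc us hy.
pose Q Z := exists k x W, cd x W /\ Z =1 (fun i => tauz k (W i)).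
have QA : forall Z b, isrow r p Z -> (rowval r p Y) ^ b = rowval r p Z -> Q Z.
  move=> Z b hZ eb; apply: (@rig_ind r p Q) hY hZ hl eb _ => //.
  - by move=> U V e [k [x [W [h eU]]]]; exists k, x, W; split=> // i; rewrite -e.
  - move=> U [k [x [W [h eU]]]] _; have [y hy'] := hs _ _ h.
    by exists k, y, (fun i => W (i + 1)%N); split=> // i; rewrite eU.
  - move=> U [k [x [W [h eU]]]] _; exists (1 + k)%R, x, W; split=> // i.
    by rewrite eU tauzD.
  - move=> U c V [k [x [W [h eU]]]] /(strip_tauz (- k)) hV.
    have [|y hy'] := hc _ _ (fun i => tauz (- k) (c i)) (fun i => tauz (- k) (V i)) h.
      by apply: strip_ext hV => // i; rewrite eU tauzK.
    by exists k, y, (fun i => tauz (- k) (V i)); split=> // i; rewrite tauzNK.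
  - have [x hx] := h0; exists 0%R, x, Y; split=> // i; by rewrite tauz0.
rewrite -[4]/(size (iota 0 4)) -(size_allpairs pair).
apply: (@size_le_codes _ _ (fun y (kx : nat * C) =>
  exists2 W, cd kx.2 W & y = rowval r p (fun i => tauz kx.1%:Z (W i)))) us _ _.
  move=> y /hy[ry [b eb]]; have [Z hZ eZ] := rig_row r_gt0 ry.
  have [k [x [W [hW eW]]]] := QA Z b hZ (etrans eb eZ).
  exists (`|k %% 4|%Z%N, x).
    by apply: (@allpairs_f _ _ _ pair); [rewrite mem_iota; clear; lia | exact: hcs hW].
  exists W => //; rewrite eZ; apply: rowval_ext => i; rewrite eW /tauz.
  congr iter; rewrite /=; clear; lia.
move=> a b [k x] /= [W h1 ->] [W' h2 ->]; apply: rowval_ext => i.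
by rewrite (hu _ _ _ h1 h2).
Qed.

End Count.

Section Bound.
Variables (r : nat) (p : int).
Hypothesis r_gt0 : 0 < r.

Let N := (4 * r)%N.

Let ltN j : j %% N < N. Proof. by rewrite ltn_mod /N muln_gt0. Qed.

Variables (Y : nat -> simp) (s : seq braid).
Hypotheses (row_Y : isrow r p Y) (len_Y : len (rowval r p Y) <> (r%:Z + 3%:Z * p)%R).
Hypotheses (uniq_s : uniq s) (s_rig : forall y, y \in s -> rigconj r p (rowval r p Y) y).

(** Strips start only from rows of letters of length 2, so the class consists of shifts and their
    images under powers of $\tau$. *)
Lemma count_shifts : ~ row2 r p Y -> size s <= 4 * N.
Proof.
move=> nY; rewrite -(size_iota 0 N); have [tY _ _] := row_Y.
have modN (j i : nat) : Y (i + j %% N)%N = Y (i + j)%N.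
  by rewrite {2}(divn_eq j N) addnA addnAC mulnC (twist_per r_gt0 tY).
apply: (count_codes r_gt0 (cd := fun j Z => j < N /\ Z =1 (fun i => Y (i + j)%N)) row_Y len_Y) =>
  //.
- by move=> j Z [hj _]; rewrite mem_iota.
- by move=> j Z Z' [_ e] [_ e'] i; rewrite e e'.
- by exists 0; split=> [|i]; rewrite ?addn0 // muln_gt0.
- move=> j Z [_ e]; exists ((1 + j) %% N)%N; split=> // i.
  by rewrite modN e addnA.
- move=> j Z c Z' [_ e] [hZ _ _ _ _]; case: nY.
  have := row2_shift (N * j - j) hZ; apply: row2_ext => i; rewrite e -addnA subnK.
    by rewrite (twist_per r_gt0 tY).
  by rewrite /N; case: (r) r_gt0 => // r' _; rewrite leq_pmull // muln_gt0.
Qed.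

Definition tcodes : seq (option (simp * option simp) * nat) :=
  let os := None :: [seq Some a | a <- allS] in
  [seq (x, j) | x <- None :: [seq Some (a, o) | a <- allS, o <- os], j <- iota 0 N].

(** 211 = 1 + 14 * 15: no step at all, or a first atom followed by an optional second one. *)
Lemma count_tri : row2 r p Y -> all_tri Y -> size s <= 4 * (211 * N).
Proof.
move=> r2 tY; have -> : (211 * N = size tcodes)%N by rewrite size_allpairs size_iota.
apply: (count_codes r_gt0 (cd := tcoded r p Y) row_Y len_Y) => //.
- move=> [x j] Z [/= hj _]; apply: (@allpairs_f _ _ _ pair); last by rewrite mem_iota.
  case: x => [[a o]|]; last exact: mem_head.
  rewrite inE; apply/orP; right; apply: allpairs_f; first exact: mem_allS.
  case: o => [b|]; last exact: mem_head.
  by rewrite inE; apply/orP; right; apply: map_f; exact: mem_allS.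
- by move=> x Z Z'; exact: tcoded_uniq.
- by apply: (near_tcoded r_gt0 r2 (x := None) (j := 0) (W := Y)) => // i; rewrite addn0.
- move=> x Z [_ [W hW e]].
  by apply: (near_tcoded r_gt0 r2 (j := (1 + x.2)%N) hW) => i; rewrite e addnA.
- by move=> x Z c Z'; exact: tcoded_step.
Qed.

Lemma NB_conj m a Z : NB r p Y m a Z -> exists b, (rowval r p Y) ^ b = rowval r p Z.
Proof.
case=> Yr [cs [[hs _] e0 em _]].
suff [b hb] : exists b, (rowval r p Y) ^ b = rowval r p (Yr m).
  by exists b; rewrite hb; exact: rowval_ext.
elim: m hs {em} => [|m IH] hs.
  by exists 1; rewrite conjg1; apply: rowval_ext => i; rewrite e0.
have [|b hb] := IH; first by move=> k hk; apply: hs; exact: ltnW.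
by exists (b * sv (cs m 0)); rewrite conjgM hb; apply: conj_of_strip; exact: hs.
Qed.

Let M := ((12 * N).+2 + N)%N.

Lemma count_pairs : row2 r p Y ->
  (forall Z b, isrow r p Z -> (rowval r p Y) ^ b = rowval r p Z -> ~ all_tri Z) ->
  size s <= 4 * (M.+1 * 14 * N).
Proof.
move=> r2 nT.
have hp m a Z : NB r p Y m a Z -> exists i, ~~ tri (Z i).
  move=> h; apply: NNPP => hn; have [b hb] := NB_conj h.
  apply: (nT Z b) => //; first exact/row2_isrow/(NB_row r2 h).
  by move=> i; apply/negPn/negP => hi; apply: hn; exists i.
pose cs := [seq (x, j) | x <- [seq (m, a) | m <- iota 0 M.+1, a <- allS], j <- iota 0 N].
have -> : (M.+1 * 14 * N = size cs)%N by rewrite !size_allpairs !size_iota.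
apply: (count_codes r_gt0 (cd := coded r p Y M) row_Y len_Y) => //.
- move=> [[m a] j] Z [/= hm hj _]; apply: (@allpairs_f _ _ _ pair); last by rewrite mem_iota.
  by apply: (@allpairs_f _ _ _ pair); [rewrite mem_iota | exact: mem_allS].
- by move=> x Z Z'; exact: coded_uniq.
- have [tY _ _] := r2; apply: (NB_coded r_gt0 hp (m := 0) (a := sI) (W := Y) (j := 0)) => //.
    by exists (fun=> Y), (fun _ => Y).
  by move=> i; rewrite addn0.
- move=> x Z [_ _ [W hW e]]; have [tW _ _] := NB_row r2 hW.
  by apply: (NB_coded r_gt0 hp (j := (1 + x.2)%N) hW tW) => i; rewrite e addnA.
- by move=> x Z c Z'; exact: coded_step.
Qed.

End Bound.

(* The codes of [count_pairs] have at most 55 r path lengths, 14 initial simple elements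
   and 4 r shifts; the remaining factor 4 counts the powers of tau. *)
Lemma count_rigconj_main r p X (s : seq braid) : 0 < r -> rig p (p + r%:Z) X ->
  len X <> (r%:Z + 3%:Z * p)%R -> uniq s -> (forall y, y \in s -> rigconj r p X y) ->
  size s <= 4 * (55 * 14 * 4) * r ^ 2.
Proof.
move=> r0 hX lX us hs; have [Y hY eX] := rig_row r0 hX; rewrite eX in hs lX.
have [r2|nr2] := classic (row2 r p Y); last first.
  have := count_shifts r0 hY lX us hs nr2; move: r0; clear; nia.
have [[Z [b [hZ eb tZ]]]|hn] := classic (exists Z b,
    [/\ isrow r p Z, (rowval r p Y) ^ b = rowval r p Z & all_tri Z]); last first.
  (* There are 52 r + 3 path lengths, at most 55 r because r is positive. *)
  suff h : size s <= 4 * (((12 * (4 * r)).+2 + 4 * r).+1 * 14 * (4 * r)) by move: h; nia.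
  by apply: count_pairs us hs r2 _ => // Z b hZ eb tZ; apply: hn; exists Z, b.
have r2Z : row2 r p Z.
  case: hZ => h1 h2 h3; split=> // i; apply/eqP; move: (tZ i).
  by have := forallS (P := fun y => tri y ==> (slen y == 2%N))
    (ltac:(by vm_compute)) (Z i) => /implyP.
suff h : size s <= 4 * (211 * (4 * r)) by move: h; nia.
apply: (count_tri r0 hZ) us _ r2Z tZ; first by rewrite -eb lenJ.
move=> y /hs[ry [c ec]]; split=> //; exists (b^-1 * c).
by rewrite -eb -conjgM mulVKg.
Qed.

(* If all letters have length 1, those of the inverse have length 2. *)
Lemma count_rigconj r p X (s : seq braid) : 0 < r -> rig p (p + r%:Z) X ->
  uniq s -> (forall y, y \in s -> rigconj r p X y) -> size s <= 4 * (55 * 14 * 4) * r ^ 2.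
Proof.
move=> r0 hX us hs.
have [lX|lX] := eqVneq (len X) (r%:Z + 3%:Z * p)%R; last exact: count_rigconj_main r0 hX (elimN
  eqP lX) us hs.
have inv V : rig p (p + r%:Z) V -> rig (- (p + r%:Z)) (- (p + r%:Z) + r%:Z) V^-1.
  by move/rigV; rewrite opprD addrNK.
rewrite -(size_map (fun y : braid => y^-1) s); apply: (count_rigconj_main r0 (inv _ hX)).
- by rewrite lenV lX; move: r0; clear; lia.
- by rewrite map_inj_uniq //; exact: invg_inj.
- move=> _ /mapP[y /hs[ry [b eb]] ->]; split; first exact: inv.
  by exists b; rewrite conjVg eb.
Qed.

(** * Translation to words *)

Lemma bval_atom a : a \in atoms -> bval (dec (atom_code a)) = sv a.
Proof.
have eA : (lval (inord 0, true) = sv s12) * (lval (inord 1, true) = sv s23) *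
  (lval (inord 2, true) = sv s34) * (lval (inord 1, false) = (sv s23)^-1) *
  (lval (inord 2, false) = (sv s34)^-1).
  by rewrite /lval /= /latom !inordK.
rewrite !inE => /or4P[/eqP ->|/eqP ->|/eqP ->|/or3P[/eqP ->|/eqP ->|/eqP ->]];
  rewrite /= ?eA ?mulg1 //.
- apply: (mulgI (sv s34)); rewrite mulVKg; apply: (mulgI (sv s23)); rewrite mulVKg.
  by rewrite -!sv_smul.
- by apply: (mulgI (sv s23)); rewrite mulVKg -!sv_smul.
- by apply: (mulgI (sv s34)); rewrite mulVKg -!sv_smul.
Qed.

Lemma bval_aword l : {subset l <= atoms} -> bval (aword l) = prodS l.
Proof.
elim: l => // a l IH hl; rewrite /aword /= bval_cat bval_atom ?hl ?mem_head // -/(aword l) IH //.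
by move=> b hb; apply: hl; rewrite inE hb orbT.
Qed.

Lemma satoms_sub s : {subset satoms s <= atoms}.
Proof.
apply/allP; move: s; exact: (forallS (P := fun s => all (mem atoms) (satoms s))).
Qed.

Lemma bval_wordS s : bval (wordS s) = sv s.
Proof.
rewrite /wordS bval_aword; last exact: satoms_sub.
by case: s; rewrite /= ?sv1 ?mulg1 // -!sv_smul.
Qed.

Lemma bval_delta : bval delta = dz 1.
Proof. by rewrite -wordSD bval_wordS svD. Qed.

Lemma bval_dpow k : bval (dpow k) = dz k.
Proof.
have h (w : word) (e : int) n : bval w = dz e -> bval (flatten (nseq n w)) = dz (e *+ n).
  by move=> ew; elim: n => [|n IH]; rewrite /= ?mulr0n -?dz0 // bval_cat IH ew mulrS dzD.
case: k => n; rewrite /dpow; first by rewrite (h _ _ n bval_delta); congr dz; lia.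
rewrite (h _ (-1)%R).
  by congr dz; lia.
by rewrite bval_winv bval_delta -dzN.
Qed.

Lemma bval_surj (g : braid) : exists w, bval w = g.
Proof.
exists (dpow (inf g) ++ flatten (map wordS (fac g))); rewrite bval_cat bval_dpow [RHS]braidE.
by congr (_ * _); elim: (fac g) => //= x xs IH; rewrite bval_cat bval_wordS IH.
Qed.

Lemma bkl_gensE : bkl_gens = [seq dec (atom_code a) | a <- [:: s12; s23; s34; s13; s24; s14]].
Proof. by []. Qed.

Lemma bkl_pos_beq u v : beq u v -> bkl_pos v -> bkl_pos u.
Proof. by move=> h [l [hl e]]; exists l; split=> //; exact: beq_trans h e. Qed.

Lemma bkl_pos_cat u v : bkl_pos u -> bkl_pos v -> bkl_pos (u ++ v).
Proof.
move=> [l [hl e]] [l' [hl' e']]; exists (l ++ l'); rewrite flatten_cat; split; last exact: beq_cat.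
by move=> g; rewrite mem_cat => /orP[/hl|/hl'].
Qed.

Lemma bkl_pos_wordS s : bkl_pos (wordS s).
Proof.
exists [seq dec (atom_code a) | a <- satoms s]; split; last exact: beq_refl.
move=> _ /mapP[a /satoms_sub ha ->]; rewrite bkl_gensE; apply: (map_f (fun a => dec (atom_code a))).
by move: ha; rewrite !inE => /or4P[->|->|->|/or3P[->|->|->]]; rewrite ?orbT.
Qed.

Lemma bkl_pos_seqword xs : bkl_pos (seqword xs).
Proof.
elim: xs => [|x xs IH]; first by exists [::]; split=> //; exact: beq_refl.
exact: bkl_pos_cat (bkl_pos_wordS x) IH.
Qed.

Lemma bkl_posP w : bkl_pos w <-> pos (bval w).
Proof.
split=> [[l [hl /beqP ->]]|hw].
  elim: l hl => // g l IH hl; rewrite [flatten _]/= bval_cat; apply: posM; last first.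
    by apply: IH => h hh; apply: hl; rewrite inE hh orbT.
  have := hl g (mem_head g l); rewrite bkl_gensE => /mapP[a ha ->]; rewrite bval_atom ?pos_sv //.
  by move: ha; rewrite !inE => /or4P[->|->|->|/or3P[->|->|->]]; rewrite ?orbT.
apply: bkl_pos_beq (beq_gword w) _; apply: bkl_pos_cat (bkl_pos_seqword _).
move: hw; rewrite /pos /inf; case: (val (bval w)).1 => // n _ /=.
by elim: n => [|n IH]; [exact: (bkl_pos_seqword [::]) | exact: bkl_pos_cat (bkl_pos_wordS sD) IH].
Qed.

Lemma bprefixP u v : bprefix u v <-> ple (bval u) (bval v).
Proof. by rewrite /bprefix bkl_posP bval_cat bval_winv. Qed.

Lemma simpleP s : simple s -> bval s = sv (hd (bval s)).
Proof.
case=> /bprefixP h1 /bprefixP h2; apply: simple_sv; first by rewrite -ple1g.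
by rewrite -bval_delta.
Qed.

Lemma bval_dpartial s a : bval s = sv a -> bval (dpartial s) = sv (sdual a).
Proof.
by move=> e; rewrite /dpartial bval_cat bval_winv bval_delta e -(sv_sdual a) mulKg.
Qed.

Lemma bval_tau_pow k s a : bval s = sv a -> bval (tau_pow k s) = sv (tauz k a).
Proof.
by move=> e; rewrite /tau_pow !bval_cat !bval_dpow e sv_dz mulgA -dzD addNr dz0 mul1g.
Qed.

Lemma left_weighted_slw s t a b : bval s = sv a -> bval t = sv b -> left_weighted s t -> slw a b.
Proof.
move=> es et [_ [_ h]]; apply/eqP; apply: sle_sI; rewrite -ple_svE sv1.
have /andP[h1 h2] := smeet_sle (sdual a) b.
have := h (wordS (smeet (sdual a) b)); rewrite !bprefixP bval_wordS (bval_dpartial es) et.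
by rewrite !ple_svE; apply.
Qed.

Section LeftNF.
Variables (x : word) (p : int) (xs : seq word).
Hypothesis nf : left_nf x p xs.

Let ts := [seq hd (bval s) | s <- xs].
Let B := bval x.

Lemma nf_letter s : s \in xs -> bval s = sv (hd (bval s)).
Proof. by case: nf => _ [_ [_ [h _]]] /h[/simpleP]. Qed.

Lemma nf_normal : normal ts.
Proof.
case: nf => _ [_ [_ [h1 h2]]]; apply/and3P; split.
- apply/mapP => -[s hs e]; have [_ [h _]] := h1 s hs; apply: h; apply/beqP.
  by rewrite (nf_letter hs) -e sv1.
- apply/mapP => -[s hs e]; have [_ [_ h]] := h1 s hs; apply: h; apply/beqP.
  by rewrite (nf_letter hs) -e svD bval_delta.
- apply/(sortedP sI) => i; rewrite size_map => hi.
  rewrite !(nth_map [::]) //; last exact: ltnW.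
  by apply: left_weighted_slw (h2 i hi); apply: nf_letter; apply: mem_nth; rewrite // ltnW.
Qed.

Lemma nf_bval : B = prodS [seq tauz (- p) t | t <- ts] * dz p.
Proof.
rewrite prodS_dz -map_comp (eq_map (g := id)) ?map_id; last by move=> t; rewrite /= tauzNK.
case: nf => /beqP e _; rewrite /B e bval_cat bval_dpow; congr (_ * _).
rewrite /ts; have := nf_letter; elim: xs => //= s ys IH hl.
rewrite bval_cat IH => [|t ht]; last by apply: hl; rewrite inE ht orbT.
by congr (_ * _); apply: hl; exact: mem_head.
Qed.

Lemma nf_hd x1 rest : xs = x1 :: rest ->
  [/\ inf B = p, bsup B = (p + (size xs)%:Z)%R,
     bval (tau_pow (- p) x1) = sv (hd (B * dz (- p))) &
     bval (dpartial (last x1 rest)) = sv (hd (B^-1 * dz (p + (size xs)%:Z)))].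
Proof.
move=> e; have := hd_NF p (etrans (normal_tauz (- p) ts) nf_normal).
rewrite -nf_bval !size_map /ts e => /(_ isT) [-> -> -> ->]; split=> //.
  by apply: bval_tau_pow; apply: nf_letter; rewrite e mem_head.
rewrite (bval_dpartial (a := hd (bval (last x1 rest)))); last first.
  by apply: nf_letter; rewrite e mem_last.
congr sv; rewrite tauz_sdual; congr sdual.
by rewrite /= -map_comp (last_map (fun s => tauz (- p) (hd (bval s)))) tauzNK.
Qed.

Lemma nf_rig : rigid_nf p xs -> rig p (p + (size xs)%:Z) B.
Proof.
case exs: xs => [|x1 rest] // [_ [_ hr]]; rewrite -exs; have [h1 h2 h3 h4] := nf_hd exs.
have p1 : pos (B * dz (- p)) by rewrite /pos inf_Mdz h1 addrN.
have p2 : pos (B^-1 * dz (p + (size xs)%:Z)) by rewrite /pos inf_Mdz infV h2 addNr.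
split=> // s; rewrite !ple_sv // => a b.
have := hr (wordS s); rewrite !bprefixP bval_wordS h3 h4 !ple_svE /=.
by rewrite -[1]sv1 ple_svE => h; apply: sle_sI; exact: h.
Qed.

Lemma nf_sliding y : (xs = [::] /\ beq y x) \/
  (exists x1 rest g, xs = x1 :: rest /\
     is_meet (tau_pow (- p) x1) (dpartial (last x1 rest)) g /\ beq y (conjw x g)) ->
  exists2 g, slide (inf B) (bsup B) B g & B ^ g = bval y.
Proof.
case=> [[e /beqP ->]|[x1 [rest [g [e [[g1 [g2 g3]] /beqP ->]]]]]].
  (* Without factors the braid is $\delta^p$, inf and sup coincide, and all prefixes allowed in
     [slide] lie below 1. *)
  exists 1; last by rewrite conjg1.
  have eB : B = dz p by rewrite nf_bval /ts e /= mul1g.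
  have -> : inf B = p by rewrite eB inf_dz.
  have -> : bsup B = p by rewrite /bsup eB -dzN inf_dz opprK.
  by split; rewrite ?eB -?dzN -?dzD ?addrN ?addNr ?dz0 ?ple_refl // ple1g.
have [h1 h2 h3 h4] := nf_hd e.
exists (bval g); last by rewrite /conjw !bval_cat bval_winv conjgE.
have p1 : pos (B * dz (- p)) by rewrite /pos inf_Mdz h1 addrN.
have p2 : pos (B^-1 * dz (p + (size xs)%:Z)) by rewrite /pos inf_Mdz infV h2 addNr.
move: g1 g2; rewrite !bprefixP h3 h4 => g1 g2; rewrite h1 h2; split.
- exact: ple_trans g1 (ple_hd p1).
- exact: ple_trans g2 (ple_hd p2).
- exact: ple_trans g1 (ple_sv_dz1 _).
- move=> h a b c; have [w ew] := bval_surj h; have := g3 w.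
  by rewrite !bprefixP h3 h4 ew; apply; exact: ple_hd_gen.
Qed.

End LeftNF.

Lemma sliding_iter_bslides k x y : sliding_iter k x y -> bslides k (bval x) (bval y).
Proof.
elim: k x => [|k IH] x /=; first by move/beqP.
by case=> z [[p [xs [nf h]]] /IH hz]; have [g hg eg] := nf_sliding nf h; exists g; rewrite ?eg.
Qed.

Lemma in_SC_rigconj x p xs y : left_nf x p xs -> rigid_nf p xs -> in_SC x y ->
  rigconj (size xs) p (bval x) (bval y).
Proof.
move=> nf hr [[z /beqP ey] [k [k0 /sliding_iter_bslides hk]]].
have {}ey : bval y = bval x ^ bval z by rewrite ey /conjw !bval_cat bval_winv conjgE.
have r0 : 0 < size xs by case: xs hr {nf}.
split; last by exists (bval z).
apply: (circuit_conj_rig (b := (bval z)^-1) (nf_rig nf hr)).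
- by move: r0; clear; lia.
- by exists k.-1; rewrite prednK.
- by rewrite ey conjgK.
Qed.

Theorem theorem1p2 :
  exists K : rat, (0 < K)%R /\
    forall (x : word), pseudo_anosov x ->
    forall (p : int) (xs : seq word), left_nf x p xs -> rigid_nf p xs ->
    forall s : seq word,
      (forall y, y \in s -> in_SC x y) ->
      (forall i j, i < j -> j < size s -> ~ beq (nth [::] s i) (nth [::] s j)) ->
      ((size s)%:R <= K * (size xs)%:R ^+ 2)%R.
Proof.
exists (4 * (55 * 14 * 4))%N%:R%R; split; first by rewrite ltr0n.
move=> x _ p xs nf hr s hs us; rewrite -natrX -natrM ler_nat -(size_map bval).
apply: (count_rigconj _ (nf_rig nf hr)).
- by case: xs hr {nf}.
- apply/negPn/(uniqPn (bval [::])) => -[i [j [ij js e]]]; rewrite size_map in js.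
  apply: (us i j ij js); apply/beqP; move: e; rewrite !(nth_map [::]) //; exact: ltn_trans js.
- by move=> _ /mapP[y /hs hy ->]; exact: in_SC_rigconj hy.
Qed.
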